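(* Let $(\mathfrak g,V)$ be the pair $(\mathfrak{osp}(m|2n),\Bbbk^{m|2n})$ or the pair $(\mathfrak{pe}(n),\Bbbk^{n|n})$, and let $B$ be the $\mathfrak g$-invariant non-degenerate symmetric bilinear form on $V$ (even for $\mathfrak{osp}(m|2n)$, odd for $\mathfrak{pe}(n)$). Let $x$ be an $\mathrm{ad}$-nilpotent element in $\mathfrak g_{\bar 1}$. Then $x$ is distinguished if and only if there is a decomposition $V=\bigoplus_{i=1}^pU_i$ where the $U_i$ are mutually orthogonal (with respect to $B$), pairwise non-isomorphic indecomposable $\Bbbk[x]$-submodules. Moreover, a distinguished element $x\in\mathfrak g_{\bar 1}$ is neat if $\mathfrak g=\mathfrak{osp}(m|2n)$ and balanced if $\mathfrak g=\mathfrak{pe}(n)$.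
   Context: Base field $\Bbbk$: algebraically closed of characteristic $0$; $m,n\ge1$. $\mathfrak{osp}(m|2n)\subset\mathfrak{gl}(m|2n)$ is the Lie sub-superalgebra preserving a non-degenerate even (super)symmetric bilinear form on $\Bbbk^{m|2n}$; $\mathfrak{pe}(n)\subset\mathfrak{gl}(n|n)$ is the Lie sub-superalgebra preserving a non-degenerate odd symmetric bilinear form on $\Bbbk^{n|n}$. ''$\Bbbk[x]$-module'' means a $\mathbb Z/2$-graded module with the action of the odd operator $x$; isomorphisms are parity-preserving. An odd element $x$ is $\mathrm{ad}$-nilpotent if $[x,x]$ is a nilpotent element of the reductive Lie algebra $\mathfrak g_{\bar 0}$. It is distinguished if every semisimple element of $\mathfrak g_{\bar 0}$ (central elements of $\mathfrak g_{\bar 0}$ count as semisimple) commuting with $x$ lies in $Z(\mathfrak g)_{\bar 0}$, $Z(\mathfrak g)$ being the center of $\mathfrak g$ (which is trivial here). In these superalgebras distinguished odd elements are automatically $\mathrm{ad}$-nilpotent. Let $G$ be the corresponding supergroup, with Lie superalgebra $\mathfrak g$ and underlying group $G_{\bar 0}=SO(m)\times Sp(2n)$, resp. $GL_n$, and $\mathrm{Rep}(G)$ the category of finite-dimensional $\mathfrak g$-modules whose $\mathfrak g_{\bar 0}$-action integrates to $G_{\bar 0}$. An $\mathrm{ad}$-nilpotent $x\in\mathfrak g_{\bar 1}$ is neat if for every $M\in\mathrm{Rep}(G)$ all Jordan blocks of $x|_M$ have odd size, and balanced if for every $M\in\mathrm{Rep}(G)$ each Jordan block of $x|_M$ has size $1$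 or even size. *)

(* Defs.v *)
From mathcomp Require Import all_boot all_order all_algebra.
From mathcomp Require Import mpoly.

Set Implicit Arguments.
Unset Strict Implicit.
Unset Printing Implicit Defensive.

Import GRing.Theory.
Local Open Scope ring_scope.

(* The superspace k^{p|q} is 'cV[k]_(p + q): the first p coordinates are even,
   the last q are odd.  Parities are booleans (true = odd).  Matrices act on
   column vectors from the left. *)

Section SuperSpace.
Variables (k : fieldType) (p q : nat).
Local Notation V := 'cV[k]_(p + q).
Local Notation gl := 'M[k]_(p + q).

Definition ipar (i : 'I_(p + q)) : bool := (p <= i)%N.

Definition hvec (d : bool) (v : V) : Prop :=
  forall i, ipar i != d -> v i 0 = 0.

Definition hmx (d : bool) (X : gl) : Prop :=
  forall i j, ipar i (+) ipar j != d -> X i j = 0.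

(* The bracket of X of parity d with Y of parity e. *)
Definition sbracket (d e : bool) (X Y : gl) : gl :=
  X *m Y - (-1) ^+ (d && e) *: (Y *m X).

Definition even_part (v : V) : V := col_mx (usubmx v) 0.

(* Bilinear forms on V are given by their Gram matrices. *)
Definition bform (B : gl) (v w : V) : k := (v^T *m B *m w) 0 0.

Definition form_nondegenerate (B : gl) : Prop :=
  forall v, (forall w, bform B v w = 0) -> v = 0.

(* The form has parity b: b = false is an even form, b = true an odd one. *)
Definition form_parity (b : bool) (B : gl) : Prop :=
  forall d e v w, hvec d v -> hvec e w -> d (+) e != b -> bform B v w = 0.

Definition form_supersymmetric (B : gl) : Prop :=
  forall d e v w, hvec d v -> hvec e w ->
    bform B v w = (-1) ^+ (d && e) * bform B w v.

(* The parity-d component of the Lie superalgebra preserving B, i.e. of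
   osp(p|q) if B is even, of pe(p) if p = q and B is odd. *)
Definition in_g (B : gl) (d : bool) (X : gl) : Prop :=
  hmx d X /\
  forall e v w, hvec e v ->
    bform B (X *m v) w + (-1) ^+ (d && e) * bform B v (X *m w) = 0.

Definition in_center0 (B : gl) (Z : gl) : Prop :=
  in_g B false Z /\ forall d Y, in_g B d Y -> sbracket false d Z Y = 0.

(* Nilpotent elements of the reductive Lie algebra g_0: those of [g_0, g_0]
   whose adjoint action on g_0 is nilpotent. *)
Definition nilpotent0 (B : gl) (e : gl) : Prop :=
  (exists (r : nat) (X Y : 'I_r -> gl),
     (forall i, in_g B false (X i) /\ in_g B false (Y i)) /\
     e = \sum_i sbracket false false (X i) (Y i)) /\
  (exists N : nat, forall Y, in_g B false Y ->
     iter N (sbracket false false e) Y = 0).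

(* Semisimple elements of g_0: those whose adjoint action on g_0 is
   diagonalizable. *)
Definition semisimple0 (B : gl) (h : gl) : Prop :=
  in_g B false h /\
  forall Y, in_g B false Y ->
    exists (r : nat) (c : 'I_r -> k) (Z : 'I_r -> gl),
      (forall i, in_g B false (Z i) /\
                 sbracket false false h (Z i) = c i *: Z i) /\
      Y = \sum_i Z i.

Definition ad_nilpotent (B : gl) (x : gl) : Prop :=
  nilpotent0 B (sbracket true true x x).

Definition distinguished (B : gl) (x : gl) : Prop :=
  forall h, semisimple0 B h -> sbracket false true h x = 0 -> in_center0 B h.

(* Z/2-graded k[x]-submodules of V. *)
Definition kx_submodule (x : gl) (U : {vspace V}) : Prop :=
  forall v, v \in U -> even_part v \in U /\ x *m v \in U.

Definition kx_indecomposable (x : gl) (U : {vspace V}) : Prop :=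
  U != 0%VS /\
  forall W1 W2 : {vspace V},
    kx_submodule x W1 -> kx_submodule x W2 ->
    (W1 + W2)%VS = U -> (W1 :&: W2)%VS = 0%VS ->
    W1 = 0%VS \/ W2 = 0%VS.

(* Only the restriction of f to U matters. *)
Definition kx_isomorphic (x : gl) (U W : {vspace V}) : Prop :=
  exists f : 'End(V),
    [/\ (f @: U)%VS = W, (U :&: lker f)%VS = 0%VS,
        (forall v, v \in U -> f (x *m v) = x *m f v) &
        (forall v, v \in U -> f (even_part v) = even_part (f v))].

Definition orthogonal_decomposition (B : gl) (x : gl) : Prop :=
  exists (r : nat) (U : 'I_r -> {vspace V}),
    [/\ directv (\sum_i U i) /\ (\sum_i U i)%VS = fullv,
        (forall i, kx_submodule x (U i) /\ kx_indecomposable x (U i)),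
        (forall i j, i != j -> forall v w, v \in U i -> w \in U j ->
           bform B v w = 0) &
        (forall i j, i != j -> ~ kx_isomorphic x (U i) (U j))].

(* The underlying algebraic groups, as Zariski closed sets of even matrices.
   For B even, p = m and q = 2n: SO(m) x Sp(2n). *)
Definition in_SOSp (B : gl) (g : gl) : Prop :=
  [/\ hmx false g, (forall v w, bform B (g *m v) (g *m w) = bform B v w) &
      \det (ulsubmx g) = 1].

(* For B odd and p = q = n: restriction to the even coordinates identifies
   this group with GL_n, the form making the odd part of V dual to the even
   part. *)
Definition in_GL (B : gl) (g : gl) : Prop :=
  hmx false g /\ (forall v w, bform B (g *m v) (g *m w) = bform B v w).

(* The matrix of polynomial functions P, evaluated at the matrix g. *)
Definition mxeval N (P : 'M[{mpoly k[(p + q) * (p + q)]}]_N) (g : gl)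
    : 'M[k]_N :=
  map_mx (fun f => f.@[fun l => mxvec g 0 l]) P.

(* Its derivative at the identity matrix in the direction X. *)
Definition mxdiff1 N (P : 'M[{mpoly k[(p + q) * (p + q)]}]_N) (X : gl)
    : 'M[k]_N :=
  \sum_(l < (p + q) * (p + q))
    mxvec X 0 l *:
      map_mx (fun f => (mderiv l f).@[fun l' => mxvec (1%:M : gl) 0 l']) P.

End SuperSpace.

(* The g_0-action rho integrates to the algebraic group G: it is the
   differential of a homomorphism from G to GL(M)_0 with regular matrix
   coefficients.  The groups G considered here preserve a non-degenerate form,
   so the entries of g^-1 are polynomials in those of g, and the regular
   functions on G are the polynomials in the entries. *)
Definition integrates (k : fieldType) (p q r s : nat) (B : 'M[k]_(p + q))
    (G : 'M[k]_(p + q) -> Prop) (rho : 'M[k]_(p + q) -> 'M[k]_(r + s)) : Prop :=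
  exists P : 'M[{mpoly k[(p + q) * (p + q)]}]_(r + s),
    [/\ mxeval P 1%:M = 1%:M,
        (forall g h, G g -> G h -> mxeval P (g *m h) = mxeval P g *m mxeval P h),
        (forall g, G g -> hmx false (mxeval P g)) &
        (forall X, in_g B false X -> rho X = mxdiff1 P X)].

(* Objects of Rep(G), on the superspace k^{r|s}.  The action of g is given by
   a linear map defined on all of gl(V), of which only the restriction to g
   matters; every linear map on g has such an extension. *)
Record repG (k : fieldType) (p q : nat) (B : 'M[k]_(p + q))
    (G : 'M[k]_(p + q) -> Prop) : Type := RepG {
  rep_dim0 : nat;
  rep_dim1 : nat;
  rep_act : {linear 'M[k]_(p + q) -> 'M[k]_(rep_dim0 + rep_dim1)};
  rep_parity : forall d X, in_g B d X -> hmx d (rep_act X);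
  rep_bracket : forall d e X Y, in_g B d X -> in_g B e Y ->
    rep_act (sbracket d e X Y) = sbracket d e (rep_act X) (rep_act Y);
  rep_integrates : integrates B G rep_act
}.

Definition nil_jordan_block (k : fieldType) (n : nat) : 'M[k]_n :=
  \matrix_(i, j) (i.+1 == j :> nat)%:R.

(* A is nilpotent, with Jordan blocks of sizes s 0, s 1, ..., s (l - 1). *)
Definition nil_jordan_type (k : fieldType) (N : nat) (A : 'M[k]_N)
    (l : nat) (s : 'I_l -> nat) : Prop :=
  (forall i, (0 < s i)%N) /\
  exists (P : 'M[k]_(N, \sum_i s i)) (Q : 'M[k]_(\sum_i s i, N)),
    [/\ P *m Q = 1%:M, Q *m P = 1%:M &
        A = P *m (\mxdiag_i nil_jordan_block k (s i)) *m Q].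

Definition neat (k : fieldType) (p q : nat) (B : 'M[k]_(p + q))
    (G : 'M[k]_(p + q) -> Prop) (x : 'M[k]_(p + q)) : Prop :=
  ad_nilpotent B x /\
  forall M : repG B G, exists (l : nat) (s : 'I_l -> nat),
    nil_jordan_type (rep_act M x) s /\ forall i, odd (s i).

Definition balanced (k : fieldType) (p q : nat) (B : 'M[k]_(p + q))
    (G : 'M[k]_(p + q) -> Prop) (x : 'M[k]_(p + q)) : Prop :=
  ad_nilpotent B x /\
  forall M : repG B G, exists (l : nat) (s : 'I_l -> nat),
    nil_jordan_type (rep_act M x) s /\ forall i, s i = 1%N \/ ~~ odd (s i).

(* Main.v *)
Require Import Defs.
From mathcomp Require Import all_boot all_order all_algebra ring zify.
From Stdlib Require Import Classical.

Set Implicit Arguments.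
Unset Strict Implicit.
Unset Printing Implicit Defensive.

Import GRing.Theory.
Local Open Scope ring_scope.

(** Write G for the parity operator and a^* for the adjoint of a with respect
    to B. On the centralizer A of {G, x} the map a |-> a^* is an
    anti-involution, and its skew elements are the elements of g_0 commuting
    with x. Then x is distinguished iff all skew elements of A are nilpotent: the
    projection e onto a generalized eigenspace of a skew z with nonzero
    eigenvalue satisfies e e^* = e^* e = 0, and e - e^* is semisimple in g_0.

    If this holds and f in A is idempotent, then 1 - (f^* - f)^2 is
    invertible, so im f is nondegenerate and f can be replaced by a selfadjoint
    idempotent with the same image. Hence 1 is a sum of orthogonal selfadjoint
    primitive idempotents, and an isomorphism a between two of their images
    would make a - a^* skew and not nilpotent. Conversely, given a
    decomposition with projections e_i, the corners e_i A e_i are local and the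
    elements z of A with tr (e_i z) = 0 for all i are closed under products,
    hence nilpotent; skew elements are of this kind.

    A primitive idempotent of A has a cyclic image. Choosing the
    generators to be eigenvectors of a skew h with [h, x] = x makes the Gram
    matrix antidiagonal on each summand, so that its dimension is odd when B is
    even and even when B is odd. Diagonal formulas then complete x^2 to an sl_2-triple
    (x^2, h, f) in g_0. For osp, [h, x] = x. For pe, x = a + b with [h, a] =
    [f, a] = 0 and [h, b] = 2b. These relations survive in every
    representation, where together with the Lefschetz isomorphisms
    E^n : M_(-n) -> M_n they exclude the forbidden block sizes. *)

(** Nilpotency and semisimplicity in g_0 are tested by the adjoint action on g_0 only. Rank-one
    operators built from eigenvectors of [x * x] lie in g_0 or g_1; they turn ad-nilpotency into
    nilpotency of [x] and show that the center is trivial.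

    The parity of the dimension of a summand comes from its generator [v]: the pairing of [v] with
    [x ^+ d.-1 *m v] is nonzero, the parities of the two vectors differ by [d - 1], and the form has
    parity [b].

    For pe, the even- and the odd-numbered vectors of a chain under [x] are two chains under [x * x]
    of equal length. Both carry the same weights of a triple, so [[h, x] = x] is impossible there,
    and [x] splits into a part of weight 0 and a part of weight 2.

    In a representation, a Jordan block of size [d] yields a vector of the kernel of [x] in the
    image of [x ^+ d.-1] but not of [x ^+ d]; a size is excluded by showing, weight by weight, that
    no such vector exists. Complete reducibility is avoided: weight spaces are generalized
    eigenspaces, only highest weight vectors are shown to be eigenvectors, and the Casimir operator
    does the rest. *)

Ltac gen_mulmx := repeat match goal with |- context [@mulmx ?R ?m ?n ?p ?A ?B] =>
  let z := fresh "z" in set z := (@mulmx R m n p A B); clearbody z end.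
(** Products are first generalized to atoms, so that only a linear identity between entries is left
    to [ring]. *)
Ltac vec_ring := gen_mulmx; apply/colP => ?; rewrite !mxE; ring.

Ltac gen_mul := repeat match goal with |- context [@GRing.mul ?R ?A ?B] =>
  let z := fresh "z" in set z := (@GRing.mul R A B); clearbody z end.
Ltac mx_lin := gen_mul; apply/matrixP => ? ?; rewrite !mxE; ring.

(** * Fitting projections and nilpotent matrices *)

Lemma mx_neq0_size (k : fieldType) N (x : 'M[k]_N) : x != 0 -> (0 < N)%N.
Proof. by case: N x => // x /eqP[]; apply/matrixP => -[]. Qed.

Section SquareMatrices.
Variables (k : fieldType) (N : nat).
Implicit Types (x y z : 'M[k]_N) (v : 'cV[k]_N) (a : k) (q : {poly k}).

Lemma mulmxAv x y m (v : 'M_(N, m)) : (x * y) *m v = x *m (y *m v).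
Proof. by rewrite mulmxA. Qed.

Lemma mul1mxv m (v : 'M[k]_(N, m)) : (1 : 'M_N) *m v = v.
Proof. exact: mul1mx. Qed.

Lemma scalerMl a x y : a *: (x * y) = (a *: x) * y.
Proof. exact: scalemxAl. Qed.

Lemma scalerMr a x y : a *: (x * y) = x * (a *: y).
Proof. exact: scalemxAr. Qed.

Lemma eq_mx_vec x y : (forall v, x *m v = y *m v) -> x = y.
Proof.
move=> h; apply/matrixP => i j.
by have /matrixP/(_ i 0) := h (delta_mx j 0); rewrite -!colE !mxE.
Qed.

Lemma mx_neq0_vec x : x != 0 -> exists v, x *m v != 0.
Proof.
move=> nz; case: (pickP (fun j => x *m delta_mx j (0 : 'I_1) != 0)) => [j hj|h].
  by exists (delta_mx j 0).
case/eqP: nz; apply/matrixP => i j.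
have /negbFE/eqP := h j; rewrite -colE => /matrixP/(_ i 0).
by rewrite !mxE.
Qed.

Lemma inj_unitmx x : (forall v, x *m v = 0 -> v = 0) -> x \in unitmx.
Proof.
move=> inj; rewrite -unitmx_tr -row_free_unit.
apply: inj_row_free => v /(congr1 trmx).
rewrite trmx_mul trmxK trmx0 => /inj /(congr1 trmx).
by rewrite trmxK trmx0.
Qed.

Lemma comm_scalar a x : GRing.comm (a%:M) x.
Proof. exact/esym/scalar_mxC. Qed.

Lemma scalar_mulE a x : a%:M * x = a *: x.
Proof. exact: mul_scalar_mx. Qed.

Lemma commrZ a x y : GRing.comm x y -> GRing.comm x (a *: y).
Proof. by move=> h; rewrite /GRing.comm -scalerMr -scalerMl h. Qed.

Lemma commr_sumP (I : Type) (r : seq I) (P : pred I) (F : I -> 'M[k]_N) x :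
  (forall i, P i -> GRing.comm x (F i)) ->
  GRing.comm x (\sum_(i <- r | P i) F i).
Proof. by move=> h; apply: big_ind => //; [exact: commr0 | move=> *; exact: commrD]. Qed.

(* mathcomp's [horner_mx] only covers sizes that are syntactically positive. *)
Definition mxpol z q := \sum_(i < size q) q`_i *: z ^+ i.

Lemma comm_mxpol x z q : GRing.comm x z -> GRing.comm x (mxpol z q).
Proof. by move=> h; apply: commr_sumP => i _; apply/commrZ/commrX. Qed.

(** Write the characteristic polynomial as ['X^m * r] with [r] prime to ['X]. A Bezout relation
    between ['X^N] and [r] gives [q], because ['X^N * r] annihilates [z] by Cayley-Hamilton. *)
Lemma fitting_exists z : exists q, z ^+ N == z ^+ N * z ^+ N * mxpol z q.
Proof.
rewrite /mxpol; case: N z => [|n] z.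
  by exists 0; apply/eqP/matrixP => -[].
have hE (p : {poly k}) : \sum_(i < size p) p`_i *: z ^+ i = horner_mx z p.
  rewrite -[p in RHS]coefK poly_def linear_sum /=; apply: eq_bigr => i _.
  by rewrite linearZ /= rmorphXn /= horner_mx_X.
have [m [r nr cE]] := multiplicity_XsubC (char_poly z) 0.
rewrite subr0 in cE.
have {}nr : ~~ root r 0 := implyP nr (monic_neq0 (char_poly_monic z)).
have mN : (m <= n.+1)%N.
  have nzr : r != 0 by apply: contraNneq nr => ->; rewrite root0.
  have := size_char_poly z; rewrite cE size_Mmonic ?monicXn //.
  rewrite size_polyXn addnS /= => e.
  by rewrite -ltnS -e -add1n leq_add2r size_poly_gt0.
have /Bezout_eq1_coprimepP[[u v] /= uv] : coprimep ('X^(n.+1)) r.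
  by apply: coprimep_expl; rewrite coprimep_sym coprimepX.
exists u; rewrite hE; apply/eqP.
have hX j : z ^+ j = horner_mx z ('X^j) by rewrite rmorphXn /= horner_mx_X.
have h0 : horner_mx z ('X^(n.+1) * (v * r)) = 0.
  rewrite (_ : _ * _ = v * 'X^(n.+1 - m) * char_poly z).
    by rewrite rmorphM /= Cayley_Hamilton mulr0.
  rewrite cE mulrCA -!mulrA; congr (_ * _).
  by rewrite [RHS]mulrCA -exprD subnK // mulrC.
rewrite !hX -[in LHS](mulr1 'X^_) -uv mulrDr rmorphD /= h0 addr0.
by rewrite -!rmorphM; congr horner_mx; rewrite mulrC -!mulrA mulrC -!mulrA.
Qed.

(** A polynomial in [z] that inverts [z ^+ N] on its image. The defining relation is boolean so that
    [xchoose] applies. *)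
Definition regp z := mxpol z (xchoose (fitting_exists z)).
(* The projection onto the kernel of [z ^+ N] along its image, as a polynomial in [z]. *)
Definition nilproj z := 1 - z ^+ N * regp z.

Lemma regp_mxpol z : exists q, regp z = mxpol z q.
Proof. by eexists. Qed.

Lemma regpP z : z ^+ N * z ^+ N * regp z = z ^+ N.
Proof. by apply/esym/eqP/(xchooseP (fitting_exists z)). Qed.

Lemma comm_regp x z : GRing.comm x z -> GRing.comm x (regp z).
Proof. exact: comm_mxpol. Qed.

Lemma comm_nilproj x z : GRing.comm x z -> GRing.comm x (nilproj z).
Proof.
move=> h; apply: commrB; first exact: commr1.
by apply: commrM; [exact: commrX | exact: comm_regp].
Qed.

Lemma comm_expregp z : GRing.comm (z ^+ N) (regp z).
Proof. exact/commr_sym/commrX/commr_sym/comm_regp. Qed.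

Lemma exp_nilproj z : z ^+ N * nilproj z = 0.
Proof. by rewrite mulrBr mulr1 mulrA regpP subrr. Qed.

Lemma subr_nilproj z : 1 - nilproj z = z ^+ N * regp z.
Proof. by rewrite opprB addrC subrK. Qed.

Lemma nilproj_idem z : nilproj z * nilproj z = nilproj z.
Proof.
rewrite {1}/nilproj mulrBl mul1r comm_expregp -mulrA exp_nilproj mulr0.
by rewrite subr0.
Qed.

End SquareMatrices.

Global Opaque nilproj regp.

(** Apply the linear factors of the characteristic polynomial to [t *m v] one by one: the last
    nonzero vector is an eigenvector, and it stays in the image of [t] because the factors commute
    with [t]. *)
Lemma eigenvector_in (k : closedFieldType) N (t z : 'M[k]_N) :
  GRing.comm t z -> t != 0 ->
  exists (w : 'cV_N) c, t *m w != 0 /\ z *m (t *m w) = c *: (t *m w).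
Proof.
case: N t z => [t z _ /eqP[]|N t z tz /mx_neq0_vec[v nz]].
  by apply/matrixP => -[].
have [s sE] := closed_field_poly_normal (char_poly z).
rewrite (monicP (char_poly_monic z)) scale1r in sE.
have := Cayley_Hamilton z; rewrite sE rmorph_prod /=.
under eq_bigr => a _ do rewrite rmorphB /= horner_mx_X horner_mx_C.
move=> hs; have {sE hs} : (\prod_(a <- s) (z - a%:M)) *m (t *m v) = 0.
  by rewrite hs mul0mx.
elim: s => [|a s IH]; first by rewrite big_nil mul1mx => /eqP; rewrite (negbTE nz).
rewrite big_cons mulmxAv; set u := _ *m (t *m v).
have [u0 _|nu h] := eqVneq u 0; first exact: IH.
have uE : u = t *m (\prod_(b <- s) (z - b%:M) *m v).
  rewrite /u -!mulmxAv; congr (_ *m _); apply/commr_sym/commr_prod => b _.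
  by apply: commrB => //; apply/commr_sym/comm_scalar.
exists (\prod_(b <- s) (z - b%:M) *m v), a; rewrite -uE nu; split=> //.
by apply/eqP; rewrite -subr_eq0 -mul_scalar_mx -mulmxBl h.
Qed.

(** * Traces and nilpotency in characteristic zero *)

Section Char0.
Variables (k : fieldType) (hk : [pchar k] =i pred0).

Lemma natf_neq0_char0 n : (0 < n)%N -> n%:R != 0 :> k.
Proof. by rewrite ((pcharf0P k).1 hk) lt0n. Qed.

Lemma char0_natr_inj : injective (fun n => n%:R : k).
Proof.
move=> m n; wlog le : m n / (m <= n)%N.
  by move=> h; case/orP: (leq_total m n) => ? => [/h->|/esym/h->].
move/esym/eqP; rewrite -subr_eq0 -natrB // ((pcharf0P k).1 hk) subn_eq0 => le'.
by apply/eqP; rewrite eqn_leq le.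
Qed.

(** The trace of an idempotent is its rank: in a full-rank factorization [p = C R] one has
    [R C = 1]. *)
Lemma idem_tr0 N (p : 'M[k]_N) : p * p = p -> \tr p = 0 -> p = 0.
Proof.
move=> pp; rewrite -{1}(mulmx_base p) mxtrace_mulC.
have -> : row_base p *m col_base p = 1%:M.
  apply: (row_free_inj (row_base_free p)); rewrite mul1mx.
  have /row_full_inj := col_base_full p; apply.
  by rewrite mulmxA mulmxA mulmx_base -mulmxA mulmx_base.
rewrite mxtrace1 => /eqP; rewrite ((pcharf0P k).1 hk) mxrank_eq0.
by move/eqP.
Qed.

(** In a full-rank factorization [z = C R], the matrix [R C] has the same trace and a nilpotency
    exponent smaller by one. *)
Lemma nilp_tr0 N (z : 'M[k]_N) n : z ^+ n = 0 -> \tr z = 0.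
Proof.
elim: n N z => [|n IH] N z.
  by rewrite expr0 => h; rewrite -[z]mulr1 h mulr0 mxtrace0.
rewrite -{2}(mulmx_base z) mxtrace_mulC => h; apply: IH.
apply: (row_free_inj (row_base_free z)); rewrite mul0mx.
have /row_full_inj := col_base_full z; apply; rewrite mulmx0 -[RHS]h.
have hm m : col_base z *m ((row_base z *m col_base z) ^+ m *m row_base z) = z ^+ m.+1.
  elim: m => [|m IHm]; first by rewrite expr0 mul1mx mulmx_base.
  rewrite exprSr mulmxAv -[X in _ *m (_ *m X)]mulmxA mulmx_base.
  rewrite 2!mulmxA -(mulmxA (col_base z)) IHm.
  by rewrite [RHS]exprSr.
exact: hm.
Qed.

(** The idempotent [1 - nilproj z] is a polynomial in [z] without constant term, so its trace
    vanishes and it is zero. *)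
Lemma tr_pow0_nilp N (z : 'M[k]_N) :
  (forall n, \tr (z ^+ n.+1) = 0) -> z ^+ N = 0.
Proof.
case: N z => [z _|N z h]; first by apply/matrixP => -[].
suff h0 : 1 - nilproj z = 0.
  by rewrite -[LHS]mulr1 -[1](subrK (nilproj z)) h0 add0r exp_nilproj.
apply: idem_tr0.
  by rewrite mulrBr mulr1 mulrBl mul1r nilproj_idem subrr subr0.
have [q qE] := regp_mxpol z.
rewrite subr_nilproj qE /mxpol mulr_sumr raddf_sum big1 //= => i _.
by rewrite -scalerMr -exprD mxtraceZ h mulr0.
Qed.
End Char0.

Lemma nilp_expN (k : fieldType) N (z : 'M[k]_N) n : z ^+ n = 0 -> z ^+ N = 0.
Proof.
move=> h; have e m : z ^+ N = z ^+ N * (z ^+ N * regp z) ^+ m.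
  by elim: m => [|m IH]; rewrite ?mulr1 // exprS mulrA mulrA regpP.
case: N z h e => [z _ _|N z h e]; first by apply/matrixP => -[].
rewrite (e n) exprMn_comm; last exact: comm_expregp.
by rewrite exprAC h expr0n /=; case: n h {e} => [|n] h;
  rewrite ?mulr0n ?mulr1n ?mul0r ?mulr0 //= -[_ * _]mulr1 -(expr0 z) h mulr0.
Qed.

Lemma exp_kernel (k : fieldType) N (z : 'M[k]_N) (u : 'cV[k]_N) n :
  (0 < n)%N -> z *m u = 0 -> z ^+ n *m u = 0.
Proof. by case: n => // n _ zu; rewrite exprSr mulmxAv zu mulmx0. Qed.

(** The eigenvector is taken in the image of [1 - nilproj z], on which [z] is injective. *)
Lemma nonnilp_eigenvector (k : closedFieldType) N (z : 'M[k]_N) : z ^+ N != 0 ->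
  exists (c : k) (v : 'cV_N), [/\ c != 0, v != 0 & z *m v = c *: v].
Proof.
move=> nz; have nt : 1 - nilproj z != 0.
  apply: contraNneq nz => h.
  by rewrite -[_ ^+ N]mulr1 -[1](subrK (nilproj z)) h add0r exp_nilproj.
have ct : GRing.comm (1 - nilproj z) z.
  by apply/commr_sym/commrB; [exact: commr1 | exact/comm_nilproj/commr_refl].
have [w [c [nw wE]]] := eigenvector_in ct nt.
exists c, ((1 - nilproj z) *m w); split=> //.
apply: contraNneq nw => c0; rewrite c0 scale0r in wE.
have zz := exp_kernel (mx_neq0_size nt) wE.
have tt : (1 - nilproj z) * (1 - nilproj z) = 1 - nilproj z.
  by rewrite mulrBr mulr1 mulrBl mul1r nilproj_idem subrr subr0.
by rewrite -tt mulmxAv {1}subr_nilproj comm_expregp mulmxAv zz mulmx0.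
Qed.

(** * Primitive idempotents of a centralizer *)

Section Centralizer.
Variables (k : fieldType) (N : nat) (S : 'M[k]_N -> Prop).
Implicit Types a b e f y : 'M[k]_N.

Definition cent a := forall y, S y -> GRing.comm y a.

Lemma cent1 : cent 1. Proof. by move=> y _; exact: commr1. Qed.
Lemma centB a b : cent a -> cent b -> cent (a - b).
Proof. by move=> ha hb y Sy; apply: commrB; [exact: ha | exact: hb]. Qed.
Lemma centM a b : cent a -> cent b -> cent (a * b).
Proof. by move=> ha hb y Sy; apply: commrM; [exact: ha | exact: hb]. Qed.
Lemma centX a n : cent a -> cent (a ^+ n).
Proof. by move=> ha y Sy; apply: commrX; exact: ha. Qed.
Lemma centZ (c : k) a : cent a -> cent (c *: a).
Proof. by move=> ha y Sy; apply: commrZ; exact: ha. Qed.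
Lemma cent_nilproj a : cent a -> cent (nilproj a).
Proof. by move=> ha y Sy; apply: comm_nilproj; exact: ha. Qed.
Lemma cent_regp a : cent a -> cent (regp a).
Proof. by move=> ha y Sy; apply: comm_regp; exact: ha. Qed.

Definition in_corner e a := [/\ cent a, e * a = a & a * e = a].

Definition prim_idem e :=
  [/\ cent e, e * e = e, e != 0 &
      forall f, in_corner e f -> f * f = f -> f = 0 \/ f = e].

Lemma prim_corner e : prim_idem e -> in_corner e e.
Proof. by case. Qed.

Lemma cornerM e a b : in_corner e a -> in_corner e b -> in_corner e (a * b).
Proof.
by move=> [ca ea ae] [cb eb be]; split; [exact: centM|rewrite mulrA ea|rewrite -mulrA be].
Qed.

Lemma cornerB e a b : in_corner e a -> in_corner e b -> in_corner e (a - b).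
Proof.
move=> [ca ea ae] [cb eb be]; split; first exact: centB.
  by rewrite mulrBr ea eb.
by rewrite mulrBl ae be.
Qed.

Lemma cornerZ e c a : in_corner e a -> in_corner e (c *: a).
Proof.
by move=> [ca ea ae]; split; [exact: centZ | rewrite -scalerMr ea | rewrite -scalerMl ae].
Qed.

Lemma corner_compress e a : e * e = e -> cent e -> cent a -> in_corner e (e * a * e).
Proof.
move=> ee ce ca; split; first by apply/centM/ce/centM.
  by rewrite !mulrA ee.
by rewrite -mulrA ee.
Qed.

Lemma nilp_not_rinv e a y n : e != 0 -> a * e = a -> a * y = e -> a ^+ n = 0 -> False.
Proof.
move=> nz ae ay; elim: n => [|n IH] h.
  by move: nz; rewrite -[e]mulr1 -(expr0 a) h mulr0 eqxx.
apply: IH; case: n h => [|n] h.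
  by move: nz; rewrite -ay -[a]expr1 h mul0r eqxx.
by rewrite exprSr -[X in _ * X]ae -[X in _ * (_ * X)]ay !mulrA -!exprSr h mul0r.
Qed.

(** The idempotent [1 - nilproj a] is a multiple of [a] on both sides, hence lies in the corner of
    [e] and is [0] or [e]. Splitting one factor off [a ^+ N] exhibits the inverse in the second
    case. *)
Lemma local_nilp_or_unit e a : prim_idem e -> in_corner e a ->
  a ^+ N = 0 \/ exists y, [/\ in_corner e y, a * y = e & y * a = e].
Proof.
move=> [ce ee nz pe] [ca ea ae].
have N0 := mx_neq0_size nz.
set n := N.-1.
have fE : 1 - nilproj a = a * (a ^+ n * regp a).
  by rewrite subr_nilproj mulrA -exprS prednK.
have ca' : GRing.comm a (regp a) by exact: comm_regp.
have fE' : 1 - nilproj a = a ^+ n * regp a * a.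
  by rewrite fE; apply: commrM => //; exact: commrX.
have ff : (1 - nilproj a) * (1 - nilproj a) = 1 - nilproj a.
  by rewrite mulrBr mulr1 mulrBl mul1r nilproj_idem subrr subr0.
have cf : in_corner e (1 - nilproj a).
  split; first by apply: centB; [exact: cent1 | exact: cent_nilproj].
    by rewrite fE mulrA ea.
  by rewrite fE' -mulrA ae.
have [f0|fe] := pe _ cf ff.
  left; rewrite -[LHS]mulr1 -[1](subrK (nilproj a)) f0 add0r.
  exact: exp_nilproj.
right; exists (e * (a ^+ n * regp a) * e); split.
- apply: corner_compress => //; apply: centM; [exact: centX | exact: cent_regp].
- by rewrite !mulrA ae -(mulrA a) -fE fe ee.
- by rewrite -!mulrA ea !mulrA -(mulrA e) -mulrA -fE' fe ee.
Qed.
End Centralizer.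

(** * Local corners over an algebraically closed field *)

Section Local.
Variables (k : closedFieldType) (hk : [pchar k] =i pred0).
Variables (N : nat) (S : 'M[k]_N -> Prop).
Implicit Types a b e f y : 'M[k]_N.

(** For an eigenvalue [c] of [a] on the image of [e], the element [a - c *: e] is not invertible in
    the corner, hence nilpotent. *)
Lemma local_scalar e a : prim_idem S e -> in_corner S e a ->
  exists c, (a - c *: e) ^+ N = 0.
Proof.
move=> pe [ca ea ae]; have [ce ee nz _] := pe.
have [w [c [nw wE]]] := @eigenvector_in k N e a (etrans ea (esym ae)) nz.
exists c; have cc : in_corner S e (a - c *: e).
  by apply: cornerB; [split | apply/cornerZ/prim_corner].
have [//|[y [_ _ ya]]] := local_nilp_or_unit pe cc.
case/eqP: nw; rewrite -[e]ee mulmxAv -[X in X *m _]ya mulmxAv mulmxBl wE.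
by rewrite -scalemxAl -mulmxAv ee subrr mulmx0.
Qed.

Lemma local_nilp_tr e a : prim_idem S e -> in_corner S e a ->
  (a ^+ N = 0 <-> \tr a = 0).
Proof.
move=> pe ca; split=> [|t0]; first exact: nilp_tr0.
have [ce ee nz _] := pe; have [_ ea ae] := ca.
have [c nc] := local_scalar pe ca.
have := nilp_tr0 nc; rewrite linearB linearZ /= t0 sub0r => /eqP.
rewrite oppr_eq0 mulf_eq0 => /orP[/eqP c0|/eqP te].
  by move: nc; rewrite c0 scale0r subr0.
by case/eqP: nz; apply: (idem_tr0 hk).
Qed.

(** If [a * b] were invertible in the corner, the nilpotent [a] would have a right inverse. *)
Lemma local_nilpM e a b : prim_idem S e -> in_corner S e a -> in_corner S e b ->
  a ^+ N = 0 -> (a * b) ^+ N = 0.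
Proof.
move=> pe ca cb na; have [//|[y [cy aby _]]] := local_nilp_or_unit pe (cornerM ca cb).
have [_ _ nz _] := pe; have [_ _ ae] := ca.
by case: (nilp_not_rinv nz ae (y := b * y) _ na); rewrite mulrA.
Qed.
End Local.

(** * Splitting an idempotent into primitive ones *)

Section Decomposition.
Variables (k : fieldType) (N : nat) (S good : 'M[k]_N -> Prop).
Implicit Types a b e f : 'M[k]_N.

Lemma rank_corner e f : e * f = f -> f * e = f -> f * f = f -> f != e ->
  (\rank f < \rank e)%N.
Proof.
move=> ef fe ff ne; have le : (f <= e)%MS by rewrite -fe submxMl.
have : (f < e)%MS.
  rewrite /ltmx le; apply: contra ne => /submxP[x eE].
  by apply/eqP; rewrite -[LHS]ef eE -[LHS]/(x *m f *m f) -mulmxA [f *m f]ff.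
by rewrite ltmxErank => /andP[].
Qed.

Hypothesis good_split : forall e, good e -> e * e = e -> ~ prim_idem S e -> e != 0 ->
  exists f, [/\ good f, good (e - f), in_corner S e f, f * f = f & f != 0 /\ f != e].

(** Induction on the rank. The predicate [good] serves two cases: membership in the centralizer, for
    Jordan chains, and in addition selfadjointness, for orthogonal summands. *)
Lemma idem_decomposition e : good e -> e * e = e ->
  exists s : seq 'M[k]_N,
    [/\ e = \sum_(a <- s) a,
        forall a, a \in s -> [/\ good a, prim_idem S a, e * a = a & a * e = a] &
        pairwise (fun a b => (a * b == 0) && (b * a == 0)) s].
Proof.
have [m] := ubnP (\rank e); elim: m e => // m IH e le ge ee.
have [->|nz] := eqVneq e 0; first by exists [::]; rewrite big_nil; split.
have [pe|npe] := classic (prim_idem S e).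
  exists [:: e]; rewrite big_seq1; split => // a; rewrite inE => /eqP ->.
  by split.
have [f [gf gg [cf ef fe] ff [nf nfe]]] := good_split ge ee npe nz.
have fg : f * (e - f) = 0 by rewrite mulrBr fe ff subrr.
have gf0 : (e - f) * f = 0 by rewrite mulrBl ef ff subrr.
have eg : e * (e - f) = e - f by rewrite mulrBr ee ef.
have ge' : (e - f) * e = e - f by rewrite mulrBl ee fe.
have gg' : (e - f) * (e - f) = e - f by rewrite mulrBr ge' gf0 subr0.
have [|s1 [s1E h1 p1]] := IH f _ gf ff.
  exact: leq_trans (rank_corner ef fe ff nfe) _.
have [|s2 [s2E h2 p2]] := IH (e - f) _ gg gg'.
  have nge : e - f != e.
    by apply: contraNneq nf => h; rewrite -[f](subKr e) h subrr.
  exact: leq_trans (rank_corner eg ge' gg' nge) _.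
exists (s1 ++ s2); split.
- by rewrite big_cat /= -s1E -s2E addrC subrK.
- move=> a; rewrite mem_cat => /orP[/h1[ga pa fa af]|/h2[ga pa ga' ag]].
    by split=> //; [rewrite -fa mulrA ef | rewrite -af -mulrA fe].
  by split=> //; [rewrite -ga' mulrA eg | rewrite -ag -mulrA ge'].
- rewrite pairwise_cat p1 p2 !andbT; apply/allrelP => a b /h1[_ _ fa af] /h2[_ _ gb bg].
  have -> : a * b = a * (f * (e - f)) * b by rewrite -[in LHS]af -[in LHS]gb !mulrA.
  have -> : b * a = b * ((e - f) * f) * a by rewrite -[in LHS]bg -[in LHS]fa !mulrA.
  by rewrite fg gf0 !mulr0 !mul0r eqxx.
Qed.

End Decomposition.

Lemma cent_split (k : fieldType) (N : nat) (S : 'M[k]_N -> Prop) e :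
  cent S e -> e * e = e -> ~ prim_idem S e -> e != 0 ->
  exists f, [/\ in_corner S e f, f * f = f, f != 0 & f != e].
Proof.
move=> ce ee np nz; apply: NNPP => nex; apply: np; split=> // f cf ff.
have [->|nf] := eqVneq f 0; first by left.
have [->|nfe] := eqVneq f e; first by right.
by case: nex; exists f.
Qed.

(** * Cyclicity of primitive summands *)

Section Cyclic.
Variables (k : closedFieldType) (hk : [pchar k] =i pred0).
Variables (N : nat) (G x : 'M[k]_N) (s : k).
Hypotheses (GG : G * G = 1) (ss : s * s = 1) (Gx : G * x = s *: (x * G)).

(** The sign [s] allows two uses: the parity operator with [s = -1], and [G = 1] with [s = 1] for
    Jordan chains without grading. *)
Definition kx_gens y := y = G \/ y = x.

Lemma GxX n : G * x ^+ n = s ^+ n *: (x ^+ n * G).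
Proof.
elim: n => [|n IH]; first by rewrite !expr0 scale1r mulr1 mul1r.
rewrite [in LHS]exprSr mulrA IH -scalerMl -mulrA Gx -scalerMr scalerA -exprSr.
by rewrite mulrA -exprSr.
Qed.

Lemma homogeneous_part m (L : 'M[k]_(m, N)) (v : 'cV[k]_N) : L *m v != 0 ->
  exists e : k, [/\ e = 1 \/ e = -1, G *m (v + e *: (G *m v)) = e *: (v + e *: (G *m v))
                 & L *m (v + e *: (G *m v)) != 0].
Proof.
move=> nz.
have h e : e = 1 \/ e = -1 -> G *m (v + e *: (G *m v)) = e *: (v + e *: (G *m v)).
  move=> he; rewrite mulmxDr -scalemxAr -mulmxAv GG mul1mxv scalerDr scalerA.
  by rewrite [_ * _](_ : _ = 1) ?scale1r 1?addrC //; case: he => ->; rewrite ?mulrNN mulr1.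
have [z1|] := eqVneq (L *m (v + 1 *: (G *m v))) 0; last first.
  by exists 1; split; [left | apply: h; left | ].
exists (-1); split; [by right | by apply: h; right |].
apply: contraNneq nz => z2.
have := congr2 +%R z1 z2; rewrite -mulmxDr scaleNr scale1r addrACA subrr addr0 addr0.
rewrite -mulr2n -scaler_nat -scalemxAr => /eqP; rewrite scaler_eq0.
by rewrite (negbTE (natf_neq0_char0 hk _)).
Qed.

Lemma commr_kx y : cent kx_gens y -> GRing.comm x y.
Proof. by apply; right. Qed.
Lemma commr_kG y : cent kx_gens y -> GRing.comm G y.
Proof. by apply; left. Qed.

(* With [m] maximal such that [x ^+ m * e != 0], the operator
   [f = \sum_i x ^+ i * (v phi) * x ^+ (m - i)] lies in the corner of [e] and maps
   into the span of the [x ^+ i v]. It is not nilpotent for a suitable [phi],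
   hence invertible in this local ring, so that [v] generates the image of [e]. *)
Lemma cyclic_prim n e : x ^+ n = 0 -> prim_idem kx_gens e ->
  exists (v : 'cV[k]_N) d (c : k),
    [/\ (0 < d)%N, c = 1 \/ c = -1, e *m v = v /\ G *m v = c *: v,
        x ^+ d.-1 *m v != 0 /\ x ^+ d * e = 0 &
        forall u : 'cV[k]_N, e *m u = u -> exists al : nat -> k,
          u = \sum_(j < d) al j *: (x ^+ j *m v)].
Proof.
move=> xn pe; have [ce ee nz _] := pe.
have xe := commr_kx ce; have Ge := commr_kG ce.
have exd : exists d, x ^+ d * e == 0 by exists n; rewrite xn mul0r.
case: (ex_minnP exd) => [[|m]] /eqP xde dmin.
  by case/eqP: nz; rewrite -[e]mul1r -(expr0 x) xde.
have : x ^+ m * e != 0 by apply/negP => /dmin; rewrite ltnn.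
case/mx_neq0_vec => v0; rewrite mulmxAv => nv0.
have [c [hc Gv nv]] := homogeneous_part nv0.
move: Gv nv; set v := (_ + _) => Gv nv.
have ev : e *m v = v.
  by rewrite /v mulmxDr -scalemxAr -!mulmxAv ee -Ge -mulrA ee.
have [i ni] : exists i, (x ^+ m *m v) i 0 != 0.
  apply: NNPP => h; case/eqP: nv; apply/matrixP => i j; rewrite ord1 [in RHS]mxE.
  by apply/eqP/negPn/negP => hi; apply: h; exists i.
pose u1 := x ^+ m *m v.
have eu1 : e *m u1 = u1.
  by rewrite /u1 -mulmxAv (commrX _ (commr_sym xe)) mulmxAv ev.
pose t := s ^+ m * c.
have tt : t * t = 1.
  have cc : c * c = 1 by case: hc => ->; rewrite ?mulrNN mulr1.
  by rewrite /t mulrACA cc mulr1 -expr2 -exprM mulnC exprM expr2 ss expr1n.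
pose ph0 : 'rV[k]_N := delta_mx 0 i *m e.
(* Making [phi] an eigenvector of [G] with the eigenvalue of [u1] is what lets [f] commute with [G];
   it also doubles the value of [phi] on [u1]. *)
pose phi := ph0 + t *: (ph0 *m G).
have Gu1 : G *m u1 = t *: u1.
  by rewrite /u1 -mulmxAv GxX -scalemxAl mulmxAv Gv -scalemxAr scalerA.
have phiu : phi *m u1 = (2 * u1 i 0)%:M.
  rewrite mulmxDl -scalemxAl -mulmxA Gu1 -scalemxAr scalerA tt.
  rewrite scale1r /ph0 -mulmxA eu1 -rowE; apply/rowP => j.
  by rewrite ord1 !mxE mulr1n mulrDl mul1r.
have phiG : phi *m G = t *: phi.
  by rewrite mulmxDl -scalemxAl -mulmxA [G *m G]GG [ph0 *m 1]mulmx1 scalerDr scalerA tt scale1r addrC.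
have phie : phi *m e = phi.
  have h : ph0 *m e = ph0 by rewrite /ph0 -mulmxA [e *m e]ee.
  by rewrite mulmxDl h -scalemxAl -mulmxA [G *m e]Ge [ph0 *m _]mulmxA h.
pose f := \sum_(i < m.+1) x ^+ i * (v *m phi) * x ^+ (m - i).
have exd0 : e * x ^+ m.+1 = 0 by rewrite (commrX _ (commr_sym xe)) xde.
have ephx : phi *m x ^+ m.+1 = 0 by rewrite -phie -mulmxA [e *m _]exd0 mulmx0.
have xv : x ^+ m.+1 *m v = 0 by rewrite -ev -mulmxAv xde mul0mx.
(* The sums [x * f] and [f * x] agree after a shift of the index, up to one boundary term each;
   these contain [phi *m x ^+ m.+1] or [x ^+ m.+1 *m v], which vanish. *)
have fx : GRing.comm x f.
  rewrite /GRing.comm /f mulr_suml mulr_sumr big_ord_recr [RHS]big_ord_recl /=.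
  rewrite subn0 expr0 mul1r -[_ * _ * _ in RHS]mulrA -exprSr.
  rewrite [X in _ = X + _](_ : _ = 0); last first.
    by rewrite -[LHS]/(v *m phi *m x ^+ m.+1) -mulmxA ephx mulmx0.
  rewrite [X in _ + X](_ : _ = 0); last first.
    by rewrite !mulrA -exprS -[x ^+ m.+1 * _]/(x ^+ m.+1 *m (v *m phi)) mulmxA xv !mul0mx mul0r.
  rewrite addr0 add0r; apply: eq_bigr => j _.
  by rewrite !mulrA -exprS -[RHS]mulrA -exprSr /bump /= add1n subnSK.
have fG : GRing.comm G f.
  apply: commr_sumP => j _; rewrite /GRing.comm.
  have hx l : x ^+ l * G = s ^+ l *: (G * x ^+ l).
    by rewrite GxX scalerA -exprMn ss expr1n scale1r.
  have Gvx : G * (v *m phi) = c *: (v *m phi).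
    by rewrite -[LHS]/(G *m (v *m phi)) mulmxA Gv scalemxAl.
  have vxG : (v *m phi) * G = t *: (v *m phi).
    by rewrite -[LHS]/(v *m phi *m G) -mulmxA phiG scalemxAr.
  rewrite !mulrA GxX -!scalerMl -[x ^+ j * G * _]mulrA Gvx -scalerMr -!scalerMl scalerA.
  rewrite -[_ * _ * G in RHS]mulrA hx -scalerMr mulrA -[_ * _ * G in RHS]mulrA vxG.
  rewrite -scalerMr -scalerMl scalerA; congr (_ *: _).
  have jm : (j <= m)%N by rewrite -ltnS.
  rewrite /t mulrA -exprD; congr (_ * _).
  rewrite (_ : (m - j + m = 2 * (m - j) + j)%N); last first.
    by rewrite mul2n -addnn -addnA subnK.
  by rewrite exprD exprM expr2 ss expr1n mul1r.
have ef : e * f = f.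
  rewrite /f mulr_sumr; apply: eq_bigr => j _; rewrite !mulrA.
  rewrite (commrX _ (commr_sym xe)) -(mulrA _ e) [e * (v *m phi)]mulmxA ev //.
have fe : f * e = f.
  rewrite /f mulr_suml; apply: eq_bigr => j _; rewrite -!mulrA.
  rewrite -(commrX _ (commr_sym xe)) !mulrA; congr (_ * _).
  by rewrite -mulrA -[v *m phi * e]mulmxA phie.
have cf : in_corner kx_gens e f by split=> // y [->|->].
(* Only the last term survives, since the others apply a power of [x] above [m] to [v]. So [f] has a
   nonzero eigenvalue. *)
have fu1 : f *m u1 = (2 * u1 i 0) *: u1.
  rewrite /f big_ord_recr /= subnn expr0 mulr1 mulmxDl mulmx_suml big1 => [|j _].
    rewrite add0r mulmxAv -mulmxA phiu mul_mx_scalar -scalemxAr //.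
  rewrite !mulmxAv -mulmxA /u1 -!mulmxAv -exprD (_ : _ + _ = m - j.+1 + m.+1)%N; last first.
    by rewrite addnS -addSn subnSK.
  by rewrite exprD mulmxAv xv !mulmx0.
have n2 : 2 * u1 i 0 != 0.
  by rewrite mulf_neq0 // natf_neq0_char0.
have [fN|[y [cy fy yf]]] := local_nilp_or_unit pe cf.
  have hf l : f ^+ l *m u1 = (2 * u1 i 0) ^+ l *: u1.
    elim: l => [|l IH]; first by rewrite !expr0 mul1mxv scale1r.
    by rewrite exprSr mulmxAv fu1 -scalemxAr IH scalerA -exprS.
  move: (hf N); rewrite fN mul0mx => /esym/eqP; rewrite scaler_eq0 expf_eq0 (negbTE n2) andbF.
  by rewrite (negbTE nv).
exists v, m.+1, c; split=> // u eu.
exists (fun j => (phi *m x ^+ (m - j) *m y *m u) 0 0).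
have uE : u = f *m (y *m u) by rewrite -mulmxAv fy eu.
rewrite [LHS]uE /f mulmx_suml; apply: eq_bigr => j _.
rewrite !mulmxAv -[v *m phi *m _]mulmxA.
rewrite [phi *m _]mx11_scalar mul_mx_scalar -scalemxAr; congr (_ 0 0 *: _).
by rewrite !mulmxA.
Qed.
End Cyclic.

(** * Jordan chains *)

Section Chains.
Variables (k : fieldType) (N : nat) (x : 'M[k]_N).
Implicit Types (v : 'cV[k]_N).

(* Numbered from the socle: [chain v d 0] is killed by [x] and [chain v d d.-1] is [v]. *)
Definition chain v d a : 'cV[k]_N :=
  if (a < d)%N then x ^+ (d - a.+1) *m v else 0.

Definition chainmx v d : 'M[k]_(N, d) := \matrix_(i, a) chain v d a i 0.

Lemma col_chainmx v d (a : 'I_d) : chainmx v d *m delta_mx a 0 = chain v d a.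
Proof. by rewrite -colE; apply/colP => i; rewrite !mxE. Qed.

Lemma chain0 v d : x ^+ d *m v = 0 -> x *m chain v d 0 = 0.
Proof.
by rewrite /chain; case: d => [|d] h; rewrite ?mulmx0 // subn1 -mulmxAv -exprS.
Qed.

Lemma chainS v d a : (a.+1 < d)%N -> x *m chain v d a.+1 = chain v d a.
Proof.
by move=> ad; rewrite /chain ad (ltnW ad) -mulmxAv -exprS subnSK.
Qed.

Lemma chain_expr v d a n : x ^+ d *m v = 0 -> (a < d)%N ->
  x ^+ n *m chain v d a = if (n <= a)%N then chain v d (a - n) else 0.
Proof.
move=> xv ad; elim: n => [|n IH]; first by rewrite expr0 mul1mxv subn0.
rewrite exprS mulmxAv IH; case: (ltngtP n a) => [na|na|<-].
- by rewrite -(subnSK na) chainS // subnSK // (leq_ltn_trans _ ad) ?leq_subr.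
- by rewrite mulmx0.
- by rewrite subnn chain0.
Qed.

Lemma chain_last v d : (0 < d)%N -> chain v d d.-1 = v.
Proof. by case: d => // d _; rewrite /chain ltnSn subnn expr0 mul1mxv. Qed.

Lemma chain_comb v d (t : 'cV_d) :
  chainmx v d *m t = \sum_b t b 0 *: chain v d b.
Proof.
by apply/colP => i; rewrite !mxE summxE; apply: eq_bigr => b _; rewrite !mxE mulrC.
Qed.

(** For the largest index [a] with a nonzero coefficient, [x ^+ a] kills the chain vectors below it
    and moves the a-th one to the socle. *)
Lemma chain_top v d (t : 'cV_d) : x ^+ d *m v = 0 -> t != 0 ->
  exists a : 'I_d, [/\ t a 0 != 0, x ^+ a *m (chainmx v d *m t) = t a 0 *: chain v d 0 &
    forall c : 'I_d, (a < c)%N -> t c 0 = 0].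
Proof.
move=> xv nt.
have [a0 na0] : exists a, t a 0 != 0.
  apply: NNPP => h; case/eqP: nt; apply/colP => a; rewrite mxE.
  by apply/eqP/negPn/negP => ha; apply: h; exists a.
have [a na amax] := @arg_maxnP _ a0 (fun a => t a 0 != 0) (fun a => a : nat) na0.
have tz (c : 'I_d) : (a < c)%N -> t c 0 = 0.
  move=> ac; apply/eqP/negPn/negP => /amax ca.
  by have := leq_trans ac ca; rewrite ltnn.
exists a; split=> //.
rewrite chain_comb mulmx_sumr (bigD1 a) //=.
rewrite -scalemxAr chain_expr // leqnn subnn big1 ?addr0 => // c nc.
rewrite -scalemxAr chain_expr //; case: leqP => [ac|]; last by rewrite scaler0.
by rewrite tz ?scale0r // ltn_neqAle ac andbT; apply: contra nc => /eqP e; apply/eqP/val_inj.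
Qed.

Lemma chainmx_inj v d (t : 'cV_d) : (0 < d)%N -> x ^+ d.-1 *m v != 0 -> x ^+ d *m v = 0 ->
  chainmx v d *m t = 0 -> t = 0.
Proof.
move=> d0 nv xv h; apply/eqP/negPn/negP => /(chain_top xv)[a [na]].
rewrite h mulmx0 => /esym/eqP; rewrite scaler_eq0 (negbTE na) /= /chain d0 subn1.
by rewrite (negbTE nv).
Qed.

(** Linear independence gives a left inverse of [chainmx]; composed with [e] it becomes the
    coordinate map of the image of [e]. *)
Lemma chainmx_frame e v d : e * e = e -> GRing.comm x e -> e *m v = v ->
  (0 < d)%N -> x ^+ d.-1 *m v != 0 -> x ^+ d *m v = 0 ->
  (forall u : 'cV_N, e *m u = u -> exists al : nat -> k,
     u = \sum_(j < d) al j *: (x ^+ j *m v)) ->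
  exists Q, chainmx v d *m Q = e /\ Q *m chainmx v d = 1%:M.
Proof.
move=> ee xe ev d0 nv xv sp.
have inj (w : 'cV_d) : chainmx v d *m w = 0 -> w = 0 by exact: chainmx_inj.
have /row_freeP[L LP] : row_free (chainmx v d)^T.
  apply: inj_row_free => w /(congr1 trmx); rewrite trmx_mul trmxK trmx0.
  by move/inj/(congr1 trmx); rewrite trmxK trmx0.
have eP : e *m chainmx v d = chainmx v d.
  apply/row_matrixP => i; apply/rowP => a; rewrite !mxE.
  have : e *m chain v d a = chain v d a.
    by rewrite /chain ltn_ord -mulmxAv (commrX _ (commr_sym xe)) mulmxAv ev.
  move/colP/(_ i); rewrite !mxE => <-; apply: eq_bigr => j _; by rewrite !mxE.
have [R eR] : exists R, e = chainmx v d *m R.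
  have h j : exists w : 'cV_d, e *m delta_mx j (0 : 'I_1) = chainmx v d *m w.
    have [|al ->] := sp (e *m delta_mx j 0); first by rewrite -mulmxAv ee.
    (* The coefficients are reversed because chains are numbered from the socle. *)
    exists (\col_a al (d - a.+1)%N); apply/colP => i; rewrite !mxE summxE.
    rewrite (reindex_inj rev_ord_inj) /=; apply: eq_bigr => a _.
    by rewrite !mxE /chain ltn_ord mulrC mxE.
  have [w wE] := fin_all_exists h; exists (\matrix_(a, j) w j a 0).
  apply/matrixP => i j; have /colP/(_ i) := wE j.
  rewrite -colE !mxE => ->; apply: eq_bigr => a _; by rewrite !mxE.
have LP' : L^T *m chainmx v d = 1%:M by rewrite -[chainmx v d]trmxK -trmx_mul LP trmx1.
exists (L^T *m e); split; last by rewrite -mulmxA eP.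
by rewrite {1}eR !mulmxA -(mulmxA (chainmx v d)) LP' mulmx1 -eR.
Qed.

(** The chains together form a basis: [Q i] reads off the coordinates along the i-th chain. Keeping
    one block per chain avoids indices into a concatenated basis. *)
Definition frame r (v : 'I_r -> 'cV[k]_N) (d : 'I_r -> nat) :=
  exists Q : forall i, 'M[k]_(d i, N),
    [/\ \sum_i chainmx (v i) (d i) *m Q i = 1%:M,
        forall i, Q i *m chainmx (v i) (d i) = 1%:M &
        forall i j, i != j -> Q i *m chainmx (v j) (d j) = 0].

Definition jordan_frame r (v : 'I_r -> 'cV[k]_N) (d : 'I_r -> nat) :=
  [/\ forall i, (0 < d i)%N, forall i, x ^+ d i *m v i = 0 & frame v d].

(** With [frame_uniq], the universal property of a basis: operators are defined and compared on
    chain vectors. *)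
Lemma frame_ext r (v : 'I_r -> 'cV[k]_N) d (phi : 'I_r -> nat -> 'cV[k]_N) :
  frame v d ->
  exists X : 'M[k]_N, forall i a, (a < d i)%N -> X *m chain (v i) (d i) a = phi i a.
Proof.
move=> [Q [_ h1 h2]].
exists (\sum_i (\matrix_(b, a) phi i a b 0) *m Q i) => i a ad.
rewrite -(col_chainmx (v i) (Ordinal ad)) mulmxA mulmx_suml (bigD1 i) //=.
rewrite big1 => [|j nj]; last by rewrite -mulmxA h2 ?mulmx0.
by rewrite -mulmxA h1 mulmx1 addr0 -colE; apply/colP => b; rewrite !mxE.
Qed.

Lemma frame_uniq r (v : 'I_r -> 'cV[k]_N) d m (X Y : 'M[k]_(m, N)) :
  frame v d ->
  (forall i a, (a < d i)%N ->
     X *m chain (v i) (d i) a = Y *m chain (v i) (d i) a) -> X = Y.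
Proof.
move=> [Q [h0 _ _]] h; rewrite -[X]mulmx1 -[Y]mulmx1 -h0 !mulmx_sumr.
apply: eq_bigr => i _; rewrite !mulmxA; congr (_ *m _).
apply/matrixP => b a; have /colP/(_ b) := h i a (ltn_ord a).
rewrite !mxE => h'; rewrite -[LHS](_ : \sum_j X b j * chain (v i) (d i) a j 0 = _).
  by rewrite h'; apply: eq_bigr => j _; rewrite mxE.
by apply: eq_bigr => j _; rewrite mxE.
Qed.

Lemma frame_of_idems r (E : 'I_r -> 'M[k]_N) (v : 'I_r -> 'cV[k]_N) (d : 'I_r -> nat) :
  \sum_i E i = 1 -> (forall i j, i != j -> E i * E j = 0) ->
  (forall i, exists Q, chainmx (v i) (d i) *m Q = E i /\ Q *m chainmx (v i) (d i) = 1%:M) ->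
  frame v d.
Proof.
move=> E1 E0 hQ; have [Q hq] := fin_all_exists hQ; exists Q; split.
- by rewrite -[RHS]E1; apply: eq_bigr => i _; case: (hq i).
- by move=> i; case: (hq i).
move=> i j ij; have [pi qi] := hq i; have [pj qj] := hq j.
rewrite -[Q i]mul1mx -qi -[chainmx (v j) _]mulmx1 -qj.
rewrite !mulmxA -(mulmxA (Q i)) pi -(mulmxA (Q i)).
rewrite -(mulmxA (Q i)) -(mulmxA (E i)) pj -!mulmxA.
by rewrite (mulmxA (E i)) [E i *m E j]E0 // mul0mx mulmx0.
Qed.
End Chains.

(** Numbering from the socle agrees with [nil_jordan_block], whose column [a.+1] is the a-th basis
    vector. *)
Lemma jordan_frame_type (k : fieldType) N (x : 'M[k]_N) r (v : 'I_r -> 'cV[k]_N) d :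
  jordan_frame x v d -> nil_jordan_type x d.
Proof.
move=> [d0 xv [Q [h0 h1 h2]]]; split=> //.
exists (\mxrow_i chainmx x (v i) (d i)), (\mxcol_i Q i); split.
- by rewrite mul_mxrow_mxcol.
- rewrite mul_mxcol_mxrow -(mxdiagZ (1 : k)); apply: eq_mxblock => i j.
  by case: eqVneq => [->|ij]; [rewrite h1 conform_mx_id | exact: h2].
rewrite mul_mxrow_mxdiag -[LHS]mulmx1 -h0 -mul_mxrow_mxcol mulmxA mul_mxrow.
congr (_ *m _); apply/eq_mxrow => i; apply/matrixP => b a.
have -> : (x *m chainmx x (v i) (d i)) b a = (x *m chain x (v i) (d i) a) b 0.
  by rewrite -col_chainmx mulmxA -colE !mxE.
rewrite [RHS]mxE; case: a => [[|a] ha] /=.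
  by rewrite chain0 // mxE big1 // => c _; rewrite !mxE mulr0.
rewrite chainS // (bigD1 (Ordinal (ltnW ha))) //= !mxE eqxx mulr1 big1 ?addr0 //.
move=> c nc; rewrite !mxE eqSS (_ : (c == a :> nat) = false) ?mulr0 //.
by apply: contraNF nc => /eqP e; apply/eqP/val_inj.
Qed.

Lemma seq_idem_family (k : fieldType) N (P : 'M[k]_N -> Prop) (s : seq 'M[k]_N) :
  (forall a, a \in s -> P a) ->
  pairwise (fun a b => (a * b == 0) && (b * a == 0)) s ->
  exists r (E : 'I_r -> 'M[k]_N),
    [/\ \sum_i E i = \sum_(a <- s) a, forall i, P (E i) &
        forall i j, i != j -> E i * E j = 0].
Proof.
move=> hP /(pairwiseP 0) h; exists (size s), (fun i => s`_i); split.
- by rewrite (big_nth 0) big_mkord.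
- by move=> i; apply: hP; rewrite mem_nth.
move=> i j; rewrite neq_ltn => /orP[ij|ij].
  by have /andP[/eqP] := h i j (ltn_ord i) (ltn_ord j) ij.
by have /andP[_ /eqP] := h j i (ltn_ord j) (ltn_ord i) ij.
Qed.

Section Frames.
Variables (k : closedFieldType) (hk : [pchar k] =i pred0) (N : nat).

Lemma prim_family_frame (G x : 'M[k]_N) (s : k) n r (E : 'I_r -> 'M[k]_N) :
  G * G = 1 -> s * s = 1 -> G * x = s *: (x * G) -> x ^+ n = 0 ->
  (forall i, prim_idem (kx_gens G x) (E i)) -> \sum_i E i = 1 ->
  (forall i j, i != j -> E i * E j = 0) ->
  exists (v : 'I_r -> 'cV[k]_N) (d : 'I_r -> nat) (c : 'I_r -> k),
    jordan_frame x v d /\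
    forall i, [/\ c i = 1 \/ c i = -1, E i *m v i = v i, G *m v i = c i *: v i,
                  x ^+ (d i).-1 *m v i != 0 &
                  exists Q, chainmx x (v i) (d i) *m Q = E i /\ Q *m chainmx x (v i) (d i) = 1%:M].
Proof.
move=> GG ss Gx xn pE E1 E0.
have h i : exists p : 'cV[k]_N * nat * k,
  [/\ (0 < p.1.2)%N, p.2 = 1 \/ p.2 = -1, E i *m p.1.1 = p.1.1 /\ G *m p.1.1 = p.2 *: p.1.1,
      x ^+ p.1.2.-1 *m p.1.1 != 0 /\ x ^+ p.1.2 *m p.1.1 = 0 &
      exists Q, chainmx x p.1.1 p.1.2 *m Q = E i /\ Q *m chainmx x p.1.1 p.1.2 = 1%:M].
  have [v [d [c [d0 hc [Ev Gv] [nv xd] sp]]]] := cyclic_prim hk GG ss Gx xn (pE i).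
  have [ce ee _ _] := pE i.
  have xv : x ^+ d *m v = 0 by rewrite -Ev -mulmxAv xd mul0mx.
  exists (v, d, c); split=> //=.
  by apply: (chainmx_frame ee _ Ev d0 nv xv sp); exact: commr_kx ce.
have [p hp] := fin_all_exists h.
exists (fun i => (p i).1.1), (fun i => (p i).1.2), (fun i => (p i).2); split.
  split; [by move=> i; case: (hp i) | by move=> i; case: (hp i) => _ _ _ [] |].
  by apply: (frame_of_idems E1 E0) => i; case: (hp i).
by move=> i; case: (hp i) => _ hc [Ev Gv] [nv _] hQ; split.
Qed.

Lemma jordan_frame_exists (x : 'M[k]_N) n : x ^+ n = 0 ->
  exists r (v : 'I_r -> 'cV[k]_N) (d : 'I_r -> nat), jordan_frame x v d.
Proof.
move=> xn; pose S := kx_gens 1 x.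
have [e ce ee np nz|s [s1 sP sO]] := @idem_decomposition k N S (cent S) _ 1 (@cent1 _ _ S) (mulr1 1).
  have [f [cf ff nf nfe]] := cent_split ce ee np nz.
  by exists f; split=> //; [case: cf | apply: centB => //; case: cf].
have hP a : a \in s -> prim_idem S a by move/sP => [].
have [r [E [E1 pE E0]]] := seq_idem_family hP sO.
have Gx : 1 * x = 1 *: (x * 1) by rewrite scale1r mulr1 mul1r.
have [v [d [c [jf _]]]] := prim_family_frame (mulr1 1) (mulr1 1) Gx xn pE (etrans E1 (esym s1)) E0.
by exists r, v, d.
Qed.

(** Let [h] act by [- a] on the a-th vector of each chain; [x] lowers [a] by one. *)
Lemma nilp_commutator (x : 'M[k]_N) n : x ^+ n = 0 ->
  exists h, h * x - x * h = x.
Proof.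
move=> xn; have [r [v [d [d0 xv fr]]]] := jordan_frame_exists xn.
have [h hE] := frame_ext (fun i a => - (a%:R : k) *: chain x (v i) (d i) a) fr.
exists h; apply: (frame_uniq fr) => i [|a] ad.
  by rewrite mulmxBl !mulmxAv hE // -scalemxAr !chain0 // scaler0 mulmx0 subrr.
rewrite mulmxBl !mulmxAv hE // -scalemxAr chainS // hE ?(ltnW ad) //.
by rewrite -scalerBl opprK addrC -natrB // subSnn scale1r.
Qed.
End Frames.

(** * Representations of sl_2 *)

(** The polynomials chosen for [z] and [z'] may differ, so the relation is proved by showing that
    both off-diagonal parts of [y] for the two projections vanish. *)
Lemma nilproj_intertwine (k : fieldType) N (z z' y : 'M[k]_N) :
  z * y = y * z' -> nilproj z * y = y * nilproj z'.
Proof.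
move=> h; have hX n : z ^+ n * y = y * z' ^+ n.
  elim: n => [|n IH]; first by rewrite !expr0 mulr1 mul1r.
  by rewrite exprS -mulrA IH mulrA h -mulrA -exprS.
have h1 : nilproj z * y * (1 - nilproj z') = 0.
  by rewrite subr_nilproj !mulrA -(mulrA _ y) -hX mulrA -(comm_nilproj (commr_sym (commrX N (commr_refl z)))) exp_nilproj !mul0r.
have h2 : (1 - nilproj z) * y * nilproj z' = 0.
  by rewrite subr_nilproj comm_expregp -!mulrA [z ^+ N * _]mulrA hX -mulrA exp_nilproj !mulr0.
move: h1 h2; rewrite mulrBr mulr1 !mulrBl mul1r => /eqP; rewrite subr_eq0 => /eqP ->.
by move/eqP; rewrite subr_eq0 eq_sym => /eqP.
Qed.

Section GenWeights.
Variables (k : closedFieldType) (N : nat) (H : 'M[k]_N).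

(* The projection onto the generalized [c]-eigenspace of [H], and membership in it. *)
Definition gwp (c : k) := nilproj (H - c%:M).
Definition gw (c : k) (v : 'cV[k]_N) := gwp c *m v = v.

Lemma gw_expP c v : gw c v <-> (H - c%:M) ^+ N *m v = 0.
Proof.
rewrite /gw /gwp; set z := H - _; split=> [<-|h].
  by rewrite -mulmxAv exp_nilproj mul0mx.
apply/eqP; rewrite eq_sym -subr_eq0 -[X in X - _]mul1mxv -mulmxBl subr_nilproj.
by rewrite comm_expregp mulmxAv h mulmx0.
Qed.

Lemma gw_gwp c v : gw c (gwp c *m v).
Proof. by rewrite /gw -mulmxAv nilproj_idem. Qed.

Lemma gwp_shift X c t : H * X - X * H = t *: X -> gwp (c + t) * X = X * gwp c.
Proof.
move=> h; apply: nilproj_intertwine; apply: eq_mx_vec => v.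
have hv : H *m (X *m v) = X *m (H *m v) + t *: (X *m v).
  by rewrite -!mulmxAv scalemxAl -h mulmxBl addrC subrK.
rewrite !mulmxAv !mulmxBl hv !mulmxBr !mul_scalar_mx -!scalemxAr.
vec_ring.
Qed.

Lemma gw_shift X c t v : H * X - X * H = t *: X -> gw c v -> gw (c + t) (X *m v).
Proof.
by move=> h hv; rewrite /gw -mulmxAv (gwp_shift c h) mulmxAv hv.
Qed.

Lemma gwp_comm X c : GRing.comm X H -> GRing.comm X (gwp c).
Proof. by move=> h; apply/comm_nilproj/commrB => //; apply/commr_sym/comm_scalar. Qed.

Lemma gwp_idem c : gwp c * gwp c = gwp c.
Proof. exact: nilproj_idem. Qed.

Lemma exp_gwp c : (H - c%:M) ^+ N * gwp c = 0.
Proof. exact: exp_nilproj. Qed.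

Lemma eigen_shift_exp c d n (u : 'cV[k]_N) :
  H *m u = c *: u -> (H - d%:M) ^+ n *m u = (c - d) ^+ n *: u.
Proof.
move=> Hu; elim: n => [|n IH]; first by rewrite !expr0 mul1mxv scale1r.
rewrite exprSr mulmxAv mulmxBl Hu mul_scalar_mx -scalerBl -scalemxAr IH scalerA.
by rewrite -exprS.
Qed.

(** An eigenvector of [H] in the image of [p * q] would have both eigenvalues [a] and [b]. *)
Lemma spectral_orth (p q : 'M[k]_N) a b :
  GRing.comm p H -> GRing.comm q H -> GRing.comm p q ->
  (H - a%:M) ^+ N * p = 0 -> (H - b%:M) ^+ N * q = 0 -> a != b -> p * q = 0.
Proof.
move=> pH qH pq pa qb ab; apply/eqP/negPn/negP => nz.
have cm : GRing.comm (p * q) H by apply/commr_sym/commrM; apply/commr_sym.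
have [w [c [nw wE]]] := eigenvector_in cm nz.
have key d : (H - d%:M) ^+ N * (p * q) = 0 -> c = d.
  move=> h; have := eigen_shift_exp d N wE; rewrite -mulmxAv h mul0mx => /esym/eqP.
  rewrite scaler_eq0 (negbTE nw) orbF expf_eq0 => /andP[_].
  by rewrite subr_eq0 => /eqP.
have ca : c = a by apply: key; rewrite mulrA pa mul0r.
have cb : c = b by apply: key; rewrite pq mulrA qb mul0r.
by rewrite -ca cb eqxx in ab.
Qed.

Lemma gwp_orth a b : a != b -> gwp a * gwp b = 0.
Proof.
have cH c : GRing.comm (gwp c) H by apply/commr_sym/gwp_comm/commr_refl.
apply: spectral_orth (cH a) (cH b) _ (exp_gwp a) (exp_gwp b).
exact: gwp_comm.
Qed.

(** Otherwise the image of [1 - \sum_i p i] contains an eigenvector of [H], which some [p i] both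
    fixes and kills. *)
Lemma spectral_sum (I : finType) (f : I -> k) (p : I -> 'M[k]_N) :
  (forall i, GRing.comm H (p i)) -> (forall i, p i * p i = p i) ->
  (forall i j, i != j -> p i * p j = 0) ->
  (forall i (u : 'cV_N), (H - (f i)%:M) ^+ N *m u = 0 -> p i *m u = u) ->
  (forall c (v : 'cV[k]_N), v != 0 -> H *m v = c *: v -> exists i, c = f i) ->
  \sum_i p i = 1.
Proof.
move=> cp pp po pE hf; apply/eqP; rewrite -subr_eq0 -oppr_eq0 opprB.
apply/negPn/negP => nz.
have cm : GRing.comm (1 - \sum_i p i) H.
  by apply/commr_sym/commrB; [exact: commr1 | apply: commr_sumP].
have [w [c [nw wE]]] := eigenvector_in cm nz.
have [i ci] := hf _ _ nw wE.
have N0 := mx_neq0_size nz.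
have := pE i ((1 - \sum_i p i) *m w).
rewrite (eigen_shift_exp _ _ wE) ci subrr expr0n eqn0Ngt N0 scale0r => /(_ erefl).
rewrite -mulmxAv mulrBr mulr1 mulr_sumr (bigD1 i) //= pp big1.
  by rewrite addr0 subrr mul0mx => /esym/eqP; rewrite (negbTE nw).
by move=> j nj; apply: po; rewrite eq_sym.
Qed.

Lemma gwp_sum (I : finType) (f : I -> k) :
  injective f ->
  (forall c (v : 'cV[k]_N), v != 0 -> H *m v = c *: v -> exists i, c = f i) ->
  \sum_i gwp (f i) = 1.
Proof.
move=> fI; apply: spectral_sum.
- by move=> i; apply: gwp_comm; exact: commr_refl.
- by move=> i; exact: gwp_idem.
- by move=> i j ij; apply: gwp_orth; rewrite (inj_eq fI).
- by move=> i u /gw_expP.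
Qed.
End GenWeights.

Section Sl2.
Variables (k : closedFieldType) (hk : [pchar k] =i pred0) (N : nat).
Implicit Types (E F H : 'M[k]_N) (v u : 'cV[k]_N).

Definition sl2 E H F :=
  [/\ H * E - E * H = 2 *: E, H * F - F * H = - 2 *: F & E * F - F * E = H].

Lemma sl2_sym E H F : sl2 E H F -> sl2 F (- H) E.
Proof.
move=> [h1 h2 h3]; split.
- by rewrite mulNr mulrN opprK addrC -opprB h2 scaleNr opprK.
- by rewrite mulNr mulrN opprK addrC -opprB h1 scaleNr.
- by rewrite -h3 opprB.
Qed.

Lemma ad_expr X H t m : H * X - X * H = t *: X ->
  H * X ^+ m - X ^+ m * H = (t * m%:R) *: X ^+ m.
Proof.
move=> h; elim: m => [|m IH].
  by rewrite !expr0 mulr1 mul1r subrr mulr0 scale0r.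
rewrite exprSr -[H * _](subrK (X ^+ m * H * X)) mulrA -mulrBl IH -addrA -!mulrA -mulrBr h.
by rewrite -scalerMl -scalerMr -scalerDl -exprSr -addn1 natrD mulrDr mulr1.
Qed.

(** Commutators are traceless, so [[H, X^n] = t n X^n] makes the traces of all powers of [X]
    vanish. *)
Lemma raise_nilp X H t : t != 0 -> H * X - X * H = t *: X -> X ^+ N = 0.
Proof.
move=> nt h; apply: (tr_pow0_nilp hk) => n.
have /eqP := congr1 mxtrace (ad_expr n.+1 h); rewrite linearB /= linearZ /= mxtrace_mulC subrr.
rewrite eq_sym mulf_eq0 mulf_eq0 (negbTE nt) (negbTE (natf_neq0_char0 hk _)) //=.
by move/eqP.
Qed.

Section Rules.
Variables (E H F : 'M[k]_N).
Hypothesis h : sl2 E H F.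

Lemma sl2HE v : H *m (E *m v) = E *m (H *m v) + 2 *: (E *m v).
Proof.
by case: h => h1 _ _; rewrite -!mulmxAv scalemxAl -h1 mulmxBl addrC subrK.
Qed.
Lemma sl2HF v : H *m (F *m v) = F *m (H *m v) - 2 *: (F *m v).
Proof.
case: h => _ h2 _; rewrite -scaleNr -!mulmxAv scalemxAl -h2 mulmxBl.
by rewrite addrC subrK.
Qed.
Lemma sl2EF v : E *m (F *m v) = F *m (E *m v) + H *m v.
Proof. by case: h => _ _ h3; rewrite -[in RHS]h3 mulmxBl !mulmxAv addrC subrK. Qed.

Lemma sl2HFn n v : H *m (F ^+ n *m v) = F ^+ n *m (H *m v) - (2 * n%:R) *: (F ^+ n *m v).
Proof.
elim: n => [|n IH]; first by rewrite !expr0 !mul1mxv mulr0 scale0r subr0.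
rewrite !exprS !mulmxAv sl2HF IH mulmxBr -scalemxAr.
by vec_ring.
Qed.

Lemma sl2HEn n v : H *m (E ^+ n *m v) = E ^+ n *m (H *m v) + (2 * n%:R) *: (E ^+ n *m v).
Proof.
elim: n => [|n IH]; first by rewrite !expr0 !mul1mxv mulr0 scale0r addr0.
rewrite !exprS !mulmxAv sl2HE IH mulmxDr -scalemxAr.
by vec_ring.
Qed.

(** [H *m v] is not replaced by a multiple of [v], because the formula is also needed for
    generalized weight vectors. *)
Lemma sl2EFn n v : E *m v = 0 ->
  E *m (F ^+ n.+1 *m v) = n.+1%:R *: (F ^+ n *m (H *m v - n%:R *: v)).
Proof.
move=> Ev; elim: n => [|n IH].
  by rewrite expr1 sl2EF Ev mulmx0 add0r expr0 mul1mxv scale0r subr0 scale1r.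
rewrite exprS mulmxAv sl2EF IH sl2HFn !mulmxBr -!scalemxAr !mulmxBr -!scalemxAr.
rewrite -![F *m (F ^+ n *m _)]mulmxAv -!exprS.
by vec_ring.
Qed.

Lemma two_neq0 : 2 != 0 :> k. Proof. exact: (natf_neq0_char0 hk). Qed.

Lemma sl2E_nilp : E ^+ N = 0.
Proof. by case: h => h1 _ _; apply: raise_nilp two_neq0 h1. Qed.
Lemma sl2F_nilp : F ^+ N = 0.
Proof. by case: h => _ h2 _; apply: raise_nilp h2; rewrite oppr_eq0 two_neq0. Qed.

Lemma last_nonzero (X : 'M[k]_N) v : X ^+ N = 0 -> v != 0 ->
  exists m, [/\ (m <= N)%N, X ^+ m *m v != 0 & X ^+ m.+1 *m v = 0].
Proof.
move=> XN nv; have ex : exists n, X ^+ n *m v == 0 by exists N; rewrite XN mul0mx.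
case: (ex_minnP ex) => [[|m]] /eqP h0 hmin.
  by case/eqP: nv; rewrite -[v]mul1mxv -(expr0 X).
exists m; split=> //; last by apply/negP => /hmin; rewrite ltnn.
by apply/ltnW/hmin; rewrite XN mul0mx.
Qed.

Lemma hw_weight v c : v != 0 -> E *m v = 0 -> H *m v = c *: v ->
  exists m, [/\ (m <= N)%N, c = m%:R, F ^+ m *m v != 0 & F ^+ m.+1 *m v = 0].
Proof.
move=> nv Ev Hv; have [m [mN n0 z0]] := last_nonzero sl2F_nilp nv.
exists m; split=> //.
have := sl2EFn m Ev; rewrite z0 mulmx0 Hv -scalerBl -scalemxAr scalerA => /esym/eqP.
rewrite scaler_eq0 (negbTE n0) orbF mulf_eq0 (negbTE (natf_neq0_char0 hk _)) //=.
by rewrite subr_eq0 => /eqP.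
Qed.

(* Otherwise two vectors [w' = (H - c) w] and [w] generate modules of which the
   second does not terminate: once [F ^+ j w'] vanishes, [E F ^+ j.+1 w] is a nonzero
   multiple of [F ^+ j w]. *)
Lemma hw_semisimple v c : gw H c v -> E *m v = 0 -> H *m v = c *: v.
Proof.
move=> /gw_expP hv Ev; apply: NNPP => nH.
pose T := H - c%:M.
have ET (w : 'cV_N) : E *m w = 0 -> E *m (T *m w) = 0.
  move=> Ew; have := sl2HE w; rewrite Ew mulmx0 scaler0 addr0 => hE.
  by rewrite mulmxBl mulmxBr -hE mul_scalar_mx -scalemxAr Ew scaler0 subrr.
have ETn n : E *m (T ^+ n *m v) = 0.
  by elim: n => [|n IH]; rewrite ?expr0 ?mul1mxv // exprS mulmxAv ET.
have ex : exists n, T ^+ n *m v == 0 by exists N; apply/eqP.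
case: (ex_minnP ex) => [[|[|m]]] /eqP h0 hmin.
- by apply: nH; move: h0; rewrite expr0 mul1mxv => ->; rewrite mulmx0 scaler0.
- apply: nH; move: h0; rewrite expr1 mulmxBl mul_scalar_mx => /eqP.
  by rewrite subr_eq0 => /eqP.
pose w := T ^+ m *m v; pose w' := T ^+ m.+1 *m v.
have nw' : w' != 0 by apply/negP => /hmin; rewrite ltnn.
have Hw : H *m w = c *: w + w'.
  by rewrite /w' exprS mulmxAv -/w mulmxBl mul_scalar_mx addrC subrK.
have Hw' : H *m w' = c *: w'.
  apply/eqP; rewrite -subr_eq0 -mul_scalar_mx -mulmxBl -/T /w' -mulmxAv -exprS.
  by rewrite h0.
have [n [_ cn nF zF]] := hw_weight nw' (ETn _) Hw'.
have F0 j : (n < j)%N -> F ^+ j *m w' = 0.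
  by move=> nj; rewrite -(subnK nj) exprD mulmxAv zF mulmx0.
have hF j : F ^+ (n.+1 + j) *m w != 0.
  elim: j => [|j IH].
    rewrite addn0; apply: contraNneq nF => z.
    have := sl2EFn n (ETn m); rewrite -/w z mulmx0 Hw cn addrAC subrr add0r => /esym/eqP.
    by rewrite scaler_eq0 (negbTE (natf_neq0_char0 hk _)) //=.
  rewrite addnS; apply: contraNneq IH => z.
  have := sl2EFn (n.+1 + j) (ETn m); rewrite -/w z mulmx0 Hw addrAC -scalerBl.
  rewrite mulmxDr F0 ?leq_addr // addr0 -scalemxAr cn => /esym/eqP.
  rewrite !scaler_eq0 (negbTE (natf_neq0_char0 hk _)) //= subr_eq0.
  case/orP => // /eqP /(char0_natr_inj hk) /eqP.
  by rewrite addSnnS -{1}[n]addn0 eqn_add2l.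
by have := hF N; rewrite addnC exprD mulmxAv sl2F_nilp mul0mx eqxx.
Qed.

(** Twice the usual [E F + F E + H^2 / 2], which avoids fractions. *)
Definition casimir := 4 *: (F * E) + H * H + 2 *: H.

Lemma casimirE v :
  casimir *m v = 4 *: (F *m (E *m v)) + H *m (H *m v) + 2 *: (H *m v).
Proof. by rewrite !mulmxDl -!scalemxAl !mulmxAv. Qed.

Lemma casimir_commE : casimir * E = E * casimir.
Proof.
apply: eq_mx_vec => v; rewrite !mulmxAv !casimirE !mulmxDr -!scalemxAr.
rewrite sl2EF !sl2HE !mulmxDr -!scalemxAr !sl2HE.
by vec_ring.
Qed.

Lemma casimir_commH : casimir * H = H * casimir.
Proof.
apply: eq_mx_vec => v; rewrite !mulmxAv !casimirE !mulmxDr -!scalemxAr.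
rewrite sl2HF !sl2HE !mulmxDr -!scalemxAr.
by vec_ring.
Qed.

Lemma casimir_hw v c : E *m v = 0 -> H *m v = c *: v -> casimir *m v = (c * (c + 2)) *: v.
Proof. by move=> Ev Hv; rewrite casimirE Ev Hv mulmx0 -scalemxAr Hv; vec_ring. Qed.
End Rules.

Lemma casimir_sym E H F : sl2 E H F -> casimir F (- H) E = casimir E H F.
Proof.
move=> h; apply: eq_mx_vec => v; rewrite !casimirE (sl2EF h) !mulNmx mulmxN.
by vec_ring.
Qed.

Lemma casimir_commF E H F : sl2 E H F -> casimir E H F * F = F * casimir E H F.
Proof. by move=> h; rewrite -(casimir_sym h) (casimir_commE (sl2_sym h)). Qed.

Lemma gw_shiftX H X c t n v :
  H * X - X * H = t *: X -> gw H c v -> gw H (c + t * n%:R) (X ^+ n *m v).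
Proof.
move=> h hv; elim: n => [|n IH]; first by rewrite mulr0 addr0 expr0 mul1mxv.
rewrite exprS mulmxAv (_ : _ + _ = c + t * n%:R + t); last by ring.
exact: gw_shift.
Qed.

Lemma gwN H c v : gw H c v -> gw (- H) (- c) v.
Proof.
move/gw_expP => h; apply/gw_expP.
have -> : - H - (- c)%:M = - (H - c%:M) by rewrite raddfN /= opprK opprB addrC.
by rewrite exprNn; case: (odd N) => //=; rewrite mulmxAv h mulmx0.
Qed.

Lemma gwM H X c v : GRing.comm X H -> gw H c v -> gw H c (X *m v).
Proof.
by move=> cX; rewrite /gw -mulmxAv -(gwp_comm c cX) mulmxAv => ->.
Qed.

(* The Casimir operator acts on [v] through the highest weight [2 s - n] of the
   last nonzero [E ^+ s v], and through the lowest weight [- n - 2 j] of the last nonzero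
   [F ^+ j v]; these two values differ. *)
Lemma lefschetz_inj E H F n s v : sl2 E H F ->
  (s <= n)%N -> gw H (- n%:R) v -> E ^+ s *m v = 0 -> v = 0.
Proof.
move=> h; elim: s v => [|s IH] v sn hv; first by rewrite expr0 mul1mxv.
move=> Ev; have [z|nz] := eqVneq (E ^+ s *m v) 0; first exact: IH (ltnW sn) hv z.
have [h1 h2 h3] := h.
have EEv : E *m (E ^+ s *m v) = 0 by rewrite -mulmxAv -exprS.
have hw := gw_shiftX s h1 hv.
have Hu := hw_semisimple h hw EEv.
have [m [_ cm _ _]] := hw_weight h nz EEv Hu.
set c := - n%:R + _ in hw Hu cm.
pose C := casimir E H F.
have CE j (u : 'cV_N) : C *m (E ^+ j *m u) = E ^+ j *m (C *m u).
  rewrite -!mulmxAv; congr (_ *m _); apply: commrX; exact: casimir_commE.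
have CF j (u : 'cV_N) : C *m (F ^+ j *m u) = F ^+ j *m (C *m u).
  rewrite -!mulmxAv; congr (_ *m _); apply: commrX; exact: casimir_commF.
(* The difference of the two sides is again of weight [- n] and is killed by [E ^+ s], so the
   induction hypothesis applies to it. *)
have Cv : C *m v = (c * (c + 2)) *: v.
  apply/eqP; rewrite -subr_eq0 -mul_scalar_mx -mulmxBl; apply/eqP.
  apply: IH (ltnW sn) _ _.
    apply: gwM hv; apply/commr_sym/commrB; last by apply/commr_sym/comm_scalar.
    by apply/commr_sym/casimir_commH.
  by rewrite mulmxBl mulmxBr mul_scalar_mx -CE (casimir_hw F EEv Hu) -scalemxAr subrr.
have [nv|nv] := eqVneq v 0; first by [].
have [j [_ nF zF]] := last_nonzero (sl2F_nilp h) nv.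
have hs := sl2_sym h; have [g1 g2 g3] := hs.
have hw' := gw_shiftX j g1 (gwN hv).
have FF : F *m (F ^+ j *m v) = 0 by rewrite -mulmxAv -exprS.
have Hw := hw_semisimple hs hw' FF.
have := casimir_hw E FF Hw; rewrite (casimir_sym h) -/C CF Cv -scalemxAr.
move=> /eqP; rewrite -subr_eq0 -scalerBl scaler_eq0 (negbTE nF) orbF opprK cm.
have e : (m + n = 2 * s)%N.
  apply: (char0_natr_inj hk); rewrite natrD natrM -cm /c; ring.
(* Here [s < n], so [m = 2 s - n < n <= n + 2 j], while [t (t + 2)] increases strictly with [t]. *)
rewrite (_ : _ - _ = (m * (m + 2))%:R - ((n + 2 * j) * (n + 2 * j + 2))%:R); last first.
  by ring.
rewrite subr_eq0 => /eqP /(char0_natr_inj hk) e2; exfalso; nia.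
Qed.

(** By two uses of [lefschetz_inj], one for [F ^+ n] and one for [E ^+ n], the operator
    [E ^+ n * F ^+ n] is injective on the weight space of [n], hence bijective there. *)
Lemma lefschetz_surj E H F n u : sl2 E H F ->
  gw H n%:R u -> exists y, gw H (- n%:R) y /\ u = E ^+ n *m y.
Proof.
move=> h hu; have [h1 h2 h3] := h; have hs := sl2_sym h; have [g1 g2 g3] := hs.
pose p := gwp H n%:R; pose X := E ^+ n * F ^+ n.
have pp : p * p = p by exact: gwp_idem.
have gF v : gw H n%:R v -> gw H (- n%:R) (F ^+ n *m v).
  move/(gw_shiftX n h2); rewrite (_ : n%:R + _ = - n%:R) //; ring.
have cX : GRing.comm X H.
  apply: eq_mx_vec => v; rewrite !mulmxAv (sl2HEn h n) (sl2HFn h) mulmxBr -scalemxAr.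
  by vec_ring.
have pX : X * p = p * X by exact: gwp_comm.
have pu : p *m u = u by [].
have pgw v : p *m v = v -> gw H n%:R v by [].
clearbody p.
have zU : X * p + (1 - p) \in unitmx.
  apply: inj_unitmx => v hv.
  have Xp0 : X * p *m v = 0.
    have := congr1 (mulmx p) hv; rewrite mulmx0 -mulmxAv mulrDr mulrBr mulr1 pp subrr.
    by rewrite addr0 pX mulrA pp.
  have pv : p *m v = v.
    move: hv; rewrite mulmxDl Xp0 add0r mulmxBl mul1mxv => /eqP.
    by rewrite subr_eq0 => /eqP.
  move: Xp0; rewrite mulmxAv pv /X mulmxAv => hE.
  have hF := lefschetz_inj h (leqnn n) (gF _ (pgw _ pv)) hE.
  exact: lefschetz_inj hs (leqnn n) (gwN (pgw _ pv)) hF.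
have [y hy] : exists y : 'cV_N, (X * p + (1 - p)) *m y = u.
  by exists (invmx (X * p + (1 - p)) *m u); exact: mulKVmx.
exists (F ^+ n *m (p *m y)); split; first by apply/gF/pgw; rewrite -mulmxAv pp.
rewrite -[LHS]pu -hy mulmxDl mulmxDr mulmxBl mul1mxv mulmxBr -(mulmxAv p p) pp subrr.
by rewrite addr0 -mulmxAv mulrA -pX -mulrA pp !mulmxAv.
Qed.

(** If [E ^+ s *m v] is the last nonzero power on an eigenvector [v], its weight is some [m <= N];
    so the eigenvalue is [m - 2 s] with [s <= N], whence the range from [- 2 N] to [N]. *)
Lemma sl2_weights E H F : sl2 E H F ->
  \sum_(i < (2 * N + N).+1) gwp H (i%:R - (2 * N)%:R) = 1.
Proof.
move=> h; apply: gwp_sum => [i j /addIr /(char0_natr_inj hk)|c v nv Hv].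
  exact: val_inj.
have [s [sN nE zE]] := last_nonzero (sl2E_nilp h) nv.
have Hu := sl2HEn h s v; rewrite Hv -scalemxAr -scalerDl in Hu.
have Eu : E *m (E ^+ s *m v) = 0 by rewrite -mulmxAv -exprS.
have [m [mN cm _ _]] := hw_weight h nE Eu Hu.
have hi : (m + 2 * (N - s) < (2 * N + N).+1)%N by lia.
exists (Ordinal hi) => /=; rewrite natrD -cm (_ : (2 * N)%:R = (2 * (N - s))%:R + 2 * s%:R).
  by ring.
by rewrite -natrM -natrD -mulnDr subnK.
Qed.
End Sl2.

(** * Criteria for the sizes of Jordan blocks *)

Section Criteria.
Variables (k : closedFieldType) (hk : [pchar k] =i pred0) (N : nat).
Implicit Types (E F H x a b T : 'M[k]_N) (u v w : 'cV[k]_N).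

Lemma image_by_weights E H F (X : 'M[k]_N) u : sl2 E H F ->
  (forall n, exists y : 'cV_N, gwp H n%:R *m u = X *m y) ->
  (forall n, exists y : 'cV_N, gwp H (- n.+1%:R) *m u = X *m y) ->
  exists y : 'cV_N, u = X *m y.
Proof.
move=> h hp hn.
have hw (i : 'I_(2 * N + N).+1) : exists y : 'cV_N, gwp H (i%:R - (2 * N)%:R) *m u = X *m y.
  case: (leqP (2 * N) i) => le; first by rewrite -natrB.
  rewrite -opprB -natrB ?(ltnW le) // -(subnSK le); exact: hn.
have [y yE] := fin_all_exists hw; exists (\sum_i y i).
rewrite -[LHS]mul1mxv -(sl2_weights hk h) mulmx_suml mulmx_sumr.
by apply: eq_bigr => i _.
Qed.

Lemma sl2_hw_neg E H F n u : sl2 E H F -> gw H (- n.+1%:R) u -> E *m u = 0 -> u = 0.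
Proof. by move=> h hu Eu; apply: (lefschetz_inj hk (s := 1) h _ hu); rewrite ?expr1. Qed.

Section Fixed.
Variables (E F H : 'M[k]_N).
Hypothesis h : sl2 E H F.

Lemma gwp_hw c u : E *m u = 0 -> E *m (gwp H c *m u) = 0.
Proof.
by have [h1 _ _] := h; move=> Eu; rewrite -mulmxAv -(gwp_shift c h1) mulmxAv Eu mulmx0.
Qed.

Lemma gwp_neg_hw n u : E *m u = 0 -> gwp H (- n.+1%:R) *m u = 0.
Proof. by move=> Eu; apply: (sl2_hw_neg (n := n) h (gw_gwp _ _ _)); apply: gwp_hw. Qed.

(* In weight [n >= c], [u] is in the image of [E ^+ n] by the Lefschetz isomorphism. In
   weight [n < c], it is [x ^+ (2 c - 1) w] with [w] of weight [- j], [j = 2 c - 1 - n >= c];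
   then [E ^+ j w = 0] and so [w = 0]. *)
Lemma odd_chain x c u w : H * x - x * H = x -> x * x = E -> (0 < c)%N ->
  u = x ^+ (2 * c).-1 *m w -> x *m u = 0 -> exists y : 'cV_N, u = x ^+ (2 * c) *m y.
Proof.
move=> hx xx c0 uE xu.
have hx1 : H * x - x * H = 1 *: x by rewrite scale1r.
have Ex m : E ^+ m = x ^+ (2 * m) by rewrite exprM expr2 xx.
have Eu : E *m u = 0 by rewrite -xx mulmxAv xu mulmx0.
apply: (image_by_weights h) => n; last by exists 0; rewrite mulmx0 gwp_neg_hw.
have [cn|nc] := leqP c n.
  have [y [_ ->]] := lefschetz_surj hk h (gw_gwp H n%:R u).
  exists (x ^+ (2 * (n - c)) *m y).
  by rewrite Ex -mulmxAv -exprD -mulnDr subnKC.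
exists 0; rewrite mulmx0.
pose j := ((2 * c).-1 - n)%N.
have un : gwp H n%:R *m u = x ^+ (2 * c).-1 *m (gwp H (- j%:R) *m w).
  have e : gwp H n%:R * x ^+ (2 * c).-1 = x ^+ (2 * c).-1 * gwp H (- j%:R).
    have -> : n%:R = - j%:R + 1 * (2 * c).-1%:R :> k.
      rewrite mul1r /j natrB; [ring | lia].
    exact: gwp_shift (ad_expr _ hx1).
  by rewrite uE -[LHS]mulmxAv e mulmxAv.
have xun : x *m (gwp H n%:R *m u) = 0.
  by rewrite -mulmxAv -(gwp_shift n%:R hx1) mulmxAv xu mulmx0.
rewrite un (lefschetz_inj hk h (leqnn j) (gw_gwp _ _ _)) ?mulmx0 //.
rewrite Ex (_ : 2 * j = (2 * c - 2 * n).-2 + (2 * c).-1.+1)%N; last by rewrite /j; lia.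
by rewrite exprD mulmxAv exprS mulmxAv -un xun mulmx0.
Qed.

(* The component of [u] in weight [n < r] vanishes and the one in weight [n > r] is in
   the image of [E ^+ n]. In weight [r], [a] kills [u], so [y = r^-1 T u] satisfies
   [u = a y = x y - b y]; here [y] is in the image of [E ^+ r], and [b y] has weight [r + 2]. *)
Lemma even_chain a b T r u w :
  (a + b) * (a + b) = E -> H * a = a * H -> H * b - b * H = 2 *: b ->
  H * T = T * H -> a * T + T * a = H -> (0 < r)%N ->
  u = (a + b) ^+ (2 * r) *m w -> (a + b) *m u = 0 ->
  exists y : 'cV_N, u = (a + b) ^+ (2 * r).+1 *m y.
Proof.
set x := a + b => xx Ha Hb HT aT r0 uE xu.
have Ex m : E ^+ m = x ^+ (2 * m) by rewrite exprM expr2 xx.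
have Eu : E *m u = 0 by rewrite -xx mulmxAv xu mulmx0.
have [h1 _ _] := h.
have low n : (n < r)%N -> gwp H n%:R *m u = 0.
  move=> nr; pose j := (2 * r - n)%N.
  have un : gwp H n%:R *m u = E ^+ r *m (gwp H (- j%:R) *m w).
    have e : gwp H n%:R * E ^+ r = E ^+ r * gwp H (- j%:R).
      have -> : n%:R = - j%:R + 2 * r%:R :> k.
        rewrite /j natrB; [ring | lia].
      exact: gwp_shift (ad_expr _ h1).
    by rewrite uE -Ex -[LHS]mulmxAv e mulmxAv.
  rewrite un (lefschetz_inj hk h (s := r.+1) (n := j) _ (gw_gwp _ _ _)) ?mulmx0 //.
    by rewrite /j; lia.
  by rewrite exprS mulmxAv -un gwp_hw.
have high n v : (r < n)%N -> gw H n%:R v -> exists y : 'cV_N, v = x ^+ (2 * r).+1 *m y.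
  move=> rn hv; have [y [_ ->]] := lefschetz_surj hk h hv.
  exists (x ^+ (2 * n - (2 * r).+1) *m y).
  by rewrite Ex -mulmxAv -exprD subnKC //; lia.
apply: (image_by_weights h) => n; last by exists 0; rewrite mulmx0 gwp_neg_hw.
case: (ltngtP n r) => [nr|rn|->].
- by exists 0; rewrite mulmx0 low.
- exact: high rn (gw_gwp _ _ _).
set ur := gwp H r%:R *m u.
have gur : gw H r%:R ur by exact: gw_gwp.
have Hur : H *m ur = r%:R *: ur by apply: (hw_semisimple hk h) => //; exact: gwp_hw.
(* The weight [r] part of [b *m u] comes from weight [r - 2] of [u], which vanishes: by [low], or as
   a negative weight if [r = 1]. Then [(a + b) *m u = 0] gives the claim. *)
have aur : a *m ur = 0.
  have b0 : gwp H r%:R *m (b *m u) = 0.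
    rewrite -mulmxAv (_ : r%:R = r%:R - 2 + 2 :> k); last by ring.
    rewrite (gwp_shift (r%:R - 2) Hb) mulmxAv; case: (r) r0 low => [//|[|q]] _ low.
      rewrite (_ : 1 - 2 = - 1%:R); last by ring.
      by rewrite gwp_neg_hw ?mulmx0.
    rewrite (_ : q.+2%:R - 2 = q%:R); last by ring.
    by rewrite low ?mulmx0.
  have abu : a *m u + b *m u = 0 by rewrite -mulmxDl.
  have := congr1 (mulmx (gwp H r%:R)) abu.
  rewrite mulmx0 mulmxDr b0 addr0 -[LHS]mulmxAv.
  by rewrite -(gwp_comm r%:R (esym Ha)) mulmxAv.
have nr : r%:R != 0 :> k by apply: natf_neq0_char0.
pose y := r%:R^-1 *: (T *m ur).
have ay : a *m y = ur.
  rewrite /y -scalemxAr -mulmxAv -[a * T](addrK (T * a)) aT mulmxBl mulmxAv aur mulmx0.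
  by rewrite subr0 Hur scalerA mulVf // scale1r.
have gT : gw H r%:R (T *m ur) by apply: gwM gur.
have gy : gw H r%:R y by rewrite /gw /y -scalemxAr gT.
have [z [_ zE]] := lefschetz_surj hk h gy.
have [z' z'E] : exists z' : 'cV_N, b *m y = x ^+ (2 * r).+1 *m z'.
  apply: (high r.+2) => //; rewrite (_ : r.+2%:R = r%:R + 2); last by ring.
  exact: gw_shift Hb gy.
exists (z - z'); rewrite mulmxBr -z'E -ay exprS mulmxAv -Ex -zE /x mulmxDl.
by rewrite addrK.
Qed.
End Fixed.

Lemma jordan_frame_socle (x : 'M[k]_N) r (v : 'I_r -> 'cV[k]_N) d i :
  jordan_frame x v d ->
  exists u, [/\ x *m u = 0, exists w : 'cV_N, u = x ^+ (d i).-1 *m w &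
                ~ exists y : 'cV_N, u = x ^+ (d i) *m y].
Proof.
move=> [d0 xv fr]; pose c j := chain x (v j) (d j).
(* [L] detects the socle of the i-th chain; it kills the image of [x ^+ d i], because no vector of
   that chain can be lowered [d i] times to the socle. *)
have [L LE] := frame_ext (fun j (n : nat) => if (j == i) && (n == 0%N) then c i 0%N else 0) fr.
exists (c i 0%N); split; first exact: chain0.
  by exists (v i); rewrite /c /chain d0 subn1.
case=> y yE; have Lx : L * x ^+ d i = 0.
  apply: (frame_uniq fr) => j a ad; rewrite mul0mx mulmxAv chain_expr //.
  case: leqP => da; last by rewrite mulmx0.
  rewrite LE; last exact: leq_ltn_trans (leq_subr _ _) ad.
  case: eqP => //= e; case: eqP => // a0; rewrite e in ad da a0; lia.
have := LE i 0%N (d0 i); rewrite !eqxx /= -/(c i 0%N) [in LHS]yE -mulmxAv Lx mul0mx.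
move=> c0; case: fr => Q [_ Qi _]; have := congr1 (mulmx (Q i)) (col_chainmx x (v i) (Ordinal (d0 i))).
rewrite -/(c i 0%N) -c0 mulmx0 mulmxA Qi mul1mx => /colP/(_ (Ordinal (d0 i))).
by rewrite !mxE !eqxx /= => /eqP; rewrite oner_eq0.
Qed.

Lemma jordan_sizes (P : pred nat) (x : 'M[k]_N) :
  x ^+ N = 0 ->
  (forall d u w, (0 < d)%N -> ~~ P d -> u = x ^+ d.-1 *m w -> x *m u = 0 ->
     exists y : 'cV_N, u = x ^+ d *m y) ->
  exists l (s : 'I_l -> nat), nil_jordan_type x s /\ forall i, P (s i).
Proof.
move=> xN hP; have [r [v [d jf]]] := jordan_frame_exists hk xN.
exists r, d; split; first exact: jordan_frame_type jf.
move=> i; apply/negPn/negP => nP.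
have [u [xu [w uE]]] := jordan_frame_socle i jf; apply.
by apply: hP uE xu => //; case: jf.
Qed.
End Criteria.

(** * Parity and adjoints *)

Section Parity.
Variables (k : fieldType) (hk : [pchar k] =i pred0) (p q : nat).
Local Notation N := (p + q)%N.

Definition parmx : 'M[k]_N := diag_mx (\row_i (-1) ^+ ipar i).
Local Notation G := parmx.

Lemma parmx_sq : G * G = 1.
Proof.
rewrite -[LHS]/(G *m G) mulmx_diag; apply/matrixP => i j; rewrite !mxE.
by rewrite -expr2 sqrr_sign.
Qed.

Lemma tr_parmx : G^T = G.
Proof. exact: tr_diag_mx. Qed.

Lemma parmx_vecE (v : 'cV[k]_N) i : (G *m v) i 0 = (-1) ^+ ipar i * v i 0.
Proof. by rewrite mul_diag_mx !mxE. Qed.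

Lemma sgn_neq (d e : bool) : d != e -> (-1) ^+ d != (-1) ^+ e :> k.
Proof.
have n1 : 1 != -1 :> k.
  by rewrite -subr_eq0 opprK -mulr2n (natf_neq0_char0 hk).
by case: d e => -[] //= _; rewrite expr1 expr0 // eq_sym.
Qed.

Lemma hvecP d (v : 'cV[k]_N) : hvec d v <-> G *m v = (-1) ^+ d *: v.
Proof.
split=> [h|h i nd].
  apply/colP => i; rewrite parmx_vecE !mxE.
  by have [->|/h->] := eqVneq (ipar i) d; rewrite ?mulr0.
have /colP/(_ i) := h; rewrite parmx_vecE !mxE => /eqP.
by rewrite -subr_eq0 -mulrBl mulf_eq0 subr_eq0 (negbTE (sgn_neq nd)) => /eqP.
Qed.

Lemma hmxP d (X : 'M[k]_N) : hmx d X <-> G * X = (-1) ^+ d *: (X * G).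
Proof.
have e i j : (G * X) i j = (-1) ^+ ipar i * X i j by rewrite -[G * X]/(G *m X) mul_diag_mx !mxE.
have e' i j : (X * G) i j = X i j * (-1) ^+ ipar j by rewrite -[X * G]/(X *m G) mul_mx_diag !mxE.
split=> [h|h i j nd].
  apply/matrixP => i j; rewrite e mxE e'.
  have [<-|/h->] := eqVneq (ipar i (+) ipar j) d; last by rewrite mulr0 mul0r mulr0.
  by rewrite signr_addb mulrACA -expr2 sqrr_sign mulr1.
have /matrixP/(_ i j) := h; rewrite e mxE e' => /eqP.
rewrite -subr_eq0 mulrA mulrAC -mulrBl mulf_eq0 subr_eq0 => /orP[|/eqP//].
have -> : (-1) ^+ ipar i = (-1) ^+ (ipar i (+) ipar j) * (-1) ^+ ipar j :> k.
  by rewrite signr_addb -mulrA -expr2 sqrr_sign mulr1.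
rewrite -subr_eq0 -mulrBl mulf_eq0 signr_eq0 orbF subr_eq0.
by rewrite (negbTE (sgn_neq nd)).
Qed.

Lemma even_partE (v : 'cV[k]_N) : even_part v = 2^-1 *: (v + G *m v).
Proof.
apply/colP => i; rewrite [RHS]mxE [X in _ * X]mxE parmx_vecE /ipar.
case: (splitP i) => j ij.
  have -> : i = lshift q j by apply: val_inj.
  rewrite /even_part col_mxEu mxE /= leqNgt ltn_ord expr0 mul1r -mulr2n -[X in _ = _ * X]mulr_natl mulrA.
  by rewrite mulVf ?mul1r // (natf_neq0_char0 hk).
have -> : i = rshift p j by apply: val_inj.
by rewrite /even_part col_mxEd mxE /= leq_addr expr1 mulN1r subrr mulr0.
Qed.

Lemma parmx_even_part (v : 'cV[k]_N) : G *m v = 2 *: even_part v - v.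
Proof.
by rewrite even_partE scalerA divff ?(natf_neq0_char0 hk) // scale1r [v + _]addrC addrK.
Qed.
End Parity.

(** * Adjoints with respect to the form *)

Section Adjoint.
Variables (k : fieldType) (hk : [pchar k] =i pred0) (p q : nat).
Local Notation N := (p + q)%N.
Local Notation G := (parmx k p q).
Variables (b : bool) (B : 'M[k]_N).
Hypotheses (Bnd : form_nondegenerate B) (Bpar : form_parity b B)
  (Bsym : form_supersymmetric B).
Implicit Types (X Y : 'M[k]_N) (v w : 'cV[k]_N).

Lemma form_unit : B \in unitmx.
Proof.
rewrite -unitmx_tr; apply: inj_unitmx => v h; apply: Bnd => w.
by rewrite /bform (_ : v^T *m B = 0) ?mul0mx ?mxE // -[LHS]trmxK trmx_mul trmxK h trmx0.
Qed.

Lemma bform_delta i j : bform B (delta_mx i 0) (delta_mx j 0) = B i j.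
Proof. by rewrite /bform trmx_delta -rowE -colE !mxE. Qed.

Lemma hvec_delta i : hvec (ipar i) (delta_mx i 0 : 'cV[k]_N).
Proof. by move=> j; rewrite mxE; case: (j =P i) => [->|_ _ //]; rewrite eqxx. Qed.

Lemma form_parmx : G * B = (-1) ^+ b *: (B * G).
Proof.
apply/(hmxP hk) => i j h; rewrite -bform_delta.
by apply: Bpar h; apply: hvec_delta.
Qed.

(** An odd form pairs opposite parities only, where the sign is trivial; an even form is symmetric
    on the even part and skew on the odd part. *)
Lemma form_tr : B^T = B * (if b then 1 else G).
Proof.
have e i j : B i j = (-1) ^+ (ipar i && ipar j) * B j i.
  by rewrite -!bform_delta (Bsym (@hvec_delta i) (@hvec_delta j)).
have e' i j : (B * G) i j = B i j * (-1) ^+ ipar j by rewrite -[B * G]/(B *m G) mul_mx_diag !mxE.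
have z i j : ipar i (+) ipar j != b -> B i j = 0.
  by move=> h; rewrite -bform_delta; by apply: Bpar h; apply: hvec_delta.
apply/matrixP => i j; rewrite mxE e; case: (b) z => z.
  rewrite mulr1; have [h|h] := eqVneq (ipar i (+) ipar j) true.
    by case: (ipar i) (ipar j) h => -[] //= _; rewrite expr0 mul1r.
  by rewrite z // mulr0.
rewrite e'; have [h|h] := eqVneq (ipar i (+) ipar j) false.
  by rewrite mulrC; case: (ipar i) (ipar j) h => -[] //=.
by rewrite z // mulr0 mul0r.
Qed.

(** The adjoint without super signs, hence an anti-automorphism of the whole matrix algebra; the
    signs reappear as a factor [G] in [in_g1P]. *)
Definition adj X := invmx B * X^T * B.

Lemma form_adj X : B * adj X = X^T * B.
Proof. by rewrite /adj !mulrA [B * _]mulmxV ?form_unit // mul1r. Qed.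

Lemma form_lcancel X Y : B * X = B * Y -> X = Y.
Proof. exact: (can_inj (mulKmx form_unit)). Qed.

Lemma adjE X Y : B * Y = X^T * B -> adj X = Y.
Proof. by move=> h; apply: form_lcancel; rewrite form_adj. Qed.

Lemma bform_adj X v w : bform B (X *m v) w = bform B v (adj X *m w).
Proof.
have e : X^T *m B = B *m adj X := esym (form_adj X).
by rewrite /bform trmx_mul -[v^T *m _ *m B]mulmxA e !mulmxA.
Qed.

Lemma adjD X Y : adj (X + Y) = adj X + adj Y.
Proof. by rewrite /adj linearD /= mulrDr mulrDl. Qed.
Lemma adjN X : adj (- X) = - adj X.
Proof. by rewrite /adj linearN /= mulrN mulNr. Qed.
Lemma adjB X Y : adj (X - Y) = adj X - adj Y.
Proof. by rewrite adjD adjN. Qed.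
Lemma adjZ c X : adj (c *: X) = c *: adj X.
Proof. by rewrite /adj linearZ /= -scalerMr -scalerMl. Qed.
Lemma adj0 : adj 0 = 0.
Proof. by rewrite /adj trmx0 mulr0 mul0r. Qed.
Lemma adj1 : adj 1 = 1.
Proof. by apply: adjE; rewrite mulr1 -[1^T]/(1%:M^T) trmx1 mul1r. Qed.
Lemma adjM X Y : adj (X * Y) = adj Y * adj X.
Proof.
by apply: adjE; rewrite mulrA form_adj -mulrA form_adj mulrA (trmx_mul X Y).
Qed.
Lemma adjX X n : adj (X ^+ n) = adj X ^+ n.
Proof. by elim: n => [|n IH]; [rewrite !expr0 adj1 | rewrite exprS adjM IH exprSr]. Qed.

Lemma adj_parmx : adj G = (-1) ^+ b *: G.
Proof. by apply: adjE; rewrite tr_parmx form_parmx -scalerMr. Qed.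

Lemma adj_tr X : \tr (adj X) = \tr X.
Proof.
rewrite /adj -mulrA -[_ * _]/(invmx B *m (X^T *m B)) mxtrace_mulC -mulmxA mulmxV ?form_unit //.
by rewrite mulmx1 mxtrace_tr.
Qed.

(** By [form_tr] the double adjoint is conjugation by [G] for an even form and trivial for an odd
    one. *)
Lemma adjK X : GRing.comm G X -> adj (adj X) = X.
Proof.
move=> GX; pose S : 'M[k]_N := if b then 1 else G.
have SS : S * S = 1 by rewrite /S; case: (b); rewrite ?mulr1 ?parmx_sq.
have SX : S * X = X * S by rewrite /S; case: (b); rewrite ?mulr1 ?mul1r.
have h : (adj X)^T * B * S = B * X * S.
  rewrite -!mulrA -SX [RHS]mulrA /S -form_tr.
  by have := congr1 trmx (form_adj X); rewrite (trmx_mul B) (trmx_mul X^T) trmxK.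
by apply: adjE; rewrite -[LHS]mulr1 -[RHS]mulr1 -SS !mulrA h.
Qed.

Lemma adj_even X : GRing.comm G X -> GRing.comm G (adj X).
Proof.
move=> GX; have := congr1 adj GX; rewrite !adjM adj_parmx -scalerMl -scalerMr.
move/(congr1 ( *:%R ((-1) ^+ b))); rewrite !scalerA -expr2 sqrr_sign !scale1r.
by move/esym.
Qed.

Lemma in_gE d X :
  in_g B d X <-> hmx d X /\ X^T * B + (if d then G else 1) * B * X = 0.
Proof.
set M := X^T * B + _.
have key e v w : hvec e v ->
    bform B (X *m v) w + (-1) ^+ (d && e) * bform B v (X *m w) = (v^T *m M *m w) 0 0.
  move=> he; rewrite /M mulmxDr mulmxDl [RHS]mxE; congr (_ + _).
    by rewrite /bform trmx_mul -[X^T * B]/(X^T *m B) !mulmxA.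
  have -> : v^T *m ((if d then G else 1) * B * X) = (-1) ^+ (d && e) *: (v^T *m B *m X).
    rewrite -[_ * _ * X]/((if d then G else 1) *m B *m X) !mulmxA.
    case: (d); last by rewrite [v^T *m 1]mulmx1 scale1r.
    have -> : v^T *m G = (-1) ^+ e *: v^T.
      by rewrite -(tr_parmx k) -trmx_mul (hvecP hk e v).1 // linearZ.
    by rewrite -!scalemxAl.
  by rewrite -scalemxAl mxE /bform !mulmxA.
split=> -[hX h]; split=> //.
  apply/matrixP => i j; have := h _ _ (delta_mx j 0) (@hvec_delta i).
  by rewrite (key _ _ _ (@hvec_delta i)) trmx_delta -rowE -colE !mxE.
by move=> e v w he; rewrite (key _ _ _ he) h mulmx0 mul0mx mxE.
Qed.

Lemma in_g0P X : in_g B false X <-> GRing.comm G X /\ adj X = - X.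
Proof.
rewrite in_gE (hmxP hk) expr0 scale1r mul1r; split=> -[GX h]; split=> //.
  by apply: adjE; rewrite mulrN; apply/esym/eqP; rewrite -addr_eq0 h.
by rewrite -form_adj h mulrN addNr.
Qed.

Lemma in_g1P X : in_g B true X <->
  G * X = - (X * G) /\ adj X = - ((-1) ^+ b *: (G * X)).
Proof.
have GB : G * B * X = B * ((-1) ^+ b *: (G * X)).
  by rewrite form_parmx -scalerMr mulrA -scalerMl.
rewrite in_gE (hmxP hk) expr1 scaleN1r GB; split=> -[GX h]; split=> //.
  by apply: adjE; rewrite mulrN; apply/esym/eqP; rewrite -addr_eq0 h.
by rewrite -form_adj h mulrN addNr.
Qed.
End Adjoint.

Global Opaque adj.

(** * Subspaces as images of idempotent matrices *)

Section Subspaces.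
Variables (k : fieldType) (N : nat).
Local Notation V := 'cV[k]_N.
Implicit Types (e y : 'M[k]_N) (v w : V) (U W : {vspace V}).

Definition mx_of (f : 'End(V)) : 'M[k]_N := \matrix_(i, j) f (delta_mx j 0) i 0.

Lemma mx_ofE f v : mx_of f *m v = f v.
Proof.
have vE : v = \sum_j v j 0 *: delta_mx j (0 : 'I_1).
  apply/colP => i; rewrite summxE (bigD1 i) //= !mxE !eqxx mulr1 big1 ?addr0 // => j nj.
  by rewrite !mxE eq_sym (negbTE nj) mulr0.
rewrite [in RHS]vE linear_sum; apply/colP => i; rewrite !mxE summxE.
by apply: eq_bigr => j _; rewrite linearZ !mxE mulrC.
Qed.

Definition imsp e : {vspace V} := limg (linfun (mulmx e : V -> V)).

Lemma mem_imsp e v : e * e = e -> (v \in imsp e) = (e *m v == v).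
Proof.
move=> ee; apply/idP/eqP => [/memv_imgP[u _ ->]|ev].
  by rewrite lfunE /= -mulmxAv ee.
by apply/memv_imgP; exists v; rewrite ?memvf // lfunE.
Qed.

Lemma compl_idem W W' : (W + W')%VS = fullv -> (W :&: W')%VS = 0%VS ->
  exists e, [/\ e * e = e, forall v, (v \in W) = (e *m v == v),
    forall v, (v \in W') = (e *m v == 0) &
    forall y, (forall v, v \in W -> y *m v \in W) ->
              (forall v, v \in W' -> y *m v \in W') -> GRing.comm y e].
Proof.
move=> full dir; pose e := mx_of (daddv_pi W W').
have eW v : e *m v \in W by rewrite mx_ofE memv_pi.
have eid v : v \in W -> e *m v = v by move=> vW; rewrite mx_ofE daddv_pi_id.
have eW' v : v - e *m v \in W'.
  have h : daddv_pi W W' v + daddv_pi W' W v = v.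
    by apply: daddv_pi_add; rewrite // full memvf.
  by rewrite mx_ofE -{1}h addrAC subrr add0r memv_pi.
have ez v : v \in W' -> e *m v = 0.
  move=> vW'; apply/eqP; rewrite -memv0 -dir memv_cap eW /=.
  by rewrite -[e *m v](subKr v) memvB.
exists e; split.
- by apply: eq_mx_vec => v; rewrite mulmxAv eid.
- by move=> v; apply/idP/eqP => [/eid//|<-].
- by move=> v; apply/idP/eqP => [/ez//|h]; rewrite -[v]subr0 -h.
move=> y yW yW'; apply: eq_mx_vec => v; rewrite !mulmxAv.
have h : e *m (y *m (v - e *m v)) = 0 by apply/ez/yW'.
have h' : e *m (y *m (e *m v)) = y *m (e *m v) by apply/eid/yW.
by move: h; rewrite !mulmxBr h' => /eqP; rewrite subr_eq0 => /eqP ->.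
Qed.

Lemma compl_idem_family r (U : 'I_r -> {vspace V}) :
  directv (\sum_i U i) -> (\sum_i U i)%VS = fullv ->
  exists E : 'I_r -> 'M[k]_N,
    [/\ \sum_i E i = 1, forall i j, i != j -> E i * E j = 0,
        forall i, E i * E i = E i, forall i v, (v \in U i) = (E i *m v == v) &
        forall y, (forall i v, v \in U i -> y *m v \in U i) ->
          forall i, GRing.comm y (E i)].
Proof.
move=> dir full.
have h i : exists e, [/\ e * e = e, forall v, (v \in U i) = (e *m v == v),
    forall v, (v \in (\sum_(j | j != i) U j)%VS) = (e *m v == 0) &
    forall y, (forall v, v \in U i -> y *m v \in U i) ->
      (forall v, v \in (\sum_(j | j != i) U j)%VS -> y *m v \in (\sum_(j | j != i) U j)%VS) ->
      GRing.comm y e].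
  apply: compl_idem.
    by rewrite -full [RHS](bigD1 i).
  by have /directv_sumP/(_ i isT) := dir.
have [E hE] := fin_all_exists h; exists E.
have E0 i j : i != j -> E i * E j = 0.
  move=> ij; apply: eq_mx_vec => v; rewrite mulmxAv mul0mx.
  case: (hE i) => _ _ h3 _; apply/eqP; rewrite -h3.
  rewrite (bigD1 j) ?(eq_sym j) //=; apply: (subvP (addvSl _ _)).
  by case: (hE j) => ee -> _ _; rewrite -mulmxAv ee.
split=> //.
- apply: eq_mx_vec => v; rewrite mul1mxv.
  have : v \in (\sum_i U i)%VS by rewrite full memvf.
  case/memv_sumP => u uU ->; rewrite mulmx_sumr; apply: eq_bigr => i _.
  have ui : E i *m u i = u i by apply/eqP; case: (hE i) => _ <- _ _; exact: uU.
  rewrite mulmx_suml (bigD1 i) //= ui big1 ?addr0 // => j ji.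
  by rewrite -ui -mulmxAv E0 ?mul0mx.
- by move=> i; case: (hE i).
- by move=> i v; case: (hE i).
move=> y yU i; case: (hE i) => _ _ _; apply; first exact: yU.
move=> v /memv_sumP[u uU ->]; rewrite mulmx_sumr; apply: memv_sumr => j ji.
by apply/yU/uU.
Qed.

Lemma idem_family_direct r (E : 'I_r -> 'M[k]_N) :
  \sum_i E i = 1 -> (forall i j, i != j -> E i * E j = 0) ->
  (forall i, E i * E i = E i) ->
  directv (\sum_i imsp (E i)) /\ (\sum_i imsp (E i))%VS = fullv.
Proof.
move=> E1 E0 EE; split.
  apply/directv_sum_independent => u hu su i _.
  have uE j : E j *m u j = u j by apply/eqP; rewrite -mem_imsp // hu.
  have := congr1 (mulmx (E i)) su; rewrite mulmx0 mulmx_sumr (bigD1 i) //= uE.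
  by rewrite big1 ?addr0 // => j ji; rewrite -uE -mulmxAv E0 ?mul0mx // eq_sym.
apply/eqP; rewrite eqEsubv subvf; apply/subvP => v _.
rewrite -[v]mul1mxv -E1 mulmx_suml; apply: memv_sumr => i _.
by rewrite mem_imsp // -mulmxAv EE.
Qed.
End Subspaces.

(** * Distinguished elements and orthogonal decompositions *)

Section Distinguished.
Variables (k : closedFieldType) (hk : [pchar k] =i pred0) (p q : nat).
Local Notation N := (p + q)%N.
Local Notation G := (parmx k p q).
Variables (b : bool) (B : 'M[k]_N).
Hypotheses (Bnd : form_nondegenerate B) (Bpar : form_parity b B)
  (Bsym : form_supersymmetric B).
Variable x : 'M[k]_N.
Hypothesis gx : in_g B true x.
Local Notation S := (kx_gens G x).
Local Notation adj := (adj B).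

Lemma Gx_anti : G * x = -1 *: (x * G).
Proof. by have [-> _] := (in_g1P hk Bnd Bpar x).1 gx; rewrite scaleN1r. Qed.

Lemma adj_x : adj x = - ((-1) ^+ b *: (G * x)).
Proof. by case: ((in_g1P hk Bnd Bpar x).1 gx). Qed.

(** The adjoint of [x] is [G * x] up to sign, so commuting with [x] passes to the adjoint once [G]
    is cancelled. *)
Lemma cent_adj a : cent S a -> cent S (adj a).
Proof.
move=> ca; have Ga := commr_kG ca; have xa := commr_kx ca.
have Ga' := adj_even hk Bnd Bpar Ga.
move=> y [->|->] //.
have := congr1 adj xa; rewrite !(adjM Bnd) adj_x mulrN mulNr => /oppr_inj.
rewrite -scalerMl -scalerMr => /(congr1 ( *:%R ((-1) ^+ b))).
rewrite !scalerA -expr2 sqrr_sign !scale1r => h.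
have GGx : G * (G * x) = x by rewrite mulrA parmx_sq mul1r.
rewrite /GRing.comm -{1}GGx -mulrA -h mulrA [G * adj a]Ga' -mulrA GGx //.
Qed.

Definition skewcent z := cent S z /\ adj z = - z.

Lemma skewcentP z : skewcent z <-> in_g B false z /\ sbracket false true z x = 0.
Proof.
rewrite (in_g0P hk Bnd) /sbracket expr0 scale1r; split.
  move=> [cz az]; split; last by rewrite [x *m z](commr_kx cz) subrr.
  by split=> //; exact: commr_kG cz.
move=> [[Gz az] /eqP]; rewrite subr_eq0 => /eqP zx; split=> // y [->|->] //.
Qed.

Lemma skewcent_sub a : cent S a -> skewcent (a - adj a).
Proof.
move=> ca; split; first by apply: centB => //; exact: cent_adj.
by rewrite adjB (adjK Bnd Bpar Bsym (commr_kG ca)) opprB.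
Qed.

Lemma skewcent_sqr : skewcent (x * x).
Proof.
split; first move=> y [->|->].
- rewrite /GRing.comm mulrA Gx_anti -scalerMl -mulrA Gx_anti -scalerMr scalerA.
  by rewrite mulrNN mulr1 scale1r mulrA.
- by rewrite /GRing.comm mulrA.
rewrite (adjM Bnd) adj_x mulrNN -scalerMl -scalerMr scalerA -expr2 sqrr_sign scale1r.
have GGx : G * (G * x) = x by rewrite mulrA parmx_sq mul1r.
by rewrite {1}Gx_anti scaleN1r mulNr -mulrA GGx.
Qed.

Lemma in_g_sqr : in_g B false (x * x).
Proof. by case/skewcentP: skewcent_sqr. Qed.

(* The action of [ad (e - f)] is diagonal in the Peirce decomposition for
   [e], [f], [1 - e - f], with eigenvalues [2, -2, 1, -1, 0]. *)
Lemma semisimple_of_idems e f : GRing.comm G e -> e * e = e -> f * f = f -> e * f = 0 -> f * e = 0 ->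
  adj e = f -> semisimple0 B (e - f).
Proof.
move=> Ge ee ff ef fe ae.
have af : adj f = e by rewrite -ae (adjK Bnd Bpar Bsym Ge).
have Gf : GRing.comm G f by rewrite -ae; exact: (adj_even hk Bnd Bpar Ge).
pose o : 'M[k]_N := 1 - e - f.
have eo : e * o = 0 by rewrite /o !mulrBr mulr1 ee ef subrr subr0.
have oe : o * e = 0 by rewrite /o !mulrBl mul1r ee fe subrr subr0.
have fo : f * o = 0 by rewrite /o !mulrBr mulr1 ff fe subr0 subrr.
have of0 : o * f = 0 by rewrite /o !mulrBl mul1r ff ef subr0 subrr.
have Go : GRing.comm G o.
  by apply: commrB => //; apply: commrB => //; exact: commr1.
have ao : adj o = o by rewrite /o !adjB (adj1 Bnd) ae af addrAC.
have sum1 : e + f + o = 1 by rewrite addrC [e + f]addrC addrA /o !subrK.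
clearbody o; split.
  by apply/(in_g0P hk Bnd); split; [exact: commrB | rewrite adjB ae af opprB].
move=> Y /(in_g0P hk Bnd)[GY aY].
(* [adj] exchanges [e] and [f] and reverses products; blocks that it exchanges up to sign are
   grouped, so that each [Z i] is in g_0. *)
pose Z := tnth [tuple e * Y * f; f * Y * e; e * Y * o + o * Y * f; o * Y * e + f * Y * o;
  e * Y * e + f * Y * f + o * Y * o].
pose c := tnth [tuple 2; -2; 1; -1; 0 : k].
have GP u v : GRing.comm G u -> GRing.comm G v -> GRing.comm G (u * Y * v).
  by move=> hu hv; apply: commrM => //; apply: commrM.
have aP u v : adj (u * Y * v) = - (adj v * Y * adj u).
  by rewrite !(adjM Bnd) aY mulNr mulrN mulrA.
exists 5%N, c, Z; split; last first.
  rewrite !big_ord_recl big_ord0 /Z !(tnth_nth 0) /= addr0.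
  rewrite -[Y in LHS]mul1r -[1 * Y]mulr1 -sum1 !mulrDl !mulrDr.
  move: (e * Y * e) (e * Y * f) (e * Y * o) (f * Y * e) (f * Y * f) (f * Y * o)
    (o * Y * e) (o * Y * f) (o * Y * o) => t1 t2 t3 t4 t5 t6 t7 t8 t9.
  by apply/matrixP => i j; rewrite !mxE; ring.
have sP u v (cu cv : k) : (e - f) * u = cu *: u -> v * (e - f) = cv *: v ->
    (e - f) * (u * Y * v) - (u * Y * v) * (e - f) = (cu - cv) *: (u * Y * v).
  move=> hu hv; rewrite !mulrA hu -(mulrA _ v) hv -scalerMr -!scalerMl.
  by rewrite scalerBl.
have le : (e - f) * e = 1 *: e by rewrite mulrBl ee fe subr0 scale1r.
have lf : (e - f) * f = -1 *: f by rewrite mulrBl ef ff sub0r scaleN1r.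
have lo : (e - f) * o = 0 *: o by rewrite mulrBl eo fo subr0 scale0r.
have re : e * (e - f) = 1 *: e by rewrite mulrBr ee ef subr0 scale1r.
have rf : f * (e - f) = -1 *: f by rewrite mulrBr fe ff sub0r scaleN1r.
have ro : o * (e - f) = 0 *: o by rewrite mulrBr oe of0 subr0 scale0r.
have addP c0 u v : (e - f) * u - u * (e - f) = c0 *: u -> (e - f) * v - v * (e - f) = c0 *: v ->
    (e - f) * (u + v) - (u + v) * (e - f) = c0 *: (u + v).
  by move=> hu hv; rewrite (mulrDr (e - f) u) (mulrDl u) opprD addrACA hu hv scalerDr.
move=> i; rewrite /sbracket expr0 scale1r -[_ *m _]/((e - f) * Z i) -[Z i *m _]/(Z i * (e - f)).
rewrite (in_g0P hk Bnd) /Z /c.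
have comm2 u v : GRing.comm G u -> GRing.comm G v -> GRing.comm G (u + v) by exact: commrD.
case: i => [[|[|[|[|[|//]]]]] hi]; rewrite !(tnth_nth 0) /=.
- split; first by split; [exact: GP | rewrite aP ae af].
  by rewrite (sP _ _ 1 (-1)) // opprK.
- split; first by split; [exact: GP | rewrite aP ae af].
  by rewrite (sP _ _ (-1) 1) // -opprD.
- split; first by split; [by apply: comm2; exact: GP | rewrite adjD !aP ae af ao opprD addrC].
  by apply: addP; [rewrite (sP _ _ 1 0) // subr0 | rewrite (sP _ _ 0 (-1)) // opprK add0r].
- split; first by split; [by apply: comm2; exact: GP | rewrite adjD !aP ae af ao opprD addrC].
  by apply: addP; [rewrite (sP _ _ 0 1) // sub0r | rewrite (sP _ _ (-1) 0) // subr0].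
split.
  split; first by apply: (comm2 _ _ _ (GP _ _ Go Go)); apply: comm2; exact: GP.
  by rewrite !adjD !aP ae af ao !opprD [- (f * _ * _) - _]addrC.
apply: (addP 0); last by rewrite (sP _ _ 0 0) // subrr.
by apply: addP; [rewrite (sP _ _ 1 1) // subrr | rewrite (sP _ _ (-1) (-1)) // subrr].
Qed.

Hypothesis center0 : forall Z, in_center0 B Z -> Z = 0.

Lemma nonnilp_eigenproj (z : 'M[k]_N) : z ^+ N != 0 ->
  exists c, c != 0 /\ nilproj (z - c%:M) != 0.
Proof.
move=> nz; have [c [w [nc nw wE]]] := nonnilp_eigenvector nz.
exists c; split=> //; apply: contraNneq nw => h0.
have N0 := mx_neq0_size nz.
have : gw z c w.
  by apply/gw_expP/exp_kernel => //; rewrite mulmxBl wE mul_scalar_mx subrr.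
by rewrite /gw /gwp h0 mul0mx => <-.
Qed.

Lemma distinguished_nilp z : distinguished B x -> skewcent z -> z ^+ N = 0.
Proof.
move=> dist [cz az]; apply/eqP/negPn/negP => nz.
have [c [nc nP]] := nonnilp_eigenproj nz.
pose e := nilproj (z - c%:M).
have comm_e y : GRing.comm y z -> GRing.comm y e.
  by move=> h; apply/comm_nilproj/commrB => //; apply/commr_sym/comm_scalar.
have ee : e * e = e by exact: nilproj_idem.
have ze : (z - c%:M) ^+ N * e = 0 by exact: exp_nilproj.
have ce : cent S e by move=> y Sy; apply/comm_e/cz.
have ne : e != 0 by exact: nP.
clearbody e.
have ez : GRing.comm e z by apply/commr_sym/comm_e/commr_refl.
pose f := adj e.
have zf : GRing.comm f z.
  have := congr1 adj ez; rewrite !(adjM Bnd) az mulNr mulrN => /oppr_inj.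
  by move=> h; rewrite /GRing.comm h.
have ef : GRing.comm e f by apply/commr_sym/comm_e.
have ff : f * f = f by rewrite /f -(adjM Bnd) ee.
(* Since [adj z = - z], the adjoint of [e] projects into the generalized eigenspace of [- c], which
   differs from [c]. *)
have z'f : (z - (- c)%:M) ^+ N * f = 0.
  have -> : (- c)%:M = - c%:M :> 'M[k]_N by exact: raddfN.
  rewrite opprK.
  have h : f * (- (z + c%:M)) ^+ N = 0.
    have := congr1 adj ze; rewrite (adjM Bnd) (adjX Bnd) adjB az -/f.
    rewrite -scalemx1 adjZ -[1%:M]/(1 : 'M_N) (adj1 Bnd) -opprD => ->.
    by rewrite adj0.
  have hc : GRing.comm f (z + c%:M).
    by apply: commrD => //; apply/commr_sym/comm_scalar.
  have h2 : f * (z + c%:M) ^+ N = 0.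
    move: h; rewrite exprNn -signr_odd; case: (odd N); last by rewrite expr0 mul1r.
    by rewrite expr1 mulN1r mulrN => /eqP; rewrite oppr_eq0 => /eqP.
  by rewrite -(commrX _ hc).
have ef0 : e * f = 0.
  apply: (spectral_orth ez zf ef ze z'f); apply: contra nc => /eqP cE.
  have : 2 * c = 0 by rewrite mulrDl mul1r {1}cE addNr.
  by move/eqP; rewrite mulf_eq0 (negbTE (natf_neq0_char0 hk _)).
have fe0 : f * e = 0 by rewrite -ef.
have ss := semisimple_of_idems (commr_kG ce) ee ff ef0 fe0 erefl.
have /dist : sbracket false true (e - f) x = 0.
  rewrite /sbracket expr0 scale1r; apply/eqP; rewrite subr_eq0; apply/eqP/esym.
  by apply: commrB; [exact: commr_kx ce | exact: commr_kx (cent_adj ce)].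
move/(_ ss)/center0/eqP; rewrite subr_eq0 => /eqP e_f.
by case/eqP: ne; rewrite -ee {2}e_f ef0.
Qed.

(* If [f - f^*] is nilpotent, then [f f^* f = f (1 - (f - f^* )^2)] is invertible
   in the corner of [f], that is, the image of [f] is nondegenerate;
   [g] is the orthogonal projection onto it. *)
Lemma selfadjoint_idem f : distinguished B x -> cent S f -> f * f = f ->
  exists g, [/\ cent S g, g * g = g, adj g = g, g * f = f & f * g = g].
Proof.
move=> dist cf ff; have sk := skewcent_sub cf.
have nil := distinguished_nilp dist sk.
set h := adj f in sk nil *.
have hh : h * h = h by rewrite /h -(adjM Bnd) ff.
have ah : adj h = f by rewrite /h (adjK Bnd Bpar Bsym) //; exact: commr_kG cf.
have af : adj f = h by [].
have chh : cent S h by exact: cent_adj.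
clearbody h.
pose u := 1 - (f - h) ^+ 2.
have uE : u = 1 - (f - f * h - h * f + h).
  by rewrite /u expr2 mulrBr !mulrBl ff hh; mx_lin.
have fu : f * u = f * h * f.
  by rewrite uE !(mulrBr, mulrDr) mulr1 !mulrA ff; mx_lin.
have uf : u * f = f * h * f.
  by rewrite uE !(mulrBl, mulrDl) mul1r -!mulrA ff !mulrA; mx_lin.
have hu : h * u = h * f * h.
  by rewrite uE !(mulrBr, mulrDr) mulr1 !mulrA hh; mx_lin.
have uh : u * h = h * f * h.
  by rewrite uE !(mulrBl, mulrDl) mul1r -!mulrA hh !mulrA; mx_lin.
have uU : u \in unitmx.
  apply: inj_unitmx => v; rewrite mulmxBl mul1mxv => /eqP; rewrite subr_eq0 => /eqP vE.
  have vn n : v = (f - h) ^+ (2 * n) *m v.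
    elim: n => [|n IH]; first by rewrite expr0 mul1mxv.
    by rewrite mulnS exprD mulmxAv -IH.
  by rewrite (vn N) mulnC exprM nil expr2 mul0r mul0mx.
have au : adj u = u by rewrite /u adjB (adj1 Bnd) (adjX Bnd) adjB af ah -[h - f]opprB !expr2 mulrNN.
pose w := invmx u.
have uw : u * w = 1 by exact: mulmxV.
have wu : w * u = 1 by exact: mulVmx.
have winv y : GRing.comm y u -> GRing.comm y w.
  by move=> yu; rewrite /GRing.comm -[y * w]mul1r -wu -!mulrA (mulrA u) -yu -(mulrA y) uw mulr1.
have aw : adj w = w.
  have := congr1 adj uw; rewrite (adjM Bnd) au (adj1 Bnd) => h1.
  by rewrite -[adj w]mulr1 -uw mulrA h1 mul1r.
clearbody u w.
have wf : f * w = w * f by apply: winv; rewrite /GRing.comm fu uf.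
have wh : h * w = w * h by apply: winv; rewrite /GRing.comm hu uh.
have cu : cent S w.
  move=> y Sy; apply: winv; rewrite uE; apply: commrB; first exact: commr1.
  have [yf yh] := (cf y Sy, chh y Sy).
  by apply: commrD => //; do 2 ?[apply: commrB => //]; apply: commrM.
(* [f * h * f = u * f], and [w] inverts [u]. *)
have gf : f * w * h * f = f.
  by rewrite wf -!mulrA (mulrA f) -uf mulrA wu mul1r.
exists (f * w * h); split.
- by apply: centM => //; apply: centM.
- by rewrite {2}wf !mulrA -(mulrA _ w f) -wf mulrA gf.
- by rewrite !(adjM Bnd) af ah aw mulrA.
- exact: gf.
- by rewrite !mulrA ff.
Qed.

End Distinguished.

(** * Distinguished elements give decompositions, and conversely *)

Section Equivalence.
Variables (k : closedFieldType) (hk : [pchar k] =i pred0) (p q : nat).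
Local Notation N := (p + q)%N.
Local Notation G := (parmx k p q).
Variables (b : bool) (B : 'M[k]_N).
Hypotheses (Bnd : form_nondegenerate B) (Bpar : form_parity b B)
  (Bsym : form_supersymmetric B).
Variable x : 'M[k]_N.
Hypothesis gx : in_g B true x.
Local Notation S := (kx_gens G x).
Local Notation adj := (adj B).
Local Notation V := 'cV[k]_N.
Implicit Types (v w : V) (e a : 'M[k]_N) (W : {vspace V}).

Lemma submodule_stable W y v : kx_submodule x W -> S y -> v \in W -> y *m v \in W.
Proof.
move=> hW [->|->] vW; have [h1 h2] := hW _ vW; last by [].
by rewrite (parmx_even_part hk) rpredB // rpredZ.
Qed.

Lemma imsp_submodule e : cent S e -> e * e = e -> kx_submodule x (imsp e).
Proof.
move=> ce ee v; rewrite !mem_imsp // => /eqP ev; split; apply/eqP; last first.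
  by rewrite -[LHS]mulmxAv -(commr_kx ce) mulmxAv ev.
rewrite (even_partE hk) -scalemxAr mulmxDr ev; congr (_ *: (_ + _)).
by rewrite -[LHS]mulmxAv -(commr_kG ce) mulmxAv ev.
Qed.

(** The projection onto [W1] along [W2] plus the image of [1 - e] is an idempotent of the corner of
    [e]. *)
Lemma prim_indecomposable e : prim_idem S e -> kx_indecomposable x (imsp e).
Proof.
move=> [ce ee ne pe]; split.
  have [v nv] := mx_neq0_vec ne; apply: contraNneq nv => h.
  by rewrite -memv0 -h mem_imsp // -mulmxAv ee.
move=> W1 W2 s1 s2 sU d12.
have f'f' : (1 - e) * (1 - e) = 1 - e by rewrite mulrBr mulr1 mulrBl mul1r ee subrr subr0.
have W1U v : v \in W1 -> e *m v = v.
  by move=> h; apply/eqP; rewrite -mem_imsp // -sU (subvP (addvSl _ _)).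
have W2U v : v \in W2 -> e *m v = v.
  by move=> h; apply/eqP; rewrite -mem_imsp // -sU (subvP (addvSr _ _)).
have full : (W1 + (W2 + imsp (1 - e)))%VS = fullv.
  apply/eqP; rewrite eqEsubv subvf addvA sU; apply/subvP => v _.
  rewrite -[v](subrK (e *m v)) addrC; apply: memv_add.
    by rewrite mem_imsp // -mulmxAv ee.
  by rewrite -[X in X - _]mul1mxv -mulmxBl mem_imsp // -mulmxAv f'f'.
have dir : (W1 :&: (W2 + imsp (1 - e)))%VS = 0%VS.
  apply/eqP; rewrite -subv0; apply/subvP => v; rewrite memv_cap => /andP[v1].
  case/memv_addP => w w2 [u]; rewrite mem_imsp // => /eqP uE vE.
  have vw : v = w.
    rewrite -(W1U _ v1) vE mulmxDr W2U // -uE -mulmxAv mulrBr mulr1 ee subrr mul0mx.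
    by rewrite addr0.
  by rewrite -d12 memv_cap v1 vw.
have [f [ff fW fW' fc]] := compl_idem full dir.
have cf : cent S f.
  move=> y Sy; apply: fc => v; first exact: submodule_stable.
  case/memv_addP => w w2 [u uU ->]; rewrite mulmxDr memv_add //.
    exact: submodule_stable w2.
  apply: submodule_stable uU => //; apply: imsp_submodule => //.
  by apply: centB => //; exact: cent1.
have ef : e * f = f.
  apply: eq_mx_vec => v; rewrite mulmxAv W1U // fW -mulmxAv ff //.
have fe : f * e = f.
  have : f * (1 - e) = 0.
    apply: eq_mx_vec => v; rewrite mulmxAv mul0mx; apply/eqP; rewrite -fW'.
    by apply: (subvP (addvSr _ _)); rewrite mem_imsp // -mulmxAv f'f'.
  by rewrite mulrBr mulr1 => /eqP; rewrite subr_eq0 => /eqP.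
have [] // := pe f.
- move=> f0; left; apply/eqP; rewrite -subv0; apply/subvP => v.
  by rewrite fW f0 mul0mx memv0 eq_sym.
- move=> f_e; right; apply/eqP; rewrite -subv0; apply/subvP => v v2.
  by rewrite -d12 memv_cap v2 andbT fW f_e W2U.
Qed.

Lemma bform_sumr (I : finType) (P : pred I) v (F : I -> V) :
  bform B v (\sum_(i | P i) F i) = \sum_(i | P i) bform B v (F i).
Proof. by rewrite /bform mulmx_sumr summxE. Qed.

Lemma bform_suml (I : finType) (P : pred I) (F : I -> V) w :
  bform B (\sum_(i | P i) F i) w = \sum_(i | P i) bform B (F i) w.
Proof. by rewrite /bform linear_sum /= !mulmx_suml summxE. Qed.

Lemma bform_inj (X Y : 'M[k]_N) :
  (forall v w, bform B v (X *m w) = bform B v (Y *m w)) -> X = Y.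
Proof.
move=> h; apply: (form_lcancel Bnd); apply/matrixP => i j.
have := h (delta_mx i 0) (delta_mx j 0).
by rewrite /bform !trmx_delta -!rowE !mulmxA -!row_mul -!colE !mxE.
Qed.

Hypothesis center0 : forall Z, in_center0 B Z -> Z = 0.

Lemma selfadjoint_prims : distinguished B x ->
  exists r (E : 'I_r -> 'M[k]_N),
    [/\ \sum_i E i = 1, forall i, prim_idem S (E i) /\ adj (E i) = E i &
        forall i j, i != j -> E i * E j = 0].
Proof.
move=> dist.
have [e [ce ae] ee np nz||s [s1 sP sO]] :=
    @idem_decomposition k N S (fun e => cent S e /\ adj e = e) _ 1 _ (mulr1 1).
- have [f [[cf ef fe] ff nf nfe]] := cent_split ce ee np nz.
  have [g [cg gg ag gf fg]] := selfadjoint_idem hk Bnd Bpar Bsym gx center0 dist cf ff.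
  have eg : e * g = g by rewrite -fg mulrA ef.
  have ge : g * e = g by have := congr1 adj eg; rewrite (adjM Bnd) ae ag.
  exists g; split=> //.
    by split; [exact: centB | rewrite adjB ae ag].
  split; first by apply: contraNneq nf => g0; rewrite -gf g0 mul0r.
  by apply: contraNneq nfe => g_e; rewrite -fe -g_e fg g_e.
- by split; [exact: cent1 | exact: adj1].
have hP a : a \in s -> prim_idem S a /\ adj a = a by move/sP => [[]].
have [r [E [E1 pE E0]]] := seq_idem_family hP sO.
by exists r, E; split=> //; rewrite E1 -s1.
Qed.

(* [a - a^*] exchanges the images of [e] and [f] injectively. *)
Lemma no_iso_of_nilp e f a : cent S e -> cent S f -> e != 0 -> e * e = e -> f * f = f ->
  adj e = e -> adj f = f -> e * f = 0 -> cent S a -> f * a = a -> a * e = a ->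
  (forall v, a *m v = 0 -> e *m v = 0) -> (forall v, exists w, f *m v = a *m w) ->
  (a - adj a) ^+ N = 0 -> False.
Proof.
move=> ce cf ne ee ff ae af ef ca fa aE inj surj nil.
have fe : f * e = 0 by rewrite -af -ae -(adjM Bnd) ef adj0.
have a'f : adj a * f = adj a by rewrite -{1}af -(adjM Bnd) fa.
have ea' : e * adj a = adj a by rewrite -{1}ae -(adjM Bnd) aE.
have inj' v : f *m v = v -> adj a *m v = 0 -> v = 0.
  move=> fv av; suff : B *m v = 0.
    by move/(congr1 (mulmx (invmx B))); rewrite mulKmx ?form_unit // mulmx0.
  apply/colP => i; rewrite [RHS]mxE.
  have [w wE] := surj (delta_mx i 0).
  have : bform B (delta_mx i 0) (f *m v) = 0.
    by rewrite -{1}af -(bform_adj Bnd) wE (bform_adj Bnd) av /bform mulmx0 mxE.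
  by rewrite fv /bform -mulmxA trmx_delta -rowE mxE.
pose z := a - adj a.
have step v : v != 0 /\ (e *m v = v \/ f *m v = v) ->
    z *m v != 0 /\ (e *m (z *m v) = z *m v \/ f *m (z *m v) = z *m v).
  move=> [nv [ev|fv]].
    have zv : z *m v = a *m v.
      by rewrite mulmxBl -{2}ev -mulmxAv -[adj a]a'f -mulrA fe mulr0 mul0mx subr0.
    rewrite zv; split; last by right; rewrite -mulmxAv fa.
    by apply: contraNneq nv => /inj; rewrite ev => ->.
  have zv : z *m v = - (adj a *m v).
    by rewrite mulmxBl -{1}fv -mulmxAv -[a]aE -mulrA ef mulr0 mul0mx sub0r.
  rewrite zv; split; last by left; rewrite mulmxN -mulmxAv ea'.
  by rewrite oppr_eq0; apply: contraNneq nv => /(inj' _ fv) ->.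
have [v0 nv0] := mx_neq0_vec ne.
have h n : z ^+ n *m (e *m v0) != 0 /\
    (e *m (z ^+ n *m (e *m v0)) = z ^+ n *m (e *m v0) \/ f *m (z ^+ n *m (e *m v0)) = z ^+ n *m (e *m v0)).
  elim: n => [|n IH]; last by rewrite exprS mulmxAv; exact: step.
  by rewrite expr0 mul1mxv; split=> //; left; rewrite -mulmxAv ee.
by have [] := h N; rewrite nil mul0mx eqxx.
Qed.

Lemma distinguished_decomposition : distinguished B x -> orthogonal_decomposition B x.
Proof.
move=> dist; have [r [E [E1 pE E0]]] := selfadjoint_prims dist.
have cE i : cent S (E i) by case: (pE i) => -[].
have EE i : E i * E i = E i by case: (pE i) => -[].
have aE i : adj (E i) = E i by case: (pE i).
exists r, (fun i => imsp (E i)); split.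
- exact: idem_family_direct.
- move=> i; split; first exact: imsp_submodule.
  by apply: prim_indecomposable; case: (pE i).
- move=> i j ij v w; rewrite !mem_imsp // => /eqP <- /eqP <-.
  by rewrite (bform_adj Bnd) aE -mulmxAv E0 // mul0mx /bform mulmx0 mxE.
move=> i j ij [f [fU fK fx fe]].
(* The isomorphism is extended by zero on the other summands, which makes it an element of the
   centralizer. *)
pose a := mx_of f * E i.
have av v : a *m v = f (E i *m v) by rewrite mulmxAv mx_ofE.
have mE l v : E l *m v \in imsp (E l) by rewrite mem_imsp // -mulmxAv EE.
have fG v : v \in imsp (E i) -> f (G *m v) = G *m f v.
  by move=> vi; rewrite !(parmx_even_part hk) linearB linearZ /= fe.
have ca : cent S a.
  move=> y [->|->]; apply: eq_mx_vec => v; rewrite !mulmxAv !mx_ofE.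
    by rewrite -fG // -[E i *m (G *m v)]mulmxAv -(commr_kG (cE i)) mulmxAv.
  by rewrite -fx // -[E i *m (x *m v)]mulmxAv -(commr_kx (cE i)) mulmxAv.
have fa : E j * a = a.
  apply: eq_mx_vec => v; rewrite mulmxAv !av; apply/eqP; rewrite -mem_imsp // -fU.
  exact: memv_img.
have aEi : a * E i = a by rewrite /a -mulrA EE.
have nE : E i != 0 by case: (pE i) => -[].
apply: (no_iso_of_nilp (cE i) (cE j) nE (EE i) (EE j) (aE i) (aE j) (E0 _ _ ij) ca fa aEi).
- move=> v; rewrite av => fv0; apply/eqP; rewrite -memv0 -fK memv_cap mE /=.
  by rewrite memv_ker fv0.
- move=> v; have := mE j v; rewrite -fU => /memv_imgP[w wU wE].
  exists w; rewrite av wE; congr (f _).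
  by apply/esym/eqP; rewrite -mem_imsp.
- by apply: (distinguished_nilp hk Bnd Bpar Bsym gx center0 dist);
  exact: (skewcent_sub hk Bnd Bpar Bsym gx ca).
Qed.

Lemma prim_family_skew_nilp r (E : 'I_r -> 'M[k]_N) z :
  \sum_i E i = 1 -> (forall i, prim_idem S (E i)) -> (forall i, adj (E i) = E i) ->
  (forall i j, i != j -> E i * E j = 0) ->
  (forall i j a c, i != j -> cent S a -> cent S c ->
     E i * a = a -> a * E j = a -> E j * c = c -> c * E i = c -> a * c = E i -> False) ->
  skewcent B x z -> z ^+ N = 0.
Proof.
move=> E1 pE aE E0 noniso [cz az].
have cE i : cent S (E i) by case: (pE i).
have EE i : E i * E i = E i by case: (pE i).
pose R a := cent S a /\ forall i, \tr (E i * a) = 0.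
have trE a i : \tr (E i * a) = \tr (E i * a * E i).
  by rewrite -[in LHS](EE i) -mulrA -[LHS]/(\tr (E i *m (E i * a))) mxtrace_mulC.
(* The trace is invariant under [adj], which fixes [E i] and negates [z]. *)
have Rz : R z.
  split=> // i; have : \tr (E i * z * E i) = - \tr (E i * z * E i).
    rewrite -[in LHS](adj_tr Bnd) !(adjM Bnd) aE az mulNr mulrN linearN /= mulrA //.
  move/eqP; rewrite -addr_eq0 -mulr2n -mulr_natl mulf_eq0 (negbTE (natf_neq0_char0 hk _)) //=.
  by rewrite -trE => /eqP.
(* Insert [\sum_j E j] between [a] and [c]. For [j = i] the two corner elements are nilpotent; for
   [j != i] an invertible product would make the images of [E i] and [E j] isomorphic. *)
have RM a c : R a -> R c -> R (a * c).
  move=> [ca ta] [cc tc]; split=> [|i]; first exact: centM.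
  have corner u : cent S u -> in_corner S (E i) (E i * u * E i).
    by move=> cu; apply: corner_compress.
  rewrite trE -[a]mulr1 -E1 mulr_sumr mulr_suml mulr_sumr mulr_suml raddf_sum big1 //= => j _.
  have [<-|ij] := eqVneq i j.
    have -> : E i * (a * E i * c) * E i = (E i * a * E i) * (E i * c * E i).
      by rewrite !mulrA -(mulrA _ (E i) (E i)) EE.
    apply: (nilp_tr0 (n := N)); apply: (local_nilpM (pE i)); try exact: corner.
    by apply/(local_nilp_tr hk (pE i)) => //; [exact: corner | rewrite -trE].
  apply: (nilp_tr0 (n := N)).
  have ct := corner _ (centM (centM ca (cE j)) cc).
  have [//|[y [cy ty _]]] := local_nilp_or_unit (pE i) ct.
  have [y1 y2 y3] := cy.
  case: (noniso i j (E i * a * E j) (E j * c * E i * y) ij).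
  - by apply: centM => //; apply: centM.
  - by apply: centM => //; apply: centM => //; apply: centM.
  - by rewrite !mulrA EE.
  - by rewrite -mulrA EE.
  - by rewrite !mulrA EE.
  - by rewrite -[LHS]mulrA y3.
  by rewrite -[RHS]ty !mulrA -(mulrA _ (E j) (E j)) EE.
have Rzn n : R (z ^+ n.+1).
  by elim: n => [|n IH]; [rewrite expr1 | rewrite exprS; exact: RM].
apply: (tr_pow0_nilp hk) => n.
rewrite -[z ^+ _]mul1r -E1 mulr_suml raddf_sum big1 //= => i _.
by case: (Rzn n) => _ ->.
Qed.

(** A solution of [[h, e] = e] is averaged with its conjugate by [G], then with [- adj h]; both are
    solutions again. *)
Lemma skew_commutator e n : GRing.comm G e -> adj e = - e -> e ^+ n = 0 ->
  exists h, in_g B false h /\ h * e - e * h = e.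
Proof.
move=> Ge ae en; have [h1 h1E] := nilp_commutator hk en.
have GG := parmx_sq k p q.
pose h2 := 2^-1 *: (h1 + G * h1 * G).
have n2 : 2 != 0 :> k by apply: natf_neq0_char0.
have Gh2 : GRing.comm G h2.
  rewrite /GRing.comm /h2 -scalerMr -scalerMl; congr (_ *: _).
  by rewrite mulrDr mulrDl !mulrA GG mul1r -!mulrA GG mulr1 addrC.
have h2E : h2 * e - e * h2 = e.
  have h3E : G * h1 * G * e - e * (G * h1 * G) = e.
    have -> : G * h1 * G * e = G * (h1 * e) * G by rewrite -!mulrA Ge.
    have -> : e * (G * h1 * G) = G * (e * h1) * G by rewrite !mulrA -Ge.
    by rewrite -mulrBl -mulrBr h1E Ge -mulrA GG mulr1.
  rewrite /h2 -scalerMl -scalerMr mulrDl mulrDr -scalerBr opprD addrACA h1E h3E.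
  by rewrite -mulr2n -scaler_nat scalerA mulVf // scale1r.
clearbody h2.
have a2E : adj h2 * e - e * adj h2 = - e.
  have := congr1 adj h2E; rewrite adjB !(adjM Bnd) ae mulNr mulrN opprK addrC => <-.
  by [].
exists (2^-1 *: (h2 - adj h2)); split.
  apply/(in_g0P hk Bnd); split.
    by apply/commrZ/commrB => //; exact: (adj_even hk Bnd Bpar).
  by rewrite adjZ adjB (adjK Bnd Bpar Bsym Gh2) -scalerN opprB.
rewrite -scalerMl -scalerMr mulrBl mulrBr -scalerBr.
rewrite (_ : _ - _ = (h2 * e - e * h2) - (adj h2 * e - e * adj h2)); last by mx_lin.
rewrite h2E a2E opprK -mulr2n -scaler_nat scalerA mulVf // scale1r //.
Qed.

(* A nilpotent [h] is a bracket [[h', h]] with [h'] in g_0. As [ad h] is both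
   diagonalizable on g_0 and nilpotent, it kills [h']. *)
Lemma nilp_semisimple0 h : semisimple0 B h -> h ^+ N = 0 -> h = 0.
Proof.
move=> [/(in_g0P hk Bnd)[Gh ah] ss] hN.
have [h' [gh' h'E]] := skew_commutator Gh ah hN.
have [r [c [Z [hZ h'Z]]]] := ss _ gh'.
have cZ i : c i *: Z i = 0.
  have [_] := hZ i; rewrite /sbracket expr0 scale1r -[h *m _]/(h * _) -[_ *m h]/(_ * h).
  move=> bE; have [->|nc] := eqVneq (c i) 0; first by rewrite scale0r.
  (* For [c i != 0], [h + (c i)%:M] is invertible while [h] is nilpotent, so taking powers of this
     relation forces [Z i = 0]. *)
  have sw : h * Z i = Z i * (h + (c i)%:M).
    by rewrite mulrDr -(comm_scalar (c i)) scalar_mulE -bE addrC subrK.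
  have swn n : h ^+ n * Z i = Z i * (h + (c i)%:M) ^+ n.
    elim: n => [|n IH]; first by rewrite !expr0 mul1r mulr1.
    by rewrite exprS -mulrA IH mulrA sw -mulrA -exprS.
  have hU : h + (c i)%:M \in unitmx.
    apply: inj_unitmx => v /eqP; rewrite mulmxDl mul_scalar_mx addr_eq0 -scaleNr => /eqP hv.
    have := eigen_shift_exp 0 N hv; rewrite raddf0 subr0 hN mul0mx => /esym/eqP.
    by rewrite scaler_eq0 expf_eq0 subr0 oppr_eq0 (negbTE nc) andbF => /eqP.
  have := swn N; rewrite hN mul0r => /esym z0.
  have uX n : (h + (c i)%:M) ^+ n * (invmx (h + (c i)%:M)) ^+ n = 1.
    elim: n => [|n IH]; first by rewrite !expr0 mulr1.
    rewrite exprSr exprS -!mulrA (mulrA (h + _)) [(h + _) * invmx _]mulmxV //.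
    by rewrite mul1r.
  by rewrite -[Z i]mulr1 -(uX N) mulrA z0 mul0r scaler0.
have h0 : h * h' - h' * h = 0.
  rewrite h'Z mulr_sumr mulr_suml -sumrB big1 // => i _.
  by have [_] := hZ i; rewrite cZ /sbracket expr0 scale1r.
by rewrite -h'E -opprB h0 oppr0.
Qed.

Lemma decomposition_distinguished n : x ^+ n = 0 ->
  orthogonal_decomposition B x -> distinguished B x.
Proof.
move=> xn [r [U [[dirU fullU] hU orthU niso]]] h ssh hx.
have [E [E1 E0 EE UE cE']] := compl_idem_family dirU fullU.
have cE i : cent S (E i).
  move=> y Sy; apply: cE' => j v; apply: submodule_stable => //.
  by case: (hU j).
have mE l v : E l *m v \in U l by rewrite UE -mulmxAv EE.
have aE i : adj (E i) = E i.
  apply: bform_inj => v w; rewrite -(bform_adj Bnd).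
  have split1 u : bform B v (E i *m u) = bform B (E i *m v) (E i *m u).
    rewrite -[v in LHS]mul1mxv -E1 mulmx_suml bform_suml (bigD1 i) //= big1 ?addr0 // => j ji.
    exact: orthU ji _ _ (mE j v) (mE i u).
  rewrite split1 -[w in LHS]mul1mxv -E1 mulmx_suml bform_sumr (bigD1 i) //= big1 ?addr0 // => j ji.
  by apply: orthU (mE i v) (mE j w); rewrite eq_sym.
have pE i : prim_idem S (E i).
  have [_ [nU indU]] := hU i; split=> //.
    apply: contraNneq nU => Ei; rewrite -subv0; apply/subvP => v.
    by rewrite UE Ei mul0mx memv0 eq_sym.
  move=> f [cf ef fe] ff.
  have gg : (E i - f) * (E i - f) = E i - f.
    by rewrite mulrBr !mulrBl EE ef fe ff subrr subr0.
  have cg : cent S (E i - f) by exact: centB.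
  have sU : (imsp f + imsp (E i - f))%VS = U i.
    apply/eqP; rewrite eqEsubv; apply/andP; split; apply/subvP => v.
      case/memv_addP => v1 h1 [v2 h2 ->]; move: h1 h2; rewrite !mem_imsp // UE mulmxDr.
      move=> /eqP <- /eqP <-; rewrite -!mulmxAv ef mulrBr EE ef //.
    rewrite UE => /eqP <-; apply/memv_addP; exists (f *m v).
      by rewrite mem_imsp // -mulmxAv ff.
    exists ((E i - f) *m v); first by rewrite mem_imsp // -mulmxAv gg.
    by rewrite mulmxBl addrC subrK.
  have d0 : (imsp f :&: imsp (E i - f))%VS = 0%VS.
    apply/eqP; rewrite -subv0; apply/subvP => v; rewrite memv_cap !mem_imsp //.
    case/andP => /eqP <- /eqP; rewrite -mulmxAv mulrBl ef ff subrr mul0mx => <-.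
    exact: mem0v.
  have key u : u * u = u -> imsp u = 0%VS -> u = 0.
    move=> uu u0; apply: eq_mx_vec => v; rewrite mul0mx; apply/eqP.
    by rewrite -memv0 -u0 mem_imsp // -mulmxAv uu.
  case: (indU _ _ (imsp_submodule cf ff) (imsp_submodule cg gg) sU d0) => /key h0.
    by left; exact: h0.
  by right; apply/esym/eqP; rewrite -subr_eq0 h0.
have z0 : h ^+ N = 0.
  apply: (prim_family_skew_nilp E1 pE aE E0); last first.
    by apply/(skewcentP hk Bnd); split=> //; case: ssh.
  move=> i j a c ij ca cc Ea aEj Ec cEi ac.
  (* [c * a] is a nonzero idempotent of the corner of the primitive [E j], so the one-sided relation
     [a * c = E i] already gives an isomorphism. *)
  have cace : c * a = E j.
    have [_ _ _ pj] := pE j.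
    have [] := pj (c * a); last by [].
    - split; [exact: centM | by rewrite mulrA Ec | by rewrite -mulrA aEj].
    - by rewrite mulrA -(mulrA c) ac -mulrA Ea.
    move=> ca0; have [_ _ ni _] := pE i; case/eqP: ni.
    by rewrite -[E i]EE -ac mulrA -(mulrA a) ca0 mulr0 mul0r.
  apply: (niso i j ij); exists (linfun (mulmx c : V -> V)); split.
  - apply/eqP; rewrite eqEsubv; apply/andP; split; apply/subvP => v.
      case/memv_imgP => u _ ->; rewrite lfunE /= UE -mulmxAv Ec //.
    rewrite UE => /eqP <-; apply/memv_imgP; exists (a *m v).
      by rewrite UE -mulmxAv Ea.
    by rewrite lfunE /= -mulmxAv cace.
  - apply/eqP; rewrite -subv0; apply/subvP => v; rewrite memv_cap UE memv_ker lfunE /=.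
    case/andP => /eqP vE /eqP cv.
    by rewrite memv0 -vE -ac mulmxAv cv mulmx0.
  - by move=> v _; rewrite !lfunE /= -!mulmxAv (commr_kx cc).
  move=> v _; rewrite !lfunE /= !(even_partE hk) -scalemxAr mulmxDr.
  by rewrite -!mulmxAv (commr_kG cc).
rewrite (nilp_semisimple0 ssh z0); split.
  by apply/(in_g0P hk Bnd); rewrite adj0 oppr0; split=> //; exact: commr0.
by move=> d Y _; rewrite /sbracket mul0mx mulmx0 scaler0 subrr.
Qed.
End Equivalence.

(** * Normal forms and sl_2-triples *)

Section Triples.
Variables (k : closedFieldType) (hk : [pchar k] =i pred0) (p q : nat).
Local Notation N := (p + q)%N.
Local Notation G := (parmx k p q).
Variables (b : bool) (B : 'M[k]_N).
Hypotheses (Bnd : form_nondegenerate B) (Bpar : form_parity b B)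
  (Bsym : form_supersymmetric B).
Variable x : 'M[k]_N.
Hypothesis gx : in_g B true x.
Local Notation S := (kx_gens G x).
Local Notation adj := (adj B).
Local Notation V := 'cV[k]_N.
Implicit Types (v w y : V) (e : 'M[k]_N).

(** [skew_commutator] writes [[x, x]] as a single bracket in g_0, which puts it in the derived
    algebra. *)
Lemma nilp_ad_nilpotent n : x ^+ n = 0 -> ad_nilpotent B x.
Proof.
move=> xn; have [ce ae] := skewcent_sqr hk Bnd Bpar gx.
rewrite /ad_nilpotent; have -> : sbracket true true x x = 2 *: (x * x).
  by rewrite /sbracket /= expr1 scaleN1r opprK -mulr2n -scaler_nat.
set e := 2 *: (x * x).
have Ge : GRing.comm G e by apply/commrZ/(commr_kG ce).
have ae' : adj e = - e by rewrite /e adjZ ae scalerN.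
have en : e ^+ n = 0.
  have eX m : e ^+ m = 2 ^+ m *: (x * x) ^+ m.
    elim: m => [|m IH]; first by rewrite !expr0 scale1r.
    by rewrite !exprS IH /e -scalerMl -scalerMr scalerA.
  have xx : (x * x) ^+ n = x ^+ n * x ^+ n by rewrite -!expr2 exprAC.
  by rewrite eX xx xn mul0r scaler0.
clearbody e; have [h [gh hE]] := skew_commutator hk Bnd Bpar Bsym Ge ae' en.
have ge : in_g B false e by apply/(in_g0P hk Bnd).
split.
  exists 1%N, (fun _ => h), (fun _ => e); split; first by [].
  by rewrite big_ord1 /sbracket expr0 scale1r.
exists (n + n)%N => Y _.
(* [m] brackets with [e] distribute [m] factors [e] over the two sides of [Y]; with [2 n] of them
   one side gets at least [n]. *)
have key m i j : (n + n <= i + j + m)%N ->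
    e ^+ i * iter m (sbracket false false e) Y * e ^+ j = 0.
  elim: m i j => [|m IH] i j le.
    have [ni|ni] := leqP n i.
      by rewrite -(subnK ni) exprD en mulr0 !mul0r.
    have nj : (n <= j)%N by lia.
    by rewrite -(subnKC nj) exprD en mul0r mulr0.
  rewrite iterS; set Z := iter m _ _ in IH *.
  rewrite /sbracket expr0 scale1r -[e *m Z]/(e * Z) -[Z *m e]/(Z * e).
  rewrite mulrBr mulrBl !mulrA -exprSr -[_ * e * e ^+ j]mulrA -exprS.
  by rewrite !IH ?subrr //; lia.
by have := key (n + n)%N 0%N 0%N; rewrite !expr0 mul1r mulr1; apply.
Qed.

Lemma bform_eq0r y : (forall w, bform B w y = 0) -> y = 0.
Proof.
move=> h; suff : B *m y = 0.
  by move/(congr1 (mulmx (invmx B))); rewrite mulKmx ?form_unit // mulmx0.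
apply/colP => i; rewrite [RHS]mxE -[RHS](h (delta_mx i 0)).
by rewrite /bform -mulmxA trmx_delta -rowE [RHS]mxE.
Qed.

Lemma bformN v w : bform B v (- w) = - bform B v w.
Proof. by rewrite /bform mulmxN mxE. Qed.
Lemma bformZr v c w : bform B v (c *: w) = c * bform B v w.
Proof. by rewrite /bform -scalemxAr mxE. Qed.
Lemma bformZl v c w : bform B (c *: v) w = c * bform B v w.
Proof. by rewrite /bform linearZ /= -!scalemxAl mxE. Qed.
Lemma bform0r v : bform B v 0 = 0.
Proof. by rewrite /bform mulmx0 mxE. Qed.
Lemma bformDr v w y : bform B v (w + y) = bform B v w + bform B v y.
Proof. by rewrite /bform mulmxDr mxE. Qed.

Lemma frame_bform_eq0 r (v : 'I_r -> V) d y : frame x v d ->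
  (forall i a, (a < d i)%N -> bform B (chain x (v i) (d i) a) y = 0) -> y = 0.
Proof.
move=> fr h; apply: bform_eq0r => w.
have e u : bform B u y = ((B *m y)^T *m u) 0 0.
  by rewrite /bform -mulmxA -[u in RHS]trmxK -trmx_mul [RHS]mxE.
rewrite e (_ : (B *m y)^T = 0) ?mul0mx ?mxE //.
apply: (frame_uniq fr) => i a ad; rewrite mul0mx; apply/matrixP => s t.
by rewrite !ord1 -e h // mxE.
Qed.

Lemma adj_comm_x h : GRing.comm G h -> h * x - x * h = x ->
  (- adj h) * x - x * (- adj h) = x.
Proof.
move=> Gh hx; have Gah := adj_even hk Bnd Bpar Gh.
have := congr1 adj hx; rewrite adjB !(adjM Bnd) (adj_x hk Bnd Bpar gx).
rewrite mulrN mulNr -scalerMr -scalerMl -opprD -scalerN -scalerDr => /oppr_inj.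
move=> /(congr1 ( *:%R ((-1) ^+ b))); rewrite !scalerA -expr2 sqrr_sign !scale1r.
move=> /(congr1 ( *%R G)); have GGx : G * (G * x) = x by rewrite mulrA parmx_sq mul1r.
rewrite mulrDr mulrN (mulrA G (G * x)) GGx (mulrA G (adj h)) Gah -(mulrA (adj h) G) GGx.
by rewrite mulNr mulrN opprK addrC.
Qed.

Lemma skew_average h : GRing.comm G h ->
  GRing.comm G (2^-1 *: (h - adj h)) /\ adj (2^-1 *: (h - adj h)) = - (2^-1 *: (h - adj h)).
Proof.
move=> Gh; split.
  by apply/commrZ/commrB => //; exact: (adj_even hk Bnd Bpar).
by rewrite adjZ adjB (adjK Bnd Bpar Bsym Gh) -scalerN opprB.
Qed.

Lemma half_double e : 2^-1 *: (e + e) = e.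
Proof.
by rewrite -mulr2n -scaler_nat scalerA mulVf ?scale1r // natf_neq0_char0.
Qed.

Lemma half_bracket h e f : h * e - e * h = f -> (- adj h) * e - e * (- adj h) = f ->
  (2^-1 *: (h - adj h)) * e - e * (2^-1 *: (h - adj h)) = f.
Proof.
move=> h1 h2; rewrite -scalerMl -scalerMr -scalerBr mulrDl mulrDr opprD addrACA h1 h2.
exact: half_double.
Qed.

Section Frame.
Variables (r : nat) (E : 'I_r -> 'M[k]_N) (n : nat).
Hypotheses (xn : x ^+ n = 0) (E1 : \sum_i E i = 1)
  (pE : forall i, prim_idem S (E i)) (aE : forall i, adj (E i) = E i)
  (E0 : forall i j, i != j -> E i * E j = 0).

Let cE i : cent S (E i). Proof. by case: (pE i). Qed.
Let EE i : E i * E i = E i. Proof. by case: (pE i). Qed.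

Lemma Gx_sign : G * x = -1 *: (x * G). Proof. exact: (Gx_anti hk Bnd Bpar gx). Qed.

Lemma G_chain (v : V) d a (c : k) : G *m v = c *: v -> (a < d)%N ->
  G *m chain x v d a = ((-1) ^+ (d - a.+1) * c) *: chain x v d a.
Proof.
move=> Gv ad; rewrite /chain ad -mulmxAv (GxX Gx_sign) -scalemxAl mulmxAv Gv.
by rewrite -scalemxAr scalerA.
Qed.

Lemma E_chain (v : V) i d a : E i *m v = v -> E i *m chain x v d a = chain x v d a.
Proof.
move=> Ev; rewrite /chain; case: ifP => _; last by rewrite mulmx0.
by rewrite -mulmxAv (commrX _ (commr_sym (commr_kx (cE i)))) mulmxAv Ev.
Qed.

Lemma Eij_chain (v : V) i j d a : i != j -> E j *m v = v -> E i *m chain x v d a = 0.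
Proof. by move=> ij Ev; rewrite -(E_chain d a Ev) -mulmxAv E0 ?mul0mx. Qed.

(** Start from the operator that multiplies [x ^+ j *m v] by [j] and average it with [- adj h]. The
    average need not be diagonal on these chains; [normal_generator] chooses new generators for
    it. *)
Lemma skew_grading : exists h, [/\ GRing.comm G h, adj h = - h, h * x - x * h = x &
  forall i, GRing.comm (E i) h].
Proof.
have [v [d [c [[d0 xv fr] hv]]]] := prim_family_frame hk (parmx_sq k p q)
  (etrans (mulrNN 1 1) (mulr1 1)) Gx_sign xn pE E1 E0.
have [h hE] := frame_ext (fun i a => ((d i - a.+1)%N)%:R *: chain x (v i) (d i) a) fr.
have Gh : GRing.comm G h.
  apply: (frame_uniq fr) => i a ad; have [_ _ Gv _ _] := hv i.
  by rewrite !mulmxAv hE // -scalemxAr (G_chain Gv ad) -scalemxAr hE // !scalerA mulrC.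
have hx : h * x - x * h = x.
  apply: (frame_uniq fr) => i [|a] ad.
    by rewrite mulmxBl !mulmxAv hE // -scalemxAr !chain0 // scaler0 mulmx0 subrr.
  rewrite mulmxBl !mulmxAv hE // -scalemxAr chainS // hE ?(ltnW ad) //.
  by rewrite -scalerBl -natrB ?leq_sub2l // -(subnSK ad) subSnn scale1r.
have Eh i : GRing.comm (E i) h.
  apply: (frame_uniq fr) => j a ad; have [_ Ev _ _ _] := hv j.
  rewrite !mulmxAv hE // -scalemxAr; have [->|ij] := eqVneq i j.
    by rewrite (E_chain _ _ Ev) hE.
  by rewrite (Eij_chain _ _ ij Ev) scaler0 mulmx0.
have [G0 a0] := skew_average Gh.
exists (2^-1 *: (h - adj h)); split=> //.
  by apply: half_bracket => //; exact: adj_comm_x.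
move=> i; apply/commrZ/commrB => //.
by have := congr1 adj (Eh i); rewrite !(adjM Bnd) aE.
Qed.

(* Let [mu] be the eigenvalue of [h] on the socle of the chain and [la = mu - (d - 1)]. As
   [x ^+ (d - 1) * (h - la)] vanishes on the chain, [h - la] has a kernel vector [w] there.
   The last nonzero [x ^+ m w] is in the socle, so [la + m = mu] and [w] is a generator. *)
Lemma normal_generator h (v : V) d (c : k) i Q :
  GRing.comm G h -> adj h = - h -> h * x - x * h = x -> GRing.comm (E i) h ->
  c = 1 \/ c = -1 -> E i *m v = v -> (0 < d)%N -> x ^+ d.-1 *m v != 0 -> x ^+ d *m v = 0 ->
  chainmx x v d *m Q = E i -> Q *m chainmx x v d = 1%:M ->
  exists (w : V) (c' : k),
    [/\ E i *m w = w, G *m w = c' *: w /\ (c' = 1 \/ c' = -1),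
        x ^+ d.-1 *m w != 0 /\ x ^+ d *m w = 0,
        exists Q', chainmx x w d *m Q' = E i /\ Q' *m chainmx x w d = 1%:M &
        exists la : k, h *m w = la *: w].
Proof.
move=> Gh ah hx Eh hc Ev d0 nv xv PQ QP.
have n0 := d0.
pose u := x ^+ d.-1 *m v.
have xE w : E i *m w = w -> E i *m (x *m w) = x *m w.
  by move=> ew; rewrite -mulmxAv -(commr_kx (cE i)) mulmxAv ew.
have xXE m w : E i *m w = w -> E i *m (x ^+ m *m w) = x ^+ m *m w.
  move=> ew; elim: m => [|m IH]; first by rewrite expr0 mul1mxv.
  by rewrite exprS mulmxAv xE.
have hE w : E i *m w = w -> E i *m (h *m w) = h *m w.
  by move=> ew; rewrite -mulmxAv Eh mulmxAv ew.
have hxv w : h *m (x *m w) = x *m (h *m w) + x *m w.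
  by rewrite -!mulmxAv -mulmxDl -[X in _ + X]hx addrC subrK.
have hxn m w : h *m (x ^+ m *m w) = x ^+ m *m (h *m w) + m%:R *: (x ^+ m *m w).
  elim: m => [|m IH]; first by rewrite !expr0 !mul1mxv scale0r addr0.
  rewrite !exprS !mulmxAv hxv IH mulmxDr -scalemxAr; vec_ring.
have c0u : chain x v d 0 = u by rewrite /chain d0 subn1.
(* The kernel of [x] on the image of [E i] is the line of [u]. *)
have socle w : E i *m w = w -> x *m w = 0 -> exists mu, w = mu *: u.
  move=> ew xw; pose t := Q *m w.
  have wE : w = chainmx x v d *m t by rewrite mulmxA PQ ew.
  have [t0|nt] := eqVneq t 0; first by exists 0; rewrite wE t0 mulmx0 scale0r.
  have [a [na xa tz]] := chain_top xv nt.
  have a0 : a = 0%N :> nat.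
    case: (posnP a) => // a0; case/eqP: na; move/eqP: xa.
    rewrite -wE -(prednK a0) exprSr mulmxAv xw mulmx0 eq_sym scaler_eq0 c0u.
    by rewrite (negbTE nv) orbF => /eqP.
  exists (t a 0); rewrite wE chain_comb (bigD1 a) //= a0 c0u big1 ?addr0 // => c1 nc1.
  rewrite tz ?scale0r // a0 lt0n -a0; apply: contra nc1 => /eqP e.
  by apply/eqP/val_inj.
have Eu : E i *m u = u by exact: xXE.
have xu : x *m u = 0 by rewrite /u -mulmxAv -exprS prednK.
have [mu hu] : exists mu, h *m u = mu *: u.
  apply: socle; first exact: hE.
  by have := hxv u; rewrite xu mulmx0 addr0 => <-.
pose la := mu - d.-1%:R.
have EP : E i *m chainmx x v d = chainmx x v d by rewrite -PQ -mulmxA QP mulmx1.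
have [w1 [nw1 Ew1 hw1]] : exists w1, [/\ w1 != 0, E i *m w1 = w1 & h *m w1 = la *: w1].
  apply: NNPP => nex.
  have RU : Q *m ((h - la%:M) *m chainmx x v d) \in unitmx.
    apply: inj_unitmx => t ht; apply/eqP/negPn/negP => nt; apply: nex.
    pose w1 := chainmx x v d *m t.
    have Ew1 : E i *m w1 = w1 by rewrite /w1 mulmxA EP.
    exists w1; split=> //.
      apply: contraNneq nt => z; apply/eqP.
      exact: (chainmx_inj d0 nv xv z).
    have e1 : E i *m ((h - la%:M) *m w1) = (h - la%:M) *m w1.
      by rewrite mulmxBl mulmxBr mul_scalar_mx -scalemxAr hE // Ew1.
    apply/eqP; rewrite -subr_eq0 -mul_scalar_mx -mulmxBl -e1 -PQ.
    by rewrite -(mulmxA (chainmx x v d)) [Q *m _](_ : _ = 0) ?mulmx0 // -[RHS]ht /w1 !mulmxA.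
  pose y := chainmx x v d *m (invmx (Q *m ((h - la%:M) *m chainmx x v d)) *m (Q *m v)).
  have Ey : E i *m y = y by rewrite /y (mulmxA (E i)) EP.
  have hy : (h - la%:M) *m y = v.
    have e1 : E i *m ((h - la%:M) *m y) = (h - la%:M) *m y.
      by rewrite mulmxBl mulmxBr mul_scalar_mx -scalemxAr hE // Ey.
    rewrite -e1 -PQ -mulmxA.
    have -> : Q *m ((h - la%:M) *m y) = Q *m v.
      rewrite /y; set R := Q *m (_ *m _) in RU *; rewrite -[RHS](mulKVmx RU) /R.
      by rewrite !mulmxA.
    by rewrite mulmxA PQ.
  case/eqP: nv; rewrite -/u.
  have xy : x *m (x ^+ d.-1 *m y) = 0.
    have -> : y = chainmx x v d *m (Q *m y) by rewrite mulmxA PQ.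
    rewrite -mulmxAv -exprS prednK // mulmxA; suff -> : x ^+ d *m chainmx x v d = 0 by rewrite mul0mx.
    apply/matrixP => s t; have := congr1 (fun z : 'cV_N => z s 0) (col_chainmx x v t).
    move=> _; have : x ^+ d *m chain x v d t = 0 by rewrite chain_expr // leqNgt ltn_ord.
    by rewrite -col_chainmx mulmxA -colE => /colP/(_ s); rewrite !mxE.
  have [nu yE] := socle _ (xXE d.-1 _ Ey) xy.
  have := hxn d.-1 y; rewrite yE -scalemxAr hu scalerA => e2.
  rewrite /u -hy mulmxBl mul_scalar_mx mulmxBr -scalemxAr yE.
  have -> : x ^+ d.-1 *m (h *m y) = (nu * mu - d.-1%:R * nu) *: u.
    by rewrite scalerBl -(scalerA nu) e2 addrK.
  by rewrite scalerA -scalerBl /la (_ : _ - _ = 0) ?scale0r //; ring.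
have n1 : 1%:M *m w1 != 0 by rewrite mul1mx.
have [c' [hc' Gw nw]] := homogeneous_part hk (parmx_sq k p q) (L := 1%:M) n1.
set w := w1 + _ in Gw nw; rewrite mul1mx in nw.
have Ew : E i *m w = w.
  by rewrite /w mulmxDr Ew1 -scalemxAr -mulmxAv -(commr_kG (cE i)) mulmxAv Ew1.
have hw : h *m w = la *: w.
  rewrite /w mulmxDr hw1 -scalemxAr -mulmxAv -Gh mulmxAv hw1 -scalemxAr scalerDr.
  by rewrite !scalerA [c' * _]mulrC.
clearbody w.
have [m [_ nm zm]] := last_nonzero (nilp_expN xn) nw.
have [nu nuE] : exists nu, x ^+ m *m w = nu *: u.
  by apply: socle; [exact: xXE | rewrite -mulmxAv -exprS].
have md : m = d.-1.
  apply: (char0_natr_inj hk); have := hxn m w; rewrite hw -scalemxAr -scalerDl nuE.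
  rewrite -scalemxAr hu !scalerA => /eqP; rewrite -subr_eq0 -scalerBl scaler_eq0 (negbTE nv) orbF.
  have nnu : nu != 0 by apply: contraNneq nm => nu0; rewrite nuE nu0 scale0r.
  rewrite /la mulrC -mulrBl mulf_eq0 (negbTE nnu) orbF => /eqP e.
  by apply/eqP; rewrite -subr_eq0 -oppr_eq0; apply/eqP; rewrite -[RHS]e; ring.
rewrite md prednK // in nm zm.
exists w, c'; split=> //; last by exists la.
pose R := Q *m chainmx x w d.
have PR : chainmx x w d = chainmx x v d *m R.
  rewrite /R mulmxA PQ; apply/matrixP => s t.
  have : E i *m chain x w d t = chain x w d t by exact: E_chain.
  by move/colP/(_ s); rewrite -col_chainmx mulmxA -!colE !mxE.
have RU : R \in unitmx.
  apply: inj_unitmx => t ht; apply: (chainmx_inj d0 nm zm).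
  by rewrite PR -mulmxA ht mulmx0.
exists (invmx R *m Q); split.
  by rewrite PR -mulmxA (mulmxA R) mulmxV // mul1mx.
by rewrite -mulmxA -/R mulVmx.
Qed.

Lemma normal_frame : exists (v : 'I_r -> V) (d : 'I_r -> nat) (c : 'I_r -> k),
  [/\ jordan_frame x v d, forall i, G *m v i = c i *: v i, forall i, odd (d i) = ~~ b &
      forall i j a a', (a < d i)%N -> (a' < d j)%N -> i != j \/ (a + a' != (d i).-1)%N ->
        bform B (chain x (v i) (d i) a) (chain x (v j) (d j) a') = 0].
Proof.
have [h [Gh ah hx Eh]] := skew_grading.
have [v0 [d [c0 [[d0 xv0 fr0] hv]]]] := prim_family_frame hk (parmx_sq k p q)
  (etrans (mulrNN 1 1) (mulr1 1)) Gx_sign xn pE E1 E0.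
have hw i : exists w : V * k * k,
    [/\ E i *m w.1.1 = w.1.1, G *m w.1.1 = w.1.2 *: w.1.1 /\ (w.1.2 = 1 \/ w.1.2 = -1),
        x ^+ (d i).-1 *m w.1.1 != 0 /\ x ^+ d i *m w.1.1 = 0,
        exists Q', chainmx x w.1.1 (d i) *m Q' = E i /\ Q' *m chainmx x w.1.1 (d i) = 1%:M &
        h *m w.1.1 = w.2 *: w.1.1].
  have [hc Ev _ nv [Q [PQ QP]]] := hv i.
  have [w [c' [Ew Gw nw hQ [la hla]]]] :=
    normal_generator Gh ah hx (Eh i) hc Ev (d0 i) nv (xv0 i) PQ QP.
  by exists (w, c', la).
have [w wP] := fin_all_exists hw.
pose v i := (w i).1.1; pose c i := (w i).1.2; pose la i := (w i).2.
have Ev i : E i *m v i = v i by case: (wP i).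
have Gv i : G *m v i = c i *: v i by case: (wP i) => _ [].
have hc i : c i * c i = 1 by case: (wP i) => _ [_ [e|e]] _ _ _; rewrite /c e ?mulrNN mulr1.
have nv i : x ^+ (d i).-1 *m v i != 0 by case: (wP i) => _ _ [].
have xv i : x ^+ d i *m v i = 0 by case: (wP i) => _ _ [].
have hv' i : h *m v i = la i *: v i by case: (wP i).
have fr : frame x v d by apply: (frame_of_idems E1 E0) => i; case: (wP i).
clearbody v c la; exists v, d, c.
have hch i a : (a < d i)%N ->
    h *m chain x (v i) (d i) a = (la i + (d i - a.+1)%N%:R) *: chain x (v i) (d i) a.
  move=> ad; rewrite /chain ad.
  elim: (d i - a.+1)%N => [|m IH]; first by rewrite expr0 !mul1mxv addr0.
  rewrite exprS !mulmxAv -[h *m _]mulmxAv -[h * x](subrK (x * h)) hx mulmxDl mulmxAv IH.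
  by rewrite -scalemxAr; vec_ring.
have skew u y : bform B (h *m u) y = - bform B u (h *m y).
  by rewrite (bform_adj Bnd) ah mulNmx bformN.
have orth i j a a' : i != j -> bform B (chain x (v i) (d i) a) (chain x (v j) (d j) a') = 0.
  move=> ij; rewrite -(E_chain _ _ (Ev j)) -{1}(aE j) -(bform_adj Bnd).
  rewrite (Eij_chain _ _ _ (Ev i)) 1?eq_sym //.
  by rewrite /bform trmx0 !mul0mx mxE.
have weight i a a' : (a < d i)%N -> (a' < d i)%N ->
    (la i + (d i - a.+1)%N%:R + (la i + (d i - a'.+1)%N%:R)) *
      bform B (chain x (v i) (d i) a) (chain x (v i) (d i) a') = 0.
  move=> ad ad'; have := skew (chain x (v i) (d i) a) (chain x (v i) (d i) a').
  rewrite !hch // bformZl bformZr => /eqP; rewrite -subr_eq0 opprK -mulrDl => /eqP.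
  by [].
(* The socle vector is orthogonal to every chain vector in the image of [x], so by nondegeneracy it
   must pair with the generator. *)
have top i : bform B (v i) (chain x (v i) (d i) 0) != 0.
  apply/eqP => z; have := nv i; have c0E : x ^+ (d i).-1 *m v i = chain x (v i) (d i) 0.
    by rewrite /chain d0 subn1.
  rewrite c0E => /eqP; apply; apply: (frame_bform_eq0 fr) => j a ad.
  have [ji|] := eqVneq j i; last exact: orth.
  rewrite ji in ad *; have [ad1|] := ltnP a.+1 (d i).
    rewrite -(chainS _ _ ad1) (bform_adj Bnd) (adj_x hk Bnd Bpar gx) mulNmx -scalemxAl.
    by rewrite mulmxAv chain0 // mulmx0 scaler0 oppr0 bform0r.
  move=> le; have -> : a = (d i).-1 by lia.
  by rewrite chain_last.
have la2 i : 2 * la i + (d i).-1%:R = 0.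
  have := weight i (d i).-1 0%N; rewrite chain_last // prednK // subnn => /(_ (leqnn _) (d0 i)) /eqP.
  rewrite mulf_eq0 (negbTE (top i)) orbF subn1 => /eqP <-; ring.
split=> //.
(* Moving [G] across the nonzero pairing of the generator with the socle compares the signs
   [(-1) ^+ (d i - 1)] and [(-1) ^+ b]. *)
- move=> i; have := bform_adj Bnd G (v i) (G *m chain x (v i) (d i) 0).
  rewrite (adj_parmx hk Bnd Bpar) -scalemxAl -[G *m (G *m _)]mulmxAv parmx_sq mul1mxv.
  rewrite Gv (G_chain (Gv i)) // bformZl !bformZr mulrA => /eqP.
  rewrite -subr_eq0 -mulrBl mulf_eq0 (negbTE (top i)) orbF subr_eq0.
  rewrite mulrCA hc mulr1 -signr_odd => /eqP sg.
  have : odd (d i - 1) == b by apply/negPn/negP => /(sgn_neq hk)/eqP; apply.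
  by move/eqP <-; rewrite oddB // addbT negbK.
- move=> i j a a' ad ad' [ij|]; first exact: orth.
  have [ij|ij] := eqVneq i j; last by move=> _; exact: orth.
  move: ad'; rewrite -ij => ad' ne; have := weight i a a' ad ad' => /eqP; rewrite mulf_eq0 => /orP[|/eqP //].
  move=> /eqP w0; case/eqP: ne; apply: (char0_natr_inj hk).
  move: w0; rewrite !natrB // => w0.
  have dd : (d i)%:R = (d i).-1%:R + 1 :> k by rewrite -[in LHS](prednK (d0 i)) -natr1.
  have := la2 i => l2; rewrite natrD; apply/eqP; rewrite -subr_eq0; apply/eqP.
  have -> : a%:R + a'%:R - (d i).-1%:R =
    (2 * la i + (d i).-1%:R) - (la i + ((d i)%:R - a.+1%:R) + (la i + ((d i)%:R - a'.+1%:R))) :> k.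
    by rewrite dd; ring.
  by rewrite w0 l2 subrr.
Qed.

End Frame.

Section Sl2Frame.
Variables (r : nat) (v : 'I_r -> V) (d : 'I_r -> nat) (c : 'I_r -> k).
Hypotheses (jf : jordan_frame x v d) (Gv : forall i, G *m v i = c i *: v i)
  (gram : forall i j a a', (a < d i)%N -> (a' < d j)%N -> i != j \/ (a + a' != (d i).-1)%N ->
        bform B (chain x (v i) (d i) a) (chain x (v j) (d j) a') = 0).
Local Notation ch i a := (chain x (v i) (d i) a).

Let fr : frame x v d. Proof. by case: jf. Qed.

Lemma frame_skew (phi : 'I_r -> nat -> k) h :
  (forall i a, (a < d i)%N -> h *m ch i a = phi i a *: ch i a) ->
  (forall i a a', (a < d i)%N -> (a' < d i)%N -> (a + a' = (d i).-1)%N -> phi i a + phi i a' = 0) ->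
  adj h = - h.
Proof.
move=> hE hphi; apply: (frame_uniq fr) => j a' ad'.
apply/eqP; rewrite -subr_eq0; apply/eqP; apply: (frame_bform_eq0 fr) => i a ad.
rewrite mulNmx opprK hE // bformDr -(bform_adj Bnd) hE // bformZl bformZr -mulrDl.
have [ij|ij] := eqVneq i j; last by rewrite gram ?mulr0 //; left.
rewrite -ij in ad' *; have [e|ne] := eqVneq (a + a')%N (d i).-1.
  by rewrite hphi ?mul0r.
by rewrite gram ?mulr0 //; right.
Qed.

Lemma frame_even h t : (forall i a, (a < d i)%N -> h *m ch i a = t i a *: ch i a.+2) ->
  GRing.comm G h.
Proof.
move=> hE; apply: (frame_uniq fr) => i a ad.
rewrite !mulmxAv hE // (G_chain (Gv i)) // -!scalemxAr hE //.
have [ad2|le] := ltnP a.+2 (d i); last by rewrite /chain ltnNge le mulmx0 !scaler0.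
rewrite (G_chain (Gv i)) // !scalerA mulrC; congr (_ * _ * _ *: _).
by rewrite -(subnSK (ltnW ad2)) -(subnSK ad2) !exprS mulrA mulrNN mulr1 mul1r.
Qed.

(** The hypotheses are, on chain vectors, skewness of [h], [[h, x^2] = 2 x^2] and [[x^2, f] = h].
    The operator [f] need not be skew, but [- adj f] satisfies the same relations, so the average of
    the two completes the triple. *)
Lemma sl2_of_frame (phi g : 'I_r -> nat -> k) :
  (forall i a a', (a < d i)%N -> (a' < d i)%N -> (a + a' = (d i).-1)%N -> phi i a + phi i a' = 0) ->
  (forall i a, (a.+2 < d i)%N -> phi i a - phi i a.+2 = 2) ->
  (forall i a, (a < d i)%N ->
     (if (a.+2 < d i)%N then g i a else 0) - (if (2 <= a)%N then g i (a - 2)%N else 0) = phi i a) ->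
  exists h f,
    [/\ in_g B false h, forall i a, (a < d i)%N -> h *m ch i a = phi i a *: ch i a,
        forall i a, (a < d i)%N -> f *m ch i a = g i a *: ch i a.+2,
        in_g B false (2^-1 *: (f - adj f)) & sl2 (x * x) h (2^-1 *: (f - adj f))].
Proof.
move=> hA hB hC; have [d0 xv _] := jf.
have [h hE] := frame_ext (fun i (a : nat) => phi i a *: ch i a) fr.
have [f fE] := frame_ext (fun i (a : nat) => g i a *: ch i a.+2) fr.
have ah := frame_skew hE hA.
have Gh : GRing.comm G h.
  apply: (frame_uniq fr) => i a ad.
  by rewrite !mulmxAv hE // (G_chain (Gv i)) // -!scalemxAr hE // (G_chain (Gv i)) // !scalerA mulrC.
have Gf := frame_even fE.
have xx (i : 'I_r) a : (a < d i)%N -> (x * x) *m ch i a = if (2 <= a)%N then ch i (a - 2)%N else 0.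
  by move=> ad; rewrite -expr2 chain_expr.
have he : h * (x * x) - (x * x) * h = 2 *: (x * x).
  apply: (frame_uniq fr) => i a ad; rewrite mulmxBl !(mulmxAv h) (mulmxAv (x * x) h) hE //.
  rewrite -scalemxAr -scalemxAl xx //; case: ltnP => a2; last by rewrite mulmx0 !scaler0 subrr.
  rewrite hE -?scalerBl; last by lia.
  have e2 : (a - 2).+2 = a by lia.
  by have := hB i (a - 2)%N; rewrite e2 => ->.
have hf : h * f - f * h = - 2 *: f.
  apply: (frame_uniq fr) => i a ad; rewrite mulmxBl !mulmxAv hE // -scalemxAr -scalemxAl fE //.
  have [ad2|le] := ltnP a.+2 (d i); last by rewrite /chain ltnNge le !scaler0 mulmx0 subr0.
  rewrite -scalemxAr hE // !scalerA -scalerBl; congr (_ *: _).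
  by rewrite (_ : phi i a = phi i a.+2 + 2) -?(hB i a ad2); ring.
have ef : (x * x) * f - f * (x * x) = h.
  apply: (frame_uniq fr) => i a ad.
  rewrite mulmxBl (mulmxAv _ f) (mulmxAv f) hE // fE // -scalemxAr (xx i a) // -(hC i a ad) scalerBl.
  congr (_ - _).
    have [ad2|le] := ltnP a.+2 (d i); last by rewrite /chain ltnNge le mulmx0 scaler0 scale0r.
    by rewrite xx //= !subSS subn0.
  case: ltnP => a2; last by rewrite mulmx0 scale0r.
  have e2 : (a - 2).+2 = a by lia.
  by rewrite fE ?e2 //; lia.
have [ce ae] := skewcent_sqr hk Bnd Bpar gx.
exists h, f; split=> //.
- by apply/(in_g0P hk Bnd).
- by apply/(in_g0P hk Bnd); exact: skew_average.
split=> //.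
  have h2 : h * (- adj f) - (- adj f) * h = - 2 *: (- adj f).
    have e2 : h * adj f - adj f * h = - 2 *: adj f.
      have := congr1 adj hf; rewrite adjB !(adjM Bnd) adjZ ah mulrN mulNr opprK addrC.
      by [].
    by rewrite mulrN mulNr opprK scalerN -e2 opprB addrC.
  rewrite -scalerMl -scalerMr -scalerBr mulrDl mulrDr opprD addrACA hf h2 -scalerDr.
  by rewrite scalerA mulrC -scalerA.
have h3 : (x * x) * (- adj f) - (- adj f) * (x * x) = h.
  have e3 : (x * x) * adj f - adj f * (x * x) = - h.
    have := congr1 adj ef; rewrite adjB (adjM Bnd _ f) (adjM Bnd f) ah ae mulrN mulNr opprK addrC.
    by [].
  by rewrite mulrN mulNr opprK -[RHS]opprK -e3 opprB addrC.
rewrite -scalerMl -scalerMr -scalerBr mulrDl mulrDr opprD addrACA ef h3.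
exact: half_double.
Qed.
End Sl2Frame.
End Triples.

(** * Ad-nilpotent elements and the center *)

Section Tensors.
Variables (k : closedFieldType) (hk : [pchar k] =i pred0) (p q : nat).
Local Notation N := (p + q)%N.
Local Notation G := (parmx k p q).
Variables (b : bool) (B : 'M[k]_N).
Hypotheses (Bnd : form_nondegenerate B) (Bpar : form_parity b B)
  (Bsym : form_supersymmetric B).
Local Notation adj := (adj B).
Local Notation V := 'cV[k]_N.
Implicit Types (u v w : V) (X Z : 'M[k]_N).

(* The operator [v |-> B(u, v) w]. *)
Definition tens w u : 'M[k]_N := w *m u^T *m B.

Lemma tens_mull X w u : X * tens w u = tens (X *m w) u.
Proof. by rewrite /tens -[LHS]/(X *m _) !mulmxA. Qed.

Lemma tens_mulr X w u : tens w u * adj X = tens w (X *m u).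
Proof.
have e : X^T *m B = B *m adj X := esym (form_adj Bnd X).
by rewrite /tens trmx_mul -[LHS]/(_ *m adj X) -!mulmxA e.
Qed.

Lemma tens_mulr_skew X w u : adj X = - X -> tens w u * X = - tens w (X *m u).
Proof. by move=> aX; rewrite -tens_mulr aX mulrN opprK. Qed.

Lemma tens_mulG w u : tens w u * G = (-1) ^+ b *: tens w (G *m u).
Proof.
rewrite -tens_mulr (adj_parmx hk Bnd Bpar) -scalerMr scalerA -expr2 sqrr_sign.
by rewrite scale1r.
Qed.

Lemma adj_tens w u : adj (tens w u) = (if b then 1 else G) * tens u w.
Proof.
apply: (adjE Bnd); rewrite mulrA -(form_tr Bpar Bsym) /tens !trmx_mul trmxK.
by rewrite -[LHS]/(B^T *m _) -[RHS]/(_ *m B) !mulmxA.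
Qed.

Lemma tensNl w u : tens (- w) u = - tens w u.
Proof. by rewrite /tens !mulNmx. Qed.
Lemma tensNr w u : tens w (- u) = - tens w u.
Proof. by rewrite /tens linearN /= mulmxN mulNmx. Qed.
Lemma tensZl c w u : tens (c *: w) u = c *: tens w u.
Proof. by rewrite /tens -!scalemxAl. Qed.
Lemma tensZr c w u : tens w (c *: u) = c *: tens w u.
Proof. by rewrite /tens linearZ /= -scalemxAr -scalemxAl. Qed.
Lemma tens0l u : tens 0 u = 0.
Proof. by rewrite /tens !mul0mx. Qed.
Lemma tens0r w : tens w 0 = 0.
Proof. by rewrite /tens trmx0 mulmx0 mul0mx. Qed.

Lemma tens_entries w u v y : tens w u + tens v y = 0 ->
  forall i j, w i 0 * u j 0 + v i 0 * y j 0 = 0.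
Proof.
rewrite -mulmxDl => /(congr1 (mulmx^~ (invmx B))).
rewrite mulmxK ?form_unit // mul0mx => /matrixP h i j.
by have := h i j; rewrite mxE [X in X + _]mxE [X in _ + X]mxE !big_ord1 !mxE.
Qed.

Lemma tens_eq0 w u : tens w u = 0 -> w = 0 \/ u = 0.
Proof.
move=> h; have [->|nu] := eqVneq u 0; [by right | left].
have [j nj] : exists j, u j 0 != 0.
  apply: NNPP => hn; case/eqP: nu; apply/colP => j; rewrite mxE.
  by apply/eqP/negPn/negP => hj; apply: hn; exists j.
apply/colP => i; rewrite mxE; apply/eqP.
have := tens_entries (w := w) (u := u) (v := 0) (y := 0) _ i j.
rewrite h tens0l addr0 => /(_ erefl); rewrite !mxE mul0r addr0 => /eqP.
by rewrite mulf_eq0 (negbTE nj) orbF.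
Qed.

(** The symmetric algebra has no zero divisors: the diagonal entry at an index where [w] is nonzero
    gives one coordinate of [u], and the column through it gives the others. *)
Lemma tens_sym_eq0 w u : tens u w + tens w u = 0 -> w != 0 -> u = 0.
Proof.
move=> h nw; have [j nj] : exists j, w j 0 != 0.
  apply: NNPP => hn; case/eqP: nw; apply/colP => j; rewrite mxE.
  by apply/eqP/negPn/negP => hj; apply: hn; exists j.
have uj : u j 0 = 0.
  have /eqP := tens_entries h j j; rewrite [w j 0 * _]mulrC -mulr2n -mulr_natl mulf_eq0.
  by rewrite (negbTE (natf_neq0_char0 hk _)) // mulf_eq0 (negbTE nj) orbF => /eqP.
apply/colP => i; rewrite mxE; apply/eqP.
have /eqP := tens_entries h i j; rewrite uj mulr0 addr0 mulf_eq0.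
by rewrite (negbTE nj) orbF.
Qed.

Lemma mx_parity_eq0 Z : (forall v, G *m v = v -> Z *m v = 0) ->
  (forall v, G *m v = - v -> Z *m v = 0) -> Z = 0.
Proof.
move=> h0 h1; apply: eq_mx_vec => v; rewrite mul0mx.
have e0 : Z *m (v + G *m v) = 0.
  by apply: h0; rewrite mulmxDr -mulmxAv parmx_sq mul1mxv addrC.
have e1 : Z *m (v - G *m v) = 0.
  by apply: h1; rewrite mulmxBr -mulmxAv parmx_sq mul1mxv opprB.
have := congr2 +%R e0 e1; rewrite -mulmxDr addrACA subrr !addr0 -mulr2n -scaler_nat.
rewrite -scalemxAr => /eqP; rewrite scaler_eq0 (negbTE (natf_neq0_char0 hk _)) //=.
by move/eqP.
Qed.

Variable x : 'M[k]_N.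
Hypothesis gx : in_g B true x.

(** [x] commutes with [x * x] and reverses parity, so a homogeneous eigenvector [v] and [x *m v]
    provide both parities. *)
Lemma nonnilp_eigenpair : (x * x) ^+ N != 0 -> exists c u w,
  [/\ c != 0, u != 0 /\ w != 0, G *m u = u /\ G *m w = - w,
      (x * x) *m u = c *: u & (x * x) *m w = c *: w].
Proof.
move/nonnilp_eigenvector => [c [v0 [nc nv0 v0E]]].
have [cxx _] := skewcent_sqr hk Bnd Bpar gx.
have n1 : 1%:M *m v0 != 0 by rewrite mul1mx.
have [e [he Gv nv]] := homogeneous_part hk (parmx_sq k p q) (L := 1%:M) n1.
set v := v0 + _ in Gv nv; rewrite mul1mx in nv.
have vE : (x * x) *m v = c *: v.
  rewrite /v mulmxDr v0E -scalemxAr -mulmxAv -(commr_kG cxx) mulmxAv v0E -scalemxAr.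
  by rewrite scalerDr !scalerA [e * _]mulrC.
clearbody v.
have nxv : x *m v != 0.
  apply: contraNneq nv => z; move: vE; rewrite mulmxAv z mulmx0 => /esym/eqP.
  by rewrite scaler_eq0 (negbTE nc).
have xvE : (x * x) *m (x *m v) = c *: (x *m v).
  by rewrite -mulmxAv -mulrA mulmxAv vE -scalemxAr.
have Gxv : G *m (x *m v) = - (e *: (x *m v)).
  by rewrite -mulmxAv (Gx_anti hk Bnd Bpar gx) -scalemxAl mulmxAv Gv -scalemxAr scaleN1r.
case: he => he; rewrite he ?scaleN1r ?scale1r ?opprK in Gv Gxv.
  by exists c, v, (x *m v).
by exists c, (x *m v), v.
Qed.

Lemma ad_nilpotent_eigen T c : ad_nilpotent B x -> in_g B false T -> c != 0 ->
  (x * x) * T - T * (x * x) = (2 * c) *: T -> T = 0.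
Proof.
move=> [_ [n hn]] gT nc hT; have := hn _ gT.
set e := sbracket true true x x.
(* [[x, x]] is twice [x * x], which doubles the eigenvalue. *)
have st : sbracket false false e T = (2 * (2 * c)) *: T.
  rewrite /e /sbracket expr0 /= expr1 scaleN1r scale1r opprK.
  by rewrite mulmxDl mulmxDr opprD addrACA [_ - _]hT -mulr2n -scaler_nat scalerA.
have -> : iter n (sbracket false false e) T = (2 * (2 * c)) ^+ n *: T.
  elim: n {hn} => [|n IH]; first by rewrite expr0 scale1r.
  rewrite iterS IH exprSr -scalerA -st /sbracket expr0 !scale1r.
  by rewrite -scalemxAr -scalemxAl scalerBr.
move/eqP; rewrite scaler_eq0 expf_eq0 !mulf_eq0 (negbTE nc) (negbTE (natf_neq0_char0 hk _)) //=.
by rewrite andbF => /eqP.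
Qed.

End Tensors.

(** * Rank-one operators in osp *)

Section Orthosymplectic.
Variables (k : closedFieldType) (hk : [pchar k] =i pred0) (p q : nat).
Local Notation N := (p + q)%N.
Local Notation G := (parmx k p q).
Variable B : 'M[k]_N.
Hypotheses (Bnd : form_nondegenerate B) (Bpar : form_parity false B)
  (Bsym : form_supersymmetric B).
Local Notation adj := (adj B).
Local Notation V := 'cV[k]_N.
Local Notation tens := (tens B).

Lemma osp_tens_odd (w : V) : G *m w = - w -> in_g B false (tens w w).
Proof.
move=> Gw; apply/(in_g0P hk Bnd); split.
  by rewrite /GRing.comm tens_mull (tens_mulG hk Bnd Bpar) expr0 scale1r Gw tensNl tensNr.
by rewrite (adj_tens Bnd Bpar Bsym) tens_mull Gw tensNl.
Qed.

Lemma osp_tens_mixed (w v : V) : G *m w = - w -> G *m v = v ->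
  in_g B true (tens w v - tens v w).
Proof.
move=> Gw Gv; apply/(in_g1P hk Bnd Bpar); split.
  rewrite mulrBr mulrBl !tens_mull !(tens_mulG hk Bnd Bpar) expr0 !scale1r Gw Gv.
  by rewrite tensNl tensNr opprK opprD.
rewrite adjB !(adj_tens Bnd Bpar Bsym) !tens_mull expr0 scale1r mulrBr !tens_mull Gw Gv.
rewrite !tensNl; move: (tens w v) (tens v w) => t1 t2; mx_lin.
Qed.

(** An odd eigenvector [w] of [x * x] with eigenvalue [c] makes [tens w w] an eigenvector in g_0 for
    [2 c]. *)
Lemma osp_ad_nilpotent_nilp (x : 'M[k]_N) : in_g B true x -> ad_nilpotent B x ->
  x ^+ (2 * N) = 0.
Proof.
move=> gx hx; rewrite exprM expr2; apply/eqP/negPn/negP => nz.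
have [c [u [w [nc [nu nw] [Gu Gw] uE wE]]]] := nonnilp_eigenpair hk Bnd Bpar gx nz.
have [_ ae] := skewcent_sqr hk Bnd Bpar gx.
have T0 : tens w w = 0.
  apply: (ad_nilpotent_eigen hk hx (osp_tens_odd Gw) nc).
  rewrite tens_mull (tens_mulr_skew Bnd _ _ ae) wE tensZl tensZr opprK.
  by rewrite -scalerDl mulr_natl mulr2n.
by case: (tens_eq0 Bnd T0) => w0; rewrite w0 eqxx in nw.
Qed.

(** Commuting with [tens w w] forces [Z *m w = 0] for odd [w]; commuting with the mixed operators
    built on [w0] then treats even vectors, where multiplication by [G] separates the two terms. *)
Lemma osp_center0 (w0 : V) Z : w0 != 0 -> G *m w0 = - w0 -> in_center0 B Z -> Z = 0.
Proof.
move=> nw0 Gw0 [/(in_g0P hk Bnd)[GZ aZ] hZ].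
have odd0 (w : V) : G *m w = - w -> Z *m w = 0.
  move=> Gw; have [->|nw] := eqVneq w 0; first by rewrite mulmx0.
  have := hZ _ _ (osp_tens_odd Gw); rewrite /sbracket expr0 scale1r.
  rewrite -[Z *m _]/(Z * _) -[_ *m Z]/(_ * Z) tens_mull (tens_mulr_skew Bnd _ _ aZ) opprK.
  by move/(tens_sym_eq0 hk Bnd); apply.
apply: (mx_parity_eq0 hk) => // v Gv.
have := hZ _ _ (osp_tens_mixed Gw0 Gv); rewrite /sbracket expr0 scale1r.
rewrite -[Z *m _]/(Z * _) -[_ *m Z]/(_ * Z) mulrBr mulrBl !tens_mull.
rewrite !(tens_mulr_skew Bnd _ _ aZ) (odd0 _ Gw0) tens0l tens0r sub0r oppr0 subr0 opprK => e1.
have := congr1 ( *%R G) e1; rewrite mulr0 mulrDr mulrN !tens_mull Gw0 -mulmxAv GZ mulmxAv Gv.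
rewrite tensNl => e2; have := congr2 +%R e1 e2.
rewrite addr0 addrACA subrr addr0 -opprD => /eqP; rewrite oppr_eq0 -mulr2n -scaler_nat.
rewrite scaler_eq0 (negbTE (natf_neq0_char0 hk _)) //= => /eqP /(tens_eq0 Bnd) [] //.
by move=> w00; rewrite w00 eqxx in nw0.
Qed.
End Orthosymplectic.

(** * Rank-one operators in pe *)

Section Periplectic.
Variables (k : closedFieldType) (hk : [pchar k] =i pred0) (p q : nat).
Local Notation N := (p + q)%N.
Local Notation G := (parmx k p q).
Variable B : 'M[k]_N.
Hypotheses (Bnd : form_nondegenerate B) (Bpar : form_parity true B)
  (Bsym : form_supersymmetric B).
Local Notation adj := (adj B).
Local Notation V := 'cV[k]_N.
Local Notation tens := (tens B).

Lemma pe_tens_even (v : V) : G *m v = v -> in_g B true (tens v v).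
Proof.
move=> Gv; apply/(in_g1P hk Bnd Bpar).
rewrite tens_mull (tens_mulG hk Bnd Bpar) expr1 !scaleN1r Gv !opprK; split=> //.
by rewrite (adj_tens Bnd Bpar Bsym) mul1r.
Qed.

Lemma pe_tens_mixed (w u : V) : G *m w = - w -> G *m u = u ->
  in_g B false (tens w u - tens u w).
Proof.
move=> Gw Gu; apply/(in_g0P hk Bnd); split.
  rewrite /GRing.comm mulrBr mulrBl !tens_mull !(tens_mulG hk Bnd Bpar) expr1 !scaleN1r Gw Gu.
  by rewrite tensNl tensNr opprK.
by rewrite adjB !(adj_tens Bnd Bpar Bsym) !mul1r opprB.
Qed.

Lemma pe_ad_nilpotent_nilp (x : 'M[k]_N) : in_g B true x -> ad_nilpotent B x ->
  x ^+ (2 * N) = 0.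
Proof.
move=> gx hx; rewrite exprM expr2; apply/eqP/negPn/negP => nz.
have [c [u [w [nc [nu nw] [Gu Gw] uE wE]]]] := nonnilp_eigenpair hk Bnd Bpar gx nz.
have [_ ae] := skewcent_sqr hk Bnd Bpar gx.
have T0 : tens w u - tens u w = 0.
  apply: (ad_nilpotent_eigen hk hx (pe_tens_mixed Gw Gu) nc).
  rewrite mulrBr mulrBl !tens_mull !(tens_mulr_skew Bnd _ _ ae) uE wE !tensZl !tensZr.
  move: (tens w u) (tens u w) => t1 t2.
  by apply/matrixP => i j; rewrite !mxE; ring.
have := congr1 ( *%R G) T0; rewrite mulr0 mulrBr !tens_mull Gu Gw tensNl => e2.
have := congr2 +%R T0 e2; rewrite addr0 addrACA subrr add0r -opprD => /eqP.
rewrite oppr_eq0 -mulr2n -scaler_nat scaler_eq0 (negbTE (natf_neq0_char0 hk _)) //=.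
by move=> /eqP /(tens_eq0 Bnd) [] z; [rewrite z eqxx in nu | rewrite z eqxx in nw].
Qed.

Lemma pe_center0 Z : in_center0 B Z -> Z = 0.
Proof.
move=> [/(in_g0P hk Bnd)[GZ aZ] hZ].
have even0 (v : V) : G *m v = v -> Z *m v = 0.
  move=> Gv; have [->|nv] := eqVneq v 0; first by rewrite mulmx0.
  have := hZ _ _ (pe_tens_even Gv); rewrite /sbracket expr0 scale1r.
  rewrite -[Z *m _]/(Z * _) -[_ *m Z]/(_ * Z) tens_mull (tens_mulr_skew Bnd _ _ aZ) opprK.
  by move/(tens_sym_eq0 hk Bnd); apply.
apply: (mx_parity_eq0 hk) => // w Gw; apply: (bform_eq0r Bnd) => u.
(* [Z *m w] is odd, so it pairs with the even part of [u] only; skewness moves [Z] to that even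
   part, which [Z] kills. *)
have GZw : G *m (Z *m w) = - (Z *m w) by rewrite -mulmxAv GZ mulmxAv Gw mulmxN.
have e1 : bform B (G *m u) (Z *m w) = bform B u (Z *m w).
  rewrite (bform_adj Bnd) (adj_parmx hk Bnd Bpar) -scalemxAl GZw expr1 scaleN1r opprK.
  by [].
have e2 : bform B (u + G *m u) (Z *m w) = 0.
  have -> : Z *m w = - (adj Z *m w) by rewrite aZ mulNmx opprK.
  rewrite bformN -(bform_adj Bnd) even0 ?/bform ?trmx0 ?mul0mx ?mxE ?oppr0 //.
  by rewrite mulmxDr -mulmxAv parmx_sq mul1mxv addrC.
have : 2 * bform B u (Z *m w) = 0.
  rewrite mulrDl mul1r -{1}e1 -[RHS]e2 /bform linearD /= !mulmxDl [RHS]mxE addrC //.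
move/eqP; rewrite mulf_eq0 (negbTE (natf_neq0_char0 hk _)) //= => /eqP //.
Qed.
End Periplectic.

(** * The triples attached to a distinguished element *)

Section DistinguishedFrame.
Variables (k : closedFieldType) (hk : [pchar k] =i pred0) (p q : nat).
Local Notation N := (p + q)%N.
Local Notation G := (parmx k p q).
Variables (b : bool) (B : 'M[k]_N).
Hypotheses (Bnd : form_nondegenerate B) (Bpar : form_parity b B)
  (Bsym : form_supersymmetric B).
Hypothesis center0 : forall Z, in_center0 B Z -> Z = 0.
Variable x : 'M[k]_N.
Hypotheses (gx : in_g B true x) (dist : distinguished B x).
Local Notation adj := (adj B).

Lemma distinguished_x_nilp : x ^+ (2 * N) = 0.
Proof.
rewrite exprM expr2; apply: (distinguished_nilp hk Bnd Bpar Bsym gx center0 dist).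
exact: (skewcent_sqr hk Bnd Bpar gx).
Qed.

Lemma distinguished_frame : exists r (v : 'I_r -> 'cV[k]_N) (d : 'I_r -> nat) (c : 'I_r -> k),
  [/\ jordan_frame x v d, forall i, G *m v i = c i *: v i, forall i, odd (d i) = ~~ b &
      forall i j a a', (a < d i)%N -> (a' < d j)%N -> i != j \/ (a + a' != (d i).-1)%N ->
        bform B (chain x (v i) (d i) a) (chain x (v j) (d j) a') = 0].
Proof.
have [r [E [E1 pE E0]]] := selfadjoint_prims hk Bnd Bpar Bsym gx center0 dist.
have pE1 i : prim_idem (kx_gens G x) (E i) by case: (pE i).
have aE i : adj (E i) = E i by case: (pE i).
by exists r; apply: (normal_frame hk Bnd Bpar Bsym gx distinguished_x_nilp E1 pE1 aE E0).
Qed.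
End DistinguishedFrame.

Lemma half_odd a : a = (odd a + 2 * a./2)%N.
Proof. by rewrite mul2n odd_double_half. Qed.

Lemma natr_half (R : pzRingType) a : a%:R = (odd a)%:R + 2 * (a./2)%:R :> R.
Proof. by rewrite {1}(half_odd a) natrD natrM. Qed.

Lemma half_sub2 a : (1 < a)%N -> a./2 = (a - 2)./2.+1 /\ odd (a - 2) = odd a.
Proof. by move=> a1; have := subnK a1; rewrite addn2 => <-; rewrite /= negbK subSS subSS subn0. Qed.

(** For [d = 2 D + 1], the even- and the odd-numbered vectors of a chain span sl_2-modules of
    highest weights [D] and [D - 1]; [g] is the usual coefficient [(m + 1) (weight - m)] with
    [m = a./2]. *)
Lemma osp_triple (k : closedFieldType) (hk : [pchar k] =i pred0) p q (B x : 'M[k]_(p + q)) :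
  form_nondegenerate B -> form_parity false B -> form_supersymmetric B ->
  (forall Z, in_center0 B Z -> Z = 0) -> in_g B true x -> distinguished B x ->
  exists h f, [/\ in_g B false h, in_g B false f, sl2 (x * x) h f & h * x - x * h = x].
Proof.
move=> Bnd Bpar Bsym center0 gx dist.
have [r [v [d [c [jf Gv dodd gram]]]]] := distinguished_frame hk Bnd Bpar Bsym center0 gx dist.
have [d0 xv fr] := jf.
have [|||h [f [gh hE fE gf hs]]] := sl2_of_frame hk Bnd Bpar Bsym gx jf Gv gram
  (phi := fun i a => (d i)./2%:R - a%:R)
  (g := fun i a => a./2.+1%:R * ((d i)./2%:R - a./2%:R - (odd a)%:R)).
- move=> i a a' _ _ e; rewrite addrACA -opprD -!natrD e.
  by rewrite (_ : (d i)./2 + (d i)./2 = (d i).-1)%N ?subrr //; have := dodd i; lia.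
- by move=> i a _; ring.
- move=> i a ad /=; have /= dO := dodd i.
  have -> : (if (a.+2 < d i)%N then a./2.+1%:R * ((d i)./2%:R - a./2%:R - (odd a)%:R) else 0)
      = a./2.+1%:R * ((d i)./2%:R - a./2%:R - (odd a)%:R) :> k.
    case: ltnP => // le; have -> : (d i)./2 = (a./2 + odd a)%N by lia.
    by rewrite natrD; ring.
  have -> : (if (2 <= a)%N then (a - 2)./2.+1%:R * ((d i)./2%:R - (a - 2)./2%:R - (odd (a - 2))%:R) else 0)
      = a./2%:R * ((d i)./2%:R - a./2%:R + 1 - (odd a)%:R) :> k.
    case: ltnP => le; last by rewrite (_ : a./2 = 0%N) ?mul0r //; lia.
    by have [-> ->] := half_sub2 le; ring.
  by rewrite [in RHS](natr_half _ a); ring.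
exists h, (2^-1 *: (f - adj B f)); split=> //.
apply: (frame_uniq fr) => i [|a] ad; rewrite mulmxBl !mulmxAv hE // -scalemxAr.
  by rewrite !chain0 // mulmx0 scaler0 subrr.
rewrite chainS // hE ?(ltnW ad) // -scalerBl -[RHS]scale1r; congr (_ *: _); ring.
Qed.

Section PeTriple.
Variables (k : closedFieldType) (hk : [pchar k] =i pred0) (p q : nat).
Local Notation G := (parmx k p q).

(** For [d = 2 D], the even- and the odd-numbered vectors both span an sl_2-module of highest weight
    [D - 1], whence [phi] and [g]. *)
Lemma pe_triple (B x : 'M[k]_(p + q)) :
  form_nondegenerate B -> form_parity true B -> form_supersymmetric B ->
  (forall Z, in_center0 B Z -> Z = 0) -> in_g B true x -> distinguished B x ->
  exists h f a, [/\ in_g B false h /\ in_g B false f, in_g B true a /\ in_g B true (x - a),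
    sl2 (x * x) h f, h * a = a * h /\ f * a = a * f &
    h * (x - a) - (x - a) * h = 2 *: (x - a) /\ a * (x - a) + (x - a) * a = x * x].
Proof.
move=> Bnd Bpar Bsym center0 gx dist.
have [r [v [d [c [jf Gv dodd gram]]]]] := distinguished_frame hk Bnd Bpar Bsym center0 gx dist.
have [d0 xv fr] := jf.
have [|||h [f [gh hE fE gf hs]]] := sl2_of_frame hk Bnd Bpar Bsym gx jf Gv gram
  (phi := fun i a => (d i)./2%:R - 1 - 2 * a./2%:R)
  (g := fun i a => a./2.+1%:R * ((d i)./2%:R - 1 - a./2%:R)).
- move=> i a a' _ _ e.
  have -> : (d i)./2 = (a./2 + a'./2).+1 by have := dodd i; have := d0 i => /=; lia.
  by rewrite -natr1 natrD; ring.
- by move=> i a _ /=; ring.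
- move=> i a ad /=; have /= dO := dodd i.
  have -> : (if (a.+2 < d i)%N then a./2.+1%:R * ((d i)./2%:R - 1 - a./2%:R) else 0)
      = a./2.+1%:R * ((d i)./2%:R - 1 - a./2%:R) :> k.
    case: ltnP => // le; have -> : (d i)./2 = (a./2).+1 by lia.
    by ring.
  have -> : (if (2 <= a)%N then (a - 2)./2.+1%:R * ((d i)./2%:R - 1 - (a - 2)./2%:R) else 0)
      = a./2%:R * ((d i)./2%:R - a./2%:R) :> k.
    case: ltnP => le; last by rewrite (_ : a./2 = 0%N) ?mul0r //; lia.
    by have [-> _] := half_sub2 le; ring.
  by ring.
pose ch i m := chain x (v i) (d i) m.
(* [a] is the part of [x] that maps odd-numbered vectors to even-numbered ones; it intertwines the
   two sl_2-modules. *)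
have [a aE] := frame_ext (fun i m => if odd m then ch i m.-1 else 0) fr.
have bE i m : (m < d i)%N -> (x - a) *m ch i m = if odd m then 0 else if m is m'.+1 then ch i m' else 0.
  move=> md; rewrite mulmxBl aE // /ch; case: m md => [|m] md /=; first by rewrite chain0 ?subr0.
  by rewrite chainS //; case: (odd m); rewrite ?subrr ?subr0.
have ha : h * a = a * h.
  apply: (frame_uniq fr) => i m md; rewrite !mulmxAv hE // -scalemxAr aE //.
  case: m md => [|m] md /=; first by rewrite mulmx0 scaler0.
  case: ifP => om; last by rewrite mulmx0 scaler0.
  rewrite /ch hE ?(ltnW md) //; have -> : uphalf m = m./2 by lia.
  by [].
have hb : h * (x - a) - (x - a) * h = 2 *: (x - a).
  apply: (frame_uniq fr) => i m md; rewrite mulmxBl !mulmxAv hE // -scalemxAr -[in RHS]scalemxAl bE //.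
  case: m md => [|m] md /=; first by rewrite mulmx0 !scaler0 subrr.
  case: ifP => om; first by rewrite mulmx0 !scaler0 subrr.
  rewrite hE ?(ltnW md) // -scalerBl; congr (_ *: _).
  have -> : (uphalf m) = m./2.+1 by lia.
  by ring.
have abba : a * (x - a) + (x - a) * a = x * x.
  apply: (frame_uniq fr) => i m md; rewrite mulmxDl !mulmxAv bE // aE //.
  case: m md => [|[|m]] md /=.
  - by rewrite !mulmx0 addr0 chain0 // mulmx0.
  - by rewrite mulmx0 add0r bE //= chainS // chain0.
  rewrite chainS // chainS ?(ltnW md) // !negbK; case: ifP => om.
    by rewrite mulmx0 add0r (bE i m.+1) ?(ltnW md) //= om.
  by rewrite mulmx0 addr0 (aE i m.+1) ?(ltnW md) //= om.
have fa : f * a = a * f.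
  apply: (frame_uniq fr) => i m md; rewrite !mulmxAv fE // -scalemxAr aE //.
  case: m md => [|m] md /=.
    rewrite mulmx0; have [m2|m2] := ltnP 2 (d i).
      by rewrite aE //= scaler0.
    by rewrite [chain _ _ _ 2]/chain ltnNge m2 mulmx0 scaler0.
  have [om|om] := boolP (odd m).
    rewrite /= mulmx0; have [m2|m2] := ltnP m.+3 (d i).
      by rewrite aE //= om scaler0.
    by rewrite [chain _ _ _ m.+3]/chain ltnNge m2 mulmx0 scaler0.
  rewrite /= /ch fE ?(ltnW md) //; have -> : uphalf m = m./2 by lia.
  have [m2|m2] := ltnP m.+3 (d i); first by rewrite aE //= om.
  rewrite [chain _ _ _ m.+3]/chain ltnNge m2 /= mulmx0 scaler0.
  have dm : d i = m.+2 by have := dodd i; have := d0 i => /=; lia.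
  by rewrite [chain _ _ _ m.+2]/chain dm ltnn scaler0.
have [Gh ah] := (in_g0P hk Bnd h).1 gh.
have [Gx ax] := (in_g1P hk Bnd Bpar x).1 gx.
(* As [a] has weight 0 and [x - a] weight 2, the latter is half of [[h, x]]. *)
have gb : in_g B true (x - a).
  have bx : x - a = 2^-1 *: (h * x - x * h).
    have -> : h * x - x * h = 2 *: (x - a).
      by rewrite -hb !mulrBr !mulrBl ha; mx_lin.
    by rewrite scalerA mulVf ?scale1r // natf_neq0_char0.
  rewrite bx; apply/(in_g1P hk Bnd Bpar); rewrite expr1 scaleN1r opprK in ax *.
  have e1 : G * (h * x) = - (h * x * G) by rewrite mulrA Gh -mulrA Gx mulrN mulrA.
  have e2 : G * (x * h) = - (x * h * G) by rewrite mulrA Gx mulNr -!mulrA Gh.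
  split; first by rewrite -scalerMr -scalerMl -scalerN mulrBr e1 e2 mulrBl opprB opprK addrC.
  rewrite scaleN1r opprK adjZ adjB !(adjM Bnd) ah ax -scalerMr; congr (_ *: _).
  by rewrite mulrBr mulrN mulNr opprK !mulrA Gh addrC.
have ga : in_g B true a.
  have [Gb ab] := (in_g1P hk Bnd Bpar _).1 gb.
  have aE' : a = x - (x - a) by rewrite subKr.
  rewrite aE'; apply/(in_g1P hk Bnd Bpar); split.
    by rewrite mulrBr mulrBl Gx Gb opprB opprK addrC.
  move: ab; rewrite expr1 !scaleN1r !opprK => ab; rewrite adjB ab [in RHS]mulrBr.
  move: (ax); rewrite ?expr1 ?scaleN1r ?opprK => ax1. by rewrite ax1.
have Gf : GRing.comm G f by exact: (frame_even hk Bnd Bpar gx jf Gv fE).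
have [Ga aa] := (in_g1P hk Bnd Bpar a).1 ga.
(* Since [adj a = G * a], the adjoint of [f * a = a * f] shows that [adj f] commutes with [G * a],
   hence with [a]. *)
have ffa : (2^-1 *: (f - adj B f)) * a = a * (2^-1 *: (f - adj B f)).
  have Gf' := adj_even hk Bnd Bpar Gf.
  have GGa : G * (G * a) = a by rewrite mulrA parmx_sq mul1r.
  have e1 : G * a * adj B f = adj B f * (G * a).
    have := congr1 (@adj _ _ _ B) fa; rewrite !(adjM Bnd) aa expr1 scaleN1r opprK.
    by [].
  have e2 : a * adj B f = adj B f * a.
    rewrite -{1}GGa -mulrA e1 mulrA [G * adj B f]Gf' -mulrA GGa //.
  by rewrite -scalerMl -scalerMr mulrBl mulrBr fa e2.
by exists h, (2^-1 *: (f - adj B f)), a.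
Qed.
End PeTriple.

(** * Jordan blocks in representations *)

Section Bracket.
Variables (k : fieldType) (p q : nat).
Implicit Types X Y : 'M[k]_(p + q).

Lemma sbracket0 d X Y : sbracket false d X Y = X * Y - Y * X.
Proof. by rewrite /sbracket expr0 scale1r. Qed.

Lemma sbracket1 X Y : sbracket true true X Y = X * Y + Y * X.
Proof. by rewrite /sbracket expr1 scaleN1r opprK. Qed.
End Bracket.

Section Representation.
Variables (k : closedFieldType) (hk : [pchar k] =i pred0) (p q : nat).
Variables (B : 'M[k]_(p + q)) (Gp : 'M[k]_(p + q) -> Prop) (M : repG B Gp).
Local Notation rho := (rep_act M).
Implicit Types (X Y x : 'M[k]_(p + q)).

Lemma rep_commutator d X Y : in_g B false X -> in_g B d Y ->
  rho (X * Y - Y * X) = rho X * rho Y - rho Y * rho X.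
Proof. by move=> gX gY; rewrite -(sbracket0 d X Y) (rep_bracket M gX gY) sbracket0. Qed.

Lemma rep_anticommutator X Y : in_g B true X -> in_g B true Y ->
  rho (X * Y + Y * X) = rho X * rho Y + rho Y * rho X.
Proof. by move=> gX gY; rewrite -(sbracket1 X Y) (rep_bracket M gX gY) sbracket1. Qed.

(** A representation respects brackets only, but [x * x] is half of [[x, x]]. *)
Lemma rep_sqr x : in_g B true x -> rho (x * x) = rho x * rho x.
Proof.
move=> gx; have := rep_anticommutator gx gx.
rewrite -!mulr2n -!scaler_nat linearZ => /(congr1 (fun z => 2^-1 *: z)).
by rewrite /= !scalerA mulVf ?scale1r // natf_neq0_char0.
Qed.

Lemma rep_sl2 e h f : in_g B false e -> in_g B false h -> in_g B false f ->
  sl2 e h f -> sl2 (rho e) (rho h) (rho f).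
Proof.
move=> ge gh gf [he hf ef].
by split; rewrite -(rep_commutator (d := false)) // ?he ?hf ?ef ?linearZ.
Qed.

Lemma rep_nilp x h f : in_g B true x -> in_g B false (x * x) -> in_g B false h -> in_g B false f ->
  sl2 (x * x) h f -> rho x ^+ (rep_dim0 M + rep_dim1 M) = 0.
Proof.
move=> gx gxx gh gf /(rep_sl2 gxx gh gf) /(sl2E_nilp hk) e.
by apply: (nilp_expN (n := 2 * (rep_dim0 M + rep_dim1 M))); rewrite exprM expr2 -rep_sqr.
Qed.

Lemma rep_odd_jordan x h f : in_g B true x -> in_g B false (x * x) -> in_g B false h ->
  in_g B false f -> sl2 (x * x) h f -> h * x - x * h = x ->
  exists l (s : 'I_l -> nat), nil_jordan_type (rho x) s /\ forall i, odd (s i).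
Proof.
move=> gx gxx gh gf hef hx; have xn := rep_nilp gx gxx gh gf hef.
apply: (jordan_sizes hk (P := odd) xn) => d u w d0 ed uE xu.
have dE : d = (2 * d./2)%N by rewrite mul2n -[LHS]odd_double_half (negbTE ed).
rewrite dE in uE *; apply: (odd_chain hk (rep_sl2 gxx gh gf hef) _ _ _ uE xu).
- by rewrite -(rep_commutator gh gx) hx.
- by rewrite rep_sqr.
- by lia.
Qed.

Lemma rep_even_jordan x h f a : in_g B true x -> in_g B false (x * x) -> in_g B false h ->
  in_g B false f -> in_g B true a -> in_g B true (x - a) ->
  sl2 (x * x) h f -> h * a = a * h -> f * a = a * f ->
  h * (x - a) - (x - a) * h = 2 *: (x - a) -> a * (x - a) + (x - a) * a = x * x ->
  exists l (s : 'I_l -> nat), nil_jordan_type (rho x) s /\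
    forall i, s i = 1%N \/ ~~ odd (s i).
Proof.
move=> gx gxx gh gf ga gb hef ha fa hb abba.
have xn := rep_nilp gx gxx gh gf hef.
have rhef := rep_sl2 gxx gh gf hef.
have comm0 z : in_g B false z -> z * a = a * z -> rho z * rho a = rho a * rho z.
  by move=> gz za; apply/eqP; rewrite -subr_eq0 -(rep_commutator gz ga) za subrr linear0.
have Ha := comm0 _ gh ha; have Fa := comm0 _ gf fa.
have Hb : rho h * rho (x - a) - rho (x - a) * rho h = 2 *: rho (x - a).
  by rewrite -(rep_commutator gh gb) hb linearZ.
have ABBA : rho a * rho (x - a) + rho (x - a) * rho a = rho (x * x).
  by rewrite -(rep_anticommutator ga gb) abba.
have xE : rho x = rho a + rho (x - a) by rewrite -linearD addrC subrK.
have xx := rep_sqr gx.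
have [l [s [js ps]]] : exists l (s : 'I_l -> nat),
    nil_jordan_type (rho x) s /\ forall i, (s i == 1%N) || ~~ odd (s i).
  apply: (jordan_sizes hk (P := fun s => (s == 1%N) || ~~ odd s) xn) => d u w d0.
  rewrite negb_or negbK => /andP[d1 od] uE xu.
  have dE : d = (2 * d./2).+1 by rewrite mul2n -[LHS]odd_double_half od.
  rewrite dE /= xE in uE xu *.
  (* [T] is the image of [[x - a, f]]. As [a] commutes with [f], the anticommutator of [a] with it
     is [[x^2, f] = h]. *)
  apply: (even_chain hk rhef (T := rho (x - a) * rho f - rho f * rho (x - a)) _ Ha Hb _ _ _ uE xu).
  - by rewrite -xE -xx.
  - case: rhef Hb => _ hf _; move: (rho h) (rho f) (rho (x - a)) hf => H F b hf Hb.
    have hF : H * F = F * H - 2 *: F by rewrite -scaleNr -hf addrC subrK.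
    have hB : H * b = b * H + 2 *: b by rewrite -Hb addrC subrK.
    rewrite mulrBr mulrBl !mulrA hF hB mulrDl mulrBl -!mulrA hF hB mulrBr mulrDr.
    by rewrite -!scalerMl -!scalerMr; move: (b * (F * H)) (F * (b * H)) (F * b) (b * F) => *; mx_lin.
  - case: rhef => _ _ <-; rewrite -ABBA; move: (rho (x - a)) (rho f) (rho a) Fa => b F A Fa.
    have e1 : A * (F * b) = F * (A * b) by rewrite !mulrA Fa.
    have e2 : b * F * A = b * A * F by rewrite -!mulrA Fa.
    rewrite mulrBr mulrBl mulrDl mulrDr e1 e2 !mulrA.
    by move: (A * b * F) (F * A * b) (b * A * F) (F * b * A) => *; mx_lin.
  - by lia.
exists l, s; split=> // i; have /orP[/eqP|] := ps i; by [left|right].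
Qed.
End Representation.

Lemma odd_vector (k : fieldType) (hk : [pchar k] =i pred0) p q : (0 < q)%N ->
  exists2 w : 'cV[k]_(p + q), w != 0 & parmx k p q *m w = - w.
Proof.
case: q => // q _; pose i : 'I_(p + q.+1) := rshift p ord0.
have pi : ipar i = true by rewrite /ipar /= leq_addr.
exists (delta_mx i 0).
  by apply/eqP => /matrixP/(_ i 0); rewrite !mxE !eqxx => /eqP; rewrite oner_eq0.
by have := @hvec_delta k p q.+1 i; rewrite (hvecP hk) pi expr1 scaleN1r.
Qed.

Theorem lemma7p4p9 (k : closedFieldType) (hk : [pchar k] =i pred0) :
  (forall (m n : nat), (0 < m)%N -> (0 < n)%N ->
   forall B : 'M[k]_(m + 2 * n),
     form_nondegenerate B -> form_parity false B -> form_supersymmetric B ->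
   forall x : 'M[k]_(m + 2 * n), in_g B true x ->
     (ad_nilpotent B x -> (distinguished B x <-> orthogonal_decomposition B x))
     /\ (distinguished B x -> neat B (in_SOSp B) x))
  /\
  (forall n : nat, (0 < n)%N ->
   forall B : 'M[k]_(n + n),
     form_nondegenerate B -> form_parity true B -> form_supersymmetric B ->
   forall x : 'M[k]_(n + n), in_g B true x ->
     (ad_nilpotent B x -> (distinguished B x <-> orthogonal_decomposition B x))
     /\ (distinguished B x -> balanced B (in_GL B) x)).
Proof.
split=> [m n m0 n0|n n0] B Bnd Bpar Bsym x gx.
  have n2 : (0 < 2 * n)%N by rewrite muln_gt0.
  have [w nw Gw] := odd_vector hk m n2.
  have center0 Z := @osp_center0 _ hk _ _ _ Bnd Bpar Bsym w Z nw Gw.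
  have gxx := in_g_sqr hk Bnd Bpar gx.
  split=> [xnil|dist].
    split; first exact: (distinguished_decomposition hk Bnd Bpar Bsym gx center0).
    exact: (decomposition_distinguished hk Bnd Bpar Bsym (osp_ad_nilpotent_nilp hk Bnd Bpar Bsym gx xnil)).
  split.
    exact: (nilp_ad_nilpotent hk Bnd Bpar Bsym gx (distinguished_x_nilp hk Bnd Bpar Bsym center0 gx dist)).
  have [h [f [gh gf hef hx]]] := osp_triple hk Bnd Bpar Bsym center0 gx dist.
  by move=> M; apply: (rep_odd_jordan hk M gx gxx gh gf hef hx).
have center0 := @pe_center0 _ hk _ _ _ Bnd Bpar Bsym.
have gxx := in_g_sqr hk Bnd Bpar gx.
split=> [xnil|dist].
  split; first exact: (distinguished_decomposition hk Bnd Bpar Bsym gx center0).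
  exact: (decomposition_distinguished hk Bnd Bpar Bsym (pe_ad_nilpotent_nilp hk Bnd Bpar Bsym gx xnil)).
split.
  exact: (nilp_ad_nilpotent hk Bnd Bpar Bsym gx (distinguished_x_nilp hk Bnd Bpar Bsym center0 gx dist)).
have [h [f [a [[gh gf] [ga gb] hef [ha fa] [hb abba]]]]] := pe_triple hk Bnd Bpar Bsym center0 gx dist.
by move=> M; apply: (rep_even_jordan hk M gx gxx gh gf ga gb hef ha fa hb abba).
Qed.
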